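(* For every $\epsilon>0$, letting $P_{n,d}(\epsilon):=\{p\in P_{n,d}:\mathsf d_{\mathrm{FS}}(p,\Delta_{n,d})\ge\epsilon\}$, the identity map $\mathrm{id}:(P_{n,d}(\epsilon),\mathsf d_{\mathrm{FS}})\to(P_{n,d}(\epsilon),W_2^{\mathrm{in}})$ is Lipschitz. In particular $P_{n,d}(\epsilon)$ is compact in the $W_2^{\mathrm{in}}$-topology.
   Context: $P_{n,d}$ is the projectivization of the space of complex homogeneous polynomials of degree $d$ in $n+1$ variables, $\Delta_{n,d}$ its discriminant (classes of polynomials with a singular projective zero). $\mathsf d_{\mathrm{FS}}$ is the Fubini–Study distance on $P_{n,d}\cong\mathbb{C}\mathrm{P}^N$ induced by the Bombieri–Weyl Hermitian product (monomials $\sqrt{d!/(\alpha_0!\cdots\alpha_n!)}z^\alpha$ orthonormal). $W_2^{\mathrm{in}}$ is the inner Wasserstein distance on $P_{n,d}$: with $\mu(p)\in\mathscr{P}(\mathbb{C}\mathrm{P}^n)$ defined by $\int f\,\mathrm{d}\mu(p)=\frac1d\int_{\mathbb{G}(1,n)}\sum_{z\in Z(p)\cap\ell}m_z(p|_\ell)f(z)\,\mathrm{vol}_{\mathbb{G}(1,n)}(\mathrm{d}\ell)$, a curve $\gamma$ is admissible if $\mu\circ\gamma$ is 2-absolutely continuous in $(\mathscr{P}(\mathbb{C}\mathrm{P}^n),W_2)$ (Fubini–Study cost), $\mathcal{E}(\gamma)=\int_0^1|\dot\mu_t|^2\mathrm{d}t$ with $|\dot\mu_t|$ the $W_2$ metric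 speed, and $W_2^{\mathrm{in}}(p_0,p_1)=\inf\mathcal{E}(\gamma)^{1/2}$ over admissible curves from $p_0$ to $p_1$. *)

(* Defs.v *)
From HB Require Import structures.
From mathcomp Require Import all_boot all_order all_algebra.
From mathcomp Require Import all_classical all_reals all_analysis.
From mathcomp Require Import complex.
Set Implicit Arguments.
Unset Strict Implicit.
Unset Printing Implicit Defensive.
Import Order.TTheory GRing.Theory Num.Theory.
Import numFieldNormedType.Exports.
Local Open Scope classical_set_scope.
Local Open Scope ring_scope.

Section Defs.
Variable R : realType.
Local Notation C := (complex R).

Definition cvec (n : nat) := {ffun 'I_n.+1 -> C}.

Definition cabs2 (z : C) : R := complex.Re z ^+ 2 + complex.Im z ^+ 2.

Definition cconj (z : C) : C := Complex (complex.Re z) (- complex.Im z).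

Definition realC (r : R) : C := Complex r 0.

Definition hdot n (x y : cvec n) : C := \sum_i x i * cconj (y i).

Definition vnorm2 n (x : cvec n) : R := \sum_i cabs2 (x i).

(* Fubini--Study (geodesic) distance between the lines through two nonzero
   vectors, for a Hermitian product with value h = <x,y>, |x|^2 = a, |y|^2 = b *)
Definition fs_of (h : C) (a b : R) : R :=
  acos (Num.sqrt (cabs2 h) / Num.sqrt (a * b)).

Definition fs_dist n (x y : cvec n) : R := fs_of (hdot x y) (vnorm2 x) (vnorm2 y).

Definition lead_coord n (x : cvec n) : C :=
  head 0 [seq c <- [seq x i | i <- enum 'I_n.+1] | c != 0].

(* canonical representative of a point of CP^n: a unit vector whose first
   nonzero coordinate is a positive real *)
Definition is_rep n (x : cvec n) : bool := (vnorm2 x == 1) && (0 < lead_coord x).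

Definition CPn n := {x : cvec n | is_rep x}.
HB.instance Definition _ n := Choice.copy (CPn n) {x : cvec n | is_rep x}.
HB.instance Definition _ n := SubChoice.copy (CPn n) {x : cvec n | is_rep x}.

Definition e0 n : cvec n := [ffun i => (i == ord0)%:R].

Lemma e0_rep n : is_rep (e0 n).
Proof.
apply/andP; split.
  rewrite /vnorm2 (bigD1 ord0) //= big1 => [|i /negbTE ni0].
    by rewrite /cabs2 ffunE eqxx /= expr0n /= addr0 expr1n addr0.
  by rewrite /cabs2 ffunE ni0 /= expr0n /= addr0.
rewrite /lead_coord enum_ordSl /= ffunE eqxx /= oner_eq0 /=.
by rewrite ltr01.
Qed.

Definition cp_base n : CPn n := exist _ (e0 n) (e0_rep n).

HB.instance Definition _ n := isPointed.Build (CPn n) (cp_base n).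

Definition nrm n (x : cvec n) : cvec n :=
  let c := lead_coord x in
  [ffun i => (`|c| / c) * realC (Num.sqrt (vnorm2 x))^-1 * x i].

(* the point [x] of CP^n (arbitrary for x = 0) *)
Definition proj n (x : cvec n) : CPn n := insubd (cp_base n) (nrm x).

Definition fs_open n : set (set (CPn n)) :=
  [set U | forall x, U x -> exists2 r : R, 0 < r &
     forall y, fs_dist (val x) (val y) < r -> U y].

Definition CP n := g_sigma_algebraType (@fs_open n).
HB.instance Definition _ n := Pointed.on (CP n).
HB.instance Definition _ n :=
  Measurable.copy (CP n) (g_sigma_algebraType (@fs_open n)).

Definition esqrt (x : \bar R) : \bar R :=
  match x with
  | r%:E => (Num.sqrt r)%:E
  | +oo%E => +oo%E
  | -oo%E => 0%E
  end.

Definition is_coupling n (mu nu : set (CP n) -> \bar R)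
    (pi : probability (CP n * CP n)%type R) : Prop :=
  (forall A : set (CP n), measurable A -> pi (A `*` setT) = mu A) /\
  (forall B : set (CP n), measurable B -> pi (setT `*` B) = nu B).

Definition W2 n (mu nu : set (CP n) -> \bar R) : \bar R :=
  esqrt (ereal_inf [set (\int[pi]_z ((fs_dist (val z.1) (val z.2)) ^+ 2)%:E)%E
                   | pi in [set pi | is_coupling mu nu pi]]).

Definition mon (n d : nat) := {a : {ffun 'I_n.+1 -> 'I_d.+1} | (\sum_i (a i : nat) == d)%N}.

Definition hpoly (n d : nat) := {ffun mon n d -> C}.

Definition mono n d (a : mon n d) (z : cvec n) : C := \prod_i z i ^+ (val a i).

Definition peval n d (p : hpoly n d) (z : cvec n) : C := \sum_a p a * mono a z.

Definition pderiv_eval n d (p : hpoly n d) (i : 'I_n.+1) (z : cvec n) : C :=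
  \sum_a p a * ((val a i : nat)%:R * \prod_j z j ^+ (val a j - (j == i))).

(* Bombieri--Weyl Hermitian product: the monomials sqrt(d!/a!) z^a are orthonormal *)
Definition bw n d (p q : hpoly n d) : C :=
  \sum_a p a * cconj (q a) * ((\prod_i (val a i : nat)`!)%:R / (d`!)%:R).

(* Fubini--Study distance on P_{n,d} (on nonzero representatives) *)
Definition dFS n d (p q : hpoly n d) : R :=
  fs_of (bw p q) (complex.Re (bw p p)) (complex.Re (bw q q)).

Definition Delta n d : set (hpoly n d) :=
  [set q | q != 0 /\ exists z : cvec n, z != 0 /\ peval q z = 0 /\
                                         forall i, pderiv_eval q i z = 0].

Definition dist_Delta n d (p : hpoly n d) : \bar R :=
  ereal_inf [set (dFS p q)%:E | q in @Delta n d].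

Definition Peps n d (eps : R) : set (hpoly n d) :=
  [set p | p != 0 /\ (eps%:E <= dist_Delta p)%E].

Fixpoint gint (m : nat) (f : seq R -> \bar R) : \bar R :=
  match m with
  | 0 => f [::]
  | m'.+1 => (\int[normal_prob 0 1]_x gint m' (fun s => f (x :: s)))%E
  end.

Definition gvec n (s : seq R) (off : nat) : cvec n :=
  [ffun i : 'I_n.+1 => Complex (nth 0 s (off + 2 * i)%N) (nth 0 s (off + 2 * i).+1)].

(* the restriction of p to the line spanned by u, v, dehomogenized:
   x |-> p(x u + v) *)
Definition restr n d (p : hpoly n d) (u v : cvec n) : {poly C} :=
  \sum_a p a *: \prod_i ((u i)%:P * 'X + (v i)%:P) ^+ (val a i).

(* sum_{z in Z(p) cap l} m_z(p|_l) f(z) for the line l = span(u, v) (u, v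
   independent); the point at infinity [1:0] is [u], with multiplicity
   d - deg. (Set to 0 when p vanishes on l, a null set of lines.) *)
Definition line_sum n d (p : hpoly n d) (u v : cvec n) (f : CP n -> \bar R) : \bar R :=
  let g := restr p u v in
  if g == 0 then 0%E else
  ((\sum_(r <- sval (closed_field_poly_normal g))
       f (proj [ffun i => (r * u i + v i)%R] : CP n))
   + ((d - (size g).-1)%:R)%:E * f (proj u : CP n))%E.

(* int f dmu(p) = 1/d int_{G(1,n)} sum_{z in Z(p) cap l} m_z(p|_l) f(z) dvol(l),
   where vol is the unitarily invariant probability on the Grassmannian G(1,n),
   realized as the law of the span of two independent standard Gaussian
   vectors of C^{n+1}. *)
Definition muP n d (p : hpoly n d) : set (CP n) -> \bar R :=
  fun A => ((d%:R^-1)%:E *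
    gint (4 * n.+1) (fun s => line_sum p (gvec n s 0) (gvec n s (2 * n.+1))
                                          (fun z => (\1_A z)%:E)))%E.

Definition mspeed n (M : R -> set (CP n) -> \bar R) (t : R) : \bar R :=
  ereal_inf [set ereal_sup [set (W2 (M (t + h)%R) (M t) * (`|h|^-1)%:E)%E
                           | h in [set h : R | 0 < `|h| < delta /\ 0 <= t + h <= 1]]
            | delta in [set delta : R | 0 < delta]].

Definition AC2 n (M : R -> set (CP n) -> \bar R) : Prop :=
  exists m : R -> R,
    measurable_fun (`[0%R, 1%R] : set R) m /\ (forall t, 0 <= m t) /\
    (\int[lebesgue_measure]_(t in `[0%R, 1%R]) (m t ^+ 2)%:E < +oo)%E /\
    forall s t, 0 <= s -> s <= t -> t <= 1 ->
      (W2 (M s) (M t) <= \int[lebesgue_measure]_(x in `[s, t]) (m x)%:E)%E.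

Definition energy n (M : R -> set (CP n) -> \bar R) : \bar R :=
  (\int[lebesgue_measure]_(t in `[0%R, 1%R]) (mspeed M t * mspeed M t))%E.

Definition admissible n d (p0 p1 : hpoly n d) (g : R -> hpoly n d) : Prop :=
  (forall t, 0 <= t <= 1 -> g t != 0) /\
  (exists c : C, c != 0 /\ g 0 = [ffun a => c * p0 a]) /\
  (exists c : C, c != 0 /\ g 1 = [ffun a => c * p1 a]) /\
  AC2 (fun t => muP (g t)).

Definition W2in n d (p0 p1 : hpoly n d) : \bar R :=
  esqrt (ereal_inf [set energy (fun t => muP (g t)) | g in admissible p0 p1]).

End Defs.

(* Main.v *)
Require Import Defs.
From HB Require Import structures.
From mathcomp Require Import all_boot all_order all_algebra.
From mathcomp Require Import all_classical all_reals all_analysis.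
From mathcomp Require Import measurable_realfun perm complex closed_field zify ring lra.
Set Implicit Arguments.
Unset Strict Implicit.
Unset Printing Implicit Defensive.
Import Order.TTheory GRing.Theory Num.Theory.
Import numFieldNormedType.Exports.
Local Open Scope classical_set_scope.
Local Open Scope ring_scope.

(** Couple [muP p] and [muP q] line by line, matching the roots of the two restrictions
    to the same random line.  Along the segment joining the two restrictions the roots
    stay in the zone [|p| <= C |p - q|] of the line, so a root that moves by a chordal
    distance D leaves a chain of points of this zone which, by Lagrange interpolation,
    forces the disc of radius 2 D to lie in a comparable zone; hence D^2 is bounded by the
    area of the zone on the line.  If some partial derivative of [p] is everywhere bounded
    below (a quantitative form of being far from the discriminant), then on each coordinate
    line the zone lies in discs of radius O(|p - q|) about the roots, so its expected area is
    O(|p - q|^2).  Thus W_2(muP p, muP q) = O(|p - q|) on polynomials with a uniform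
    lower bound, and a curve of such polynomials that is Lipschitz in the coefficients has
    metric speed bounded by its Lipschitz constant.

    Nearby points of [Peps eps] are joined by the segment between phase-aligned unit
    representatives.  For distant points a uniform bound suffices; it follows by compactness
    from the existence of one path, and this path is found in the complex pencil through the
    two polynomials, whose singular parameters form a set definable in the field of
    complex numbers, hence finite by quantifier elimination. *)

(** A line may be tangent to the zero set of a nonsingular polynomial, and near such a line the
    roots of the restriction move like a fractional power of |p - q|: no Lipschitz bound holds line
    by line. The estimate holds in mean square, because the exponent 2 of the cost is the real
    dimension of a complex line, so that a squared displacement can be compared with an area. This
    comparison uses nothing about [p] except its degree. Regularity of [p] enters only after
    Tonelli: for a fixed parameter x, the point x u + v can be moved along any coordinate axis by
    resampling one entry of u or v, so an axis along which the derivative of [p] is large is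
    available even where the line is tangent.

    The lower bound on derivatives replaces the distance to the discriminant because it is stable
    under small changes of the coefficients and holds, with some constant, at every nonsingular
    polynomial; segments and paths that leave [Peps eps] can therefore still be controlled. *)

Notation cm := ComplexField.Normc.normc.

(** * Complex numbers *)

Section ComplexModulus.
Variable R : realType.
Local Notation C := (complex R).
Implicit Types x y z : C.

Lemma cabs2E z : cabs2 z = cm z ^+ 2.
Proof. by case: z => a b; rewrite /cabs2 /= sqr_sqrtr // addr_ge0 ?sqr_ge0. Qed.

Lemma cm_ge0 z : 0 <= cm z.
Proof. by case: z => a b; rewrite /= sqrtr_ge0. Qed.

Lemma cm0 : cm (0 : C) = 0. Proof. exact: ComplexField.Normc.normc0. Qed.
Lemma cm1 : cm (1 : C) = 1. Proof. exact: ComplexField.Normc.normc1. Qed.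

Lemma cm_eq0 z : (cm z == 0) = (z == 0).
Proof.
by apply/eqP/eqP => [/ComplexField.Normc.eq0_normc //|->]; rewrite cm0.
Qed.

Lemma cm_gt0 z : (0 < cm z) = (z != 0).
Proof. by rewrite lt_def cm_ge0 andbT cm_eq0. Qed.

Lemma cmM x y : cm (x * y) = cm x * cm y.
Proof. exact: ComplexField.Normc.normcM. Qed.

Lemma cmV x : cm x^-1 = (cm x)^-1.
Proof. exact: ComplexField.Normc.normcV. Qed.

Lemma cmN x : cm (- x) = cm x.
Proof. exact: normcN. Qed.

Lemma cmD x y : cm (x + y) <= cm x + cm y.
Proof. exact: le_normcD. Qed.

Lemma cmB x y : cm (x - y) = cm (y - x).
Proof. by rewrite -cmN opprB. Qed.

Lemma cmX x k : cm (x ^+ k) = cm x ^+ k.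
Proof. by elim: k => [|k ih]; rewrite ?expr0 ?cm1 // !exprS cmM ih. Qed.

Lemma cm_sum (I : Type) (r : seq I) (P : pred I) (F : I -> C) :
  cm (\sum_(i <- r | P i) F i) <= \sum_(i <- r | P i) cm (F i).
Proof.
elim/big_ind2: _ => [|x y z t h1 h2|//]; first by rewrite cm0.
by apply: le_trans (cmD _ _) (lerD _ _).
Qed.

Lemma cm_prod (I : Type) (r : seq I) (P : pred I) (F : I -> C) :
  cm (\prod_(i <- r | P i) F i) = \prod_(i <- r | P i) cm (F i).
Proof. by elim/big_ind2: _ => [|x y z t h1 h2|//]; rewrite ?cm1 // cmM h1 h2. Qed.

Lemma cm_nat k : cm (k%:R : C) = k%:R.
Proof.
by rewrite -(rmorph_nat (real_complex R)) /= expr0n /= addr0 sqrtr_sqr ger0_norm.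
Qed.

Lemma cm_conj z : cm (cconj z) = cm z.
Proof. by case: z => a b; rewrite /= sqrrN. Qed.

Lemma cm_realC (r : R) : cm (realC r) = `|r|.
Proof. by rewrite /= expr0n /= addr0 sqrtr_sqr. Qed.

Lemma Re_le_cm z : `|complex.Re z| <= cm z.
Proof.
by case: z => a b /=; rewrite -sqrtr_sqr ler_wsqrtr // lerDl sqr_ge0.
Qed.

Lemma Im_le_cm z : `|complex.Im z| <= cm z.
Proof.
by case: z => a b /=; rewrite -sqrtr_sqr ler_wsqrtr // lerDr sqr_ge0.
Qed.

Lemma cm_le z : cm z <= `|complex.Re z| + `|complex.Im z|.
Proof.
rewrite -(@ler_pXn2r _ 2) ?nnegrE ?cm_ge0 ?addr_ge0 // -cabs2E /cabs2.
rewrite sqrrD !real_normK ?num_real // addrAC -addrA lerD2l lerDl.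
by rewrite mulrn_wge0 // mulr_ge0.
Qed.

Lemma cconjD x y : cconj (x + y) = cconj x + cconj y.
Proof. by case: x => a b; case: y => c e; rewrite /cconj /= opprD. Qed.

Lemma cconjM x y : cconj (x * y) = cconj x * cconj y.
Proof.
case: x => a b; case: y => c e; rewrite /cconj /=.
by apply/eqP; rewrite eq_complex /= mulrN mulNr opprK mulrN mulNr -opprD !eqxx.
Qed.

Lemma cconjK x : cconj (cconj x) = x.
Proof. by case: x => a b; rewrite /cconj /= opprK. Qed.

Lemma cconj0 : cconj (0 : C) = 0.
Proof. by rewrite /cconj /= oppr0. Qed.

Lemma cconj_sum (I : Type) (r : seq I) (P : pred I) (F : I -> C) :
  cconj (\sum_(i <- r | P i) F i) = \sum_(i <- r | P i) cconj (F i).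
Proof. by elim/big_ind2: _ => [|x y z t h1 h2|//]; rewrite ?cconj0 // cconjD h1 h2. Qed.

Lemma realCE (r : R) : realC r = real_complex R r. Proof. by []. Qed.

Lemma mulc_conj z : z * cconj z = realC (cabs2 z).
Proof.
case: z => a b; rewrite /cconj /cabs2 /realC /=; apply/eqP; rewrite eq_complex /=.
by rewrite mulrN opprK -!expr2 mulrN mulrC addNr !eqxx.
Qed.

Lemma realCD (r s : R) : realC (r + s) = realC r + realC s.
Proof. by rewrite !realCE rmorphD. Qed.
Lemma realCM (r s : R) : realC (r * s) = realC r * realC s.
Proof. by rewrite !realCE rmorphM. Qed.
Lemma realC_sum (I : Type) (r : seq I) (P : pred I) (F : I -> R) :
  realC (\sum_(i <- r | P i) F i) = \sum_(i <- r | P i) realC (F i).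
Proof. by rewrite realCE rmorph_sum. Qed.
Lemma realC_inj : injective (@realC R).
Proof. by move=> r s [->]. Qed.

Lemma cReD x y : complex.Re (x + y) = complex.Re x + complex.Re y.
Proof. by case: x => a b; case: y. Qed.
Lemma cImD x y : complex.Im (x + y) = complex.Im x + complex.Im y.
Proof. by case: x => a b; case: y. Qed.
Lemma cReM x y : complex.Re (x * y) =
  complex.Re x * complex.Re y - complex.Im x * complex.Im y.
Proof. by case: x => a b; case: y. Qed.
Lemma cImM x y : complex.Im (x * y) =
  complex.Re x * complex.Im y + complex.Im x * complex.Re y.
Proof. by case: x => a b; case: y. Qed.
Lemma cReN x : complex.Re (- x) = - complex.Re x.
Proof. by case: x. Qed.
Lemma cImN x : complex.Im (- x) = - complex.Im x.
Proof. by case: x. Qed.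
Lemma Re_realC (r : R) : complex.Re (realC r) = r. Proof. by []. Qed.
Lemma cRe_sum (I : Type) (r : seq I) (P : pred I) (F : I -> C) :
  complex.Re (\sum_(i <- r | P i) F i) = \sum_(i <- r | P i) complex.Re (F i).
Proof. by elim/big_ind2: _ => [//|x y z t h1 h2|//]; rewrite cReD h1 h2. Qed.

End ComplexModulus.

(** * The chordal metric *)

Section Chordal.
Variable R : realType.
Local Notation C := (complex R).
Implicit Types x y z : C.

(** The norm of the vector (x, 1) of C^2. *)
Definition jb x : R := Num.sqrt (1 + cm x ^+ 2).

Lemma jb_gt0 x : 0 < jb x.
Proof. by rewrite sqrtr_gt0 ltr_pwDl ?sqr_ge0. Qed.

Lemma jb_sqr x : jb x ^+ 2 = 1 + cm x ^+ 2.
Proof. by rewrite sqr_sqrtr // addr_ge0 ?sqr_ge0. Qed.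

Lemma cm_jb x y : cm (1 + cconj x * y) <= jb x * jb y.
Proof.
apply: le_trans (cmD _ _) _; rewrite cm1 cmM cm_conj.
rewrite -(@ler_pXn2r _ 2) ?nnegrE ?addr_ge0 ?mulr_ge0 ?cm_ge0 ?(ltW (jb_gt0 _)) //.
rewrite exprMn !jb_sqr.
have := sqr_ge0 (cm x - cm y); nra.
Qed.

(** The sine of the angle between the complex lines of (x, 1) and (y, 1) in C^2. *)
Definition chi x y : R := cm (x - y) / (jb x * jb y).

Lemma chi_ge0 x y : 0 <= chi x y.
Proof. by rewrite divr_ge0 ?cm_ge0 // ltW // mulr_gt0 ?jb_gt0. Qed.

Lemma chiC x y : chi x y = chi y x.
Proof. by rewrite /chi cmB mulrC [jb x * _]mulrC mulrC. Qed.

Lemma chixx x : chi x x = 0.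
Proof. by rewrite /chi subrr cm0 mul0r. Qed.

Lemma chi_le1 x y : chi x y <= 1.
Proof.
rewrite ler_pdivrMr ?mulr_gt0 ?jb_gt0 // mul1r.
apply: le_trans (cmD _ _) _; rewrite cmN.
rewrite -(@ler_pXn2r _ 2) ?nnegrE ?addr_ge0 ?mulr_ge0 ?cm_ge0 ?(ltW (jb_gt0 _)) //.
rewrite exprMn !jb_sqr.
have := sqr_ge0 (cm x * cm y - 1); nra.
Qed.

(** With y' the conjugate of y, this rests on the identity (x - y)(1 + y' z) + (y - z)(1 + y' x) =
    (x - z)(1 + y y'), whose factors 1 + y' z and 1 + y' x are Hermitian products bounded by
    Cauchy-Schwarz in [cm_jb]. *)
Lemma chi_triangle y x z : chi x z <= chi x y + chi y z.
Proof.
have jx := jb_gt0 x; have jy := jb_gt0 y; have jz := jb_gt0 z.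
have key : cm (x - z) * jb y ^+ 2 <=
    cm (x - y) * (jb y * jb z) + cm (y - z) * (jb y * jb x).
  have -> : cm (x - z) * jb y ^+ 2 = cm ((x - y) * (1 + cconj y * z) +
      (y - z) * (1 + cconj y * x)).
    have -> : (x - y) * (1 + cconj y * z) + (y - z) * (1 + cconj y * x) =
       (x - z) * (1 + y * cconj y) by ring.
    rewrite mulc_conj cmM jb_sqr cabs2E -[1 + realC _]/(realC 1 + _) -realCD.
    by rewrite cm_realC ger0_norm // addr_ge0 ?sqr_ge0.
  apply: le_trans (cmD _ _) _; rewrite !cmM.
  by apply: lerD; rewrite ler_wpM2l ?cm_ge0 // cm_jb.
rewrite /chi.
rewrite -(@ler_pM2r _ (jb x * jb y ^+ 2 * jb z)) ?mulr_gt0 ?exprn_gt0 //.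
have -> : cm (x - z) / (jb x * jb z) * (jb x * jb y ^+ 2 * jb z) = cm (x - z) * jb y ^+ 2.
  by field; rewrite !gt_eqF.
suff -> : (cm (x - y) / (jb x * jb y) + cm (y - z) / (jb y * jb z)) *
   (jb x * jb y ^+ 2 * jb z) = cm (x - y) * (jb y * jb z) + cm (y - z) * (jb y * jb x) by [].
by field; rewrite !gt_eqF.
Qed.

End Chordal.

(* The chordal metric of the projective line [CP^1] in the affine coordinate [x]
   of the pencil [x u + v], where [a = |u|^2], [h = <v,u>] and [w = |u /\ v|];
   then [|x u + v|^2 = lN x ^+ 2]. *)
Section LineMetric.
Variable R : realType.
Local Notation C := (complex R).
Variables (a w : R) (h : C).
Hypotheses (a_gt0 : 0 < a) (w_gt0 : 0 < w).
Implicit Types x y z : C.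

Definition lN2 x : R := (cabs2 (realC a * x + h) + w ^+ 2) / a.
Definition lN x : R := Num.sqrt (lN2 x).
(** In a suitable orthonormal basis of the span of u and v, whose first vector is along u, the
    vector x u + v is proportional to ([lX x], 1). *)
Definition lX x : C := realC w^-1 * (realC a * x + h).
Definition ls x y : R := chi (lX x) (lX y).

Lemma lN2_gt0 x : 0 < lN2 x.
Proof.
by rewrite divr_gt0 // ltr_wpDl ?exprn_gt0 // addr_ge0 ?sqr_ge0.
Qed.

Lemma lN_gt0 x : 0 < lN x. Proof. by rewrite sqrtr_gt0 lN2_gt0. Qed.

Lemma lN_sqr x : lN x ^+ 2 = lN2 x.
Proof. by rewrite sqr_sqrtr // ltW // lN2_gt0. Qed.

Lemma cm_lX x : cm (lX x) = cm (realC a * x + h) / w.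
Proof. by rewrite /lX cmM cm_realC ger0_norm ?invr_ge0 1?mulrC // ltW. Qed.

Lemma lN_jb x : lN x = jb (lX x) * w / Num.sqrt a.
Proof.
apply/eqP; rewrite -(@eqrXn2 _ 2) ?(ltW (lN_gt0 _)) //; last first.
  by rewrite !mulr_ge0 ?(ltW (jb_gt0 _)) ?invr_ge0 ?sqrtr_ge0 // ltW.
rewrite lN_sqr !exprMn exprVn jb_sqr sqr_sqrtr ?(ltW a_gt0) // cm_lX /lN2 cabs2E.
by apply/eqP; field; rewrite !gt_eqF.
Qed.

(** Both sides are the area spanned by x u + v and y u + v. *)
Lemma ls_mul x y : ls x y * (lN x * lN y) = w * cm (x - y).
Proof.
rewrite !lN_jb /ls /chi.
have -> : cm (lX x - lX y) = a * cm (x - y) / w.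
  rewrite /lX -mulrBr.
  have -> : realC a * x + h - (realC a * y + h) = realC a * (x - y) by ring.
  by rewrite !cmM !cm_realC !ger0_norm ?invr_ge0 1?mulrC // ltW.
have j1 := jb_gt0 (lX x); have j2 := jb_gt0 (lX y).
have sa : 0 < Num.sqrt a by rewrite sqrtr_gt0.
have -> : a = Num.sqrt a ^+ 2 by rewrite sqr_sqrtr // ltW.
rewrite [Num.sqrt (_ ^+ 2)]sqrtr_sqr ger0_norm ?sqrtr_ge0 //.
by field; rewrite !gt_eqF.
Qed.

Lemma lsE x y : ls x y = w * cm (x - y) / (lN x * lN y).
Proof. by rewrite -ls_mul mulfK // gt_eqF // mulr_gt0 ?lN_gt0. Qed.

Lemma ls_ge0 x y : 0 <= ls x y. Proof. exact: chi_ge0. Qed.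
Lemma ls_le1 x y : ls x y <= 1. Proof. exact: chi_le1. Qed.
Lemma lsC x y : ls x y = ls y x. Proof. exact: chiC. Qed.
Lemma ls_triangle y x z : ls x z <= ls x y + ls y z.
Proof. exact: chi_triangle. Qed.

End LineMetric.

(** * Lagrange interpolation along chains of points *)

Section Lagrange.
Variable F : fieldType.

Lemma lagrange_interp (d : nat) (g : {poly F}) (xs : 'I_d.+1 -> F) (x : F) :
  (size g <= d.+1)%N -> injective xs ->
  g.[x] = \sum_i g.[xs i] * \prod_(j | j != i) ((x - xs j) / (xs i - xs j)).
Proof.
move=> sg xi.
pose L : {poly F} := \sum_i g.[xs i] *:
   \prod_(j | j != i) ((xs i - xs j)^-1 *: ('X - (xs j)%:P)).
suff : g - L = 0.
  move/eqP; rewrite subr_eq0 => /eqP gL; rewrite [in LHS]gL /L horner_sum.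
  apply: eq_bigr => i _; rewrite hornerZ horner_prod; congr (_ * _).
  by apply: eq_bigr => j _; rewrite hornerZ hornerXsubC mulrC.
apply: (@roots_geq_poly_eq0 _ _ (codom xs)).
- apply/allP => _ /codomP [k ->]; rewrite rootE !hornerE subr_eq0 /L horner_sum.
  rewrite (bigD1 k) //= hornerZ horner_prod big1 ?mulr1; last first.
    move=> j jk; rewrite hornerZ hornerXsubC mulVf // subr_eq0.
    by apply: contra jk => /eqP /xi ->.
  rewrite big1 ?addr0 // => i ik; rewrite hornerZ horner_prod (bigD1 k) 1?eq_sym //=.
  by rewrite hornerZ hornerXsubC subrr mulr0 mul0r mulr0.
- by rewrite map_inj_uniq ?enum_uniq.
- rewrite size_codom card_ord; apply: (leq_trans (size_polyD _ _)).
  rewrite size_polyN geq_max sg /=; apply: (leq_trans (size_sum _ _ _)).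
  apply/bigmax_leqP => i _; apply: (leq_trans (size_scale_leq _ _)).
  apply: (@leq_trans (size (\prod_(j | j != i) ('X - (xs j)%:P)))).
    by rewrite scaler_prod; apply: size_scale_leq.
  rewrite size_prod; last by move=> j _; rewrite polyXsubC_eq0.
  rewrite (eq_bigr (fun=> 2%N)); last by move=> j _; rewrite size_XsubC.
  rewrite sum_nat_const; have := cardC1 i; rewrite card_ord /=.
  have -> : #|[pred j | j != i]| = #|predC1 i| by apply: eq_card => j; rewrite !inE.
  move=> ->; lia.
Qed.

End Lagrange.

Section Chains.
Variable R : realType.
Local Notation C := (complex R).
Variables (a w : R) (h : C).
Hypotheses (a_gt0 : 0 < a) (w_gt0 : 0 < w).
Local Notation s := (ls a w h).
Local Notation N := (lN a w h).

(** Each of the d quotients in an interpolation weight is a quotient of chordal distances times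
    [N x / N (xs i)]; these factors turn the weight [N (xs i) ^+ d] of the node into [N x ^+ d], so
    the bound is homogeneous. *)
Lemma lagrange_bound (d : nat) (g : {poly C}) (xs : 'I_d.+1 -> C) (x : C)
    (sg tau eta : R) :
  (size g <= d.+1)%N -> 0 < sg -> 0 <= eta ->
  (forall i j, i != j -> sg <= s (xs i) (xs j)) ->
  (forall i, cm g.[xs i] <= eta * N (xs i) ^+ d) ->
  (forall i, s x (xs i) <= tau) ->
  cm g.[x] <= d.+1%:R * (tau / sg) ^+ d * eta * N x ^+ d.
Proof.
move=> sz sg0 eta0 sep small near.
have N0 z : 0 < N z by exact: lN_gt0.
have xi : injective xs.
  move=> i j e; apply: contraTeq sg0 => /sep; rewrite e /ls chixx -leNgt => ->; by [].
rewrite (lagrange_interp _ sz xi).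
apply: le_trans (cm_sum _ _ _) _.
rewrite -!mulrA [leRHS]mulr_natl -[in leRHS](card_ord d.+1) -sumr_const.
apply: ler_sum => i _; rewrite cmM cm_prod.
have tau0 : 0 <= tau by apply: le_trans (near i); exact: ls_ge0.
have -> : (tau / sg) ^+ d * (eta * N x ^+ d) =
    (eta * N (xs i) ^+ d) * (tau / sg * (N x / N (xs i))) ^+ d.
  rewrite !exprMn !exprVn; field.
  by rewrite !gt_eqF // exprn_gt0.
apply: ler_pM; rewrite ?cm_ge0 ?prodr_ge0 //; first by move=> *; exact: cm_ge0.
have dE : #|[pred j | j != i]| = d.
  have e := cardC1 i; rewrite card_ord /= in e; apply: etrans e.
  by apply: eq_card => j; rewrite !inE.
rewrite -[X in _ <= _ ^+ X]dE -prodr_const; apply: ler_prod => j ji; rewrite cm_ge0 /=.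
rewrite cmM cmV.
have e1 : cm (x - xs j) = s x (xs j) * (N x * N (xs j)) / w.
  by rewrite ls_mul // mulrC mulKf // gt_eqF.
have e2 : cm (xs i - xs j) = s (xs i) (xs j) * (N (xs i) * N (xs j)) / w.
  by rewrite ls_mul // mulrC mulKf // gt_eqF.
have sij : sg <= s (xs i) (xs j) by apply: sep; rewrite eq_sym.
have sij0 := lt_le_trans sg0 sij.
have -> : cm (x - xs j) / cm (xs i - xs j) =
    (s x (xs j) / s (xs i) (xs j)) * (N x / N (xs i)).
  by rewrite e1 e2; field; rewrite !gt_eqF.
rewrite ler_wpM2r ?divr_ge0 ?(ltW (N0 _)) //.
apply: ler_pM; rewrite ?ls_ge0 ?invr_ge0 ?ls_ge0 //.
by rewrite lef_pV2 ?posrE.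
Qed.

(* [y] is reached from [x] by finitely many jumps of length at most [eps] landing in [V];
   stated impredicatively, as membership in every set closed under such jumps. *)
Definition chainrel (V : C -> Prop) (eps : R) (x y : C) : Prop :=
  forall S : C -> Prop, (forall z z', S z -> V z' -> s z z' <= eps -> S z') -> S x -> S y.

Lemma chainrel_refl V eps x : chainrel V eps x x. Proof. by []. Qed.

Lemma chainrel_trans V eps x y z :
  chainrel V eps x y -> chainrel V eps y z -> chainrel V eps x z.
Proof. by move=> xy yz S hS Sx; apply: (yz S hS); apply: xy. Qed.

Lemma chainrel_step V eps x y : V y -> s x y <= eps -> chainrel V eps x y.
Proof. by move=> Vy sxy S hS Sx; apply: (hS x). Qed.

(** A discrete intermediate value theorem: if no point of [V] had distance between c and c + eps
    from x, the open ball of radius c about x would be closed under jumps and would contain y. *)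
Lemma chain_level V eps x y c : 0 <= eps -> V x -> chainrel V eps x y ->
  0 <= c <= s x y -> exists2 z, V z & c <= s x z <= c + eps.
Proof.
move=> eps0 Vx xy /andP[c0 cD].
have [c00|c_gt0] := eqVneq c 0.
  by exists x => //; rewrite c00 /ls chixx lexx add0r.
apply: contrapT => nz.
suff : s x y < c by rewrite ltNge cD.
apply: (xy (fun z => s x z < c)) => [z z' zc Vz' zz'|]; last first.
  by rewrite /ls chixx lt_def c_gt0 c0.
rewrite ltNge; apply/negP => cz'; apply: nz; exists z' => //; rewrite cz' /=.
by apply: le_trans (ls_triangle _ _ _ z _ _) _; apply: lerD => //; apply: ltW.
Qed.

(* The chain supplies d + 1 points of the zone at chordal distances 0, D/d, ..., D from [x],
   which are well-separated interpolation nodes. *)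
Lemma chain_bound (d : nat) (g : {poly C}) (eta eps : R) (x y : C) :
  (0 < d)%N -> (size g <= d.+1)%N -> 0 <= eta -> 0 <= eps ->
  cm g.[x] <= eta * N x ^+ d ->
  chainrel (fun z => cm g.[z] <= eta * N z ^+ d) eps x y ->
  0 < s x y -> eps <= s x y / (2 * d%:R) ->
  forall z, s z x <= 2 * s x y ->
  cm g.[z] <= d.+1%:R * (8 * d%:R) ^+ d * eta * N z ^+ d.
Proof.
move=> d0 sz eta0 eps0 Vx xy D0 epsD z zx.
set D := s x y in D0 epsD zx *.
have d0' : 0 < d%:R :> R by rewrite ltr0n.
have /choice [zs hzs] : forall j : 'I_d.+1, exists v,
    cm g.[v] <= eta * N v ^+ d /\ j%:R * (D / d%:R) <= s x v <= j%:R * (D / d%:R) + eps.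
  move=> j; have [|v Vv hv] := chain_level eps0 Vx xy (c := j%:R * (D / d%:R)); last by exists v.
  apply/andP; split; first by rewrite mulr_ge0 // divr_ge0 // ltW.
  rewrite -/D mulrCA -[leRHS]mulr1 ler_wpM2l ?(ltW D0) //.
  by rewrite ler_pdivrMr // mul1r ler_nat -ltnS.
have hD : 2 * (D / (2 * d%:R)) = D / d%:R by field; rewrite gt_eqF.
have sepw (i j : 'I_d.+1) : (i < j)%N -> D / (2 * d%:R) <= s (zs i) (zs j).
  move=> ij; have [_ /andP[_ hi]] := hzs i; have [_ /andP[hj _]] := hzs j.
  have tr := ls_triangle a w h (zs i) x (zs j).
  have : i%:R * (D / d%:R) + D / d%:R <= j%:R * (D / d%:R).
    rewrite -[X in _ + X]mul1r -mulrDl; apply: ler_wpM2r.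
      by rewrite divr_ge0 // ltW.
    by rewrite natr1 ler_nat.
  move: epsD hi hj tr hD; lra.
(* The nodes are D / (2 d) apart, since their levels differ by at least D / d and each overshoots by
   at most eps. They are within 4 D of z: 2 D from z to x, then at most D + eps. *)
have -> : 8 * d%:R = (4 * D) / (D / (2 * d%:R)) by field; rewrite !gt_eqF.
apply: (lagrange_bound (xs := zs)) => //.
- by rewrite divr_gt0 // mulr_gt0.
- move=> i j; rewrite neq_ltn => /orP[|] ij; first exact: sepw.
  by rewrite /ls chiC; apply: sepw.
- by move=> i; have [] := hzs i.
- move=> i; have [_ /andP[_ hi]] := hzs i.
  have tr := ls_triangle a w h x z (zs i).
  have : i%:R * (D / d%:R) <= D.
    rewrite mulrCA -[leRHS]mulr1 ler_wpM2l ?(ltW D0) //.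
    by rewrite ler_pdivrMr // mul1r ler_nat -ltnS.
  have : D / (2 * d%:R) <= D.
    rewrite -[leRHS]mulr1 ler_wpM2l ?(ltW D0) // invf_le1 ?mulr_gt0 //.
    have : 1 <= d%:R :> R by rewrite ler1n.
    lra.
  move: epsD hi tr zx; lra.
Qed.

End Chains.

(** * Continuity and matching of roots *)

Section ComplexConvergence.
Variable R : realType.
Local Notation C := (complex R).
Context {T : Type} (F : set_system T) {FF : Filter F}.
Implicit Types (f g : T -> C) (k l : C).

Definition ccvg f l : Prop :=
  (complex.Re (f t) @[t --> F] --> complex.Re l) /\
  (complex.Im (f t) @[t --> F] --> complex.Im l).

Lemma ccvg_cst k : ccvg (fun=> k) k.
Proof. by split; apply: cvg_cst. Qed.

Lemma ccvgD f g k l : ccvg f k -> ccvg g l -> ccvg (fun t => f t + g t) (k + l).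
Proof.
move=> [f1 f2] [g1 g2]; split.
  rewrite cReD; under eq_fun do rewrite cReD; exact: cvgD.
by rewrite cImD; under eq_fun do rewrite cImD; exact: cvgD.
Qed.

Lemma ccvgM f g k l : ccvg f k -> ccvg g l -> ccvg (fun t => f t * g t) (k * l).
Proof.
move=> [f1 f2] [g1 g2]; split.
  rewrite cReM; under eq_fun do rewrite cReM; apply: cvgB; exact: cvgM.
by rewrite cImM; under eq_fun do rewrite cImM; apply: cvgD; exact: cvgM.
Qed.

Lemma ccvgN f k : ccvg f k -> ccvg (fun t => - f t) (- k).
Proof.
move=> [f1 f2]; split.
  rewrite cReN; under eq_fun do rewrite cReN; exact: cvgN.
by rewrite cImN; under eq_fun do rewrite cImN; exact: cvgN.
Qed.

Lemma ccvg_sum (I : Type) (r : seq I) (P : pred I) (f : I -> T -> C) (k : I -> C) :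
  (forall i, P i -> ccvg (f i) (k i)) ->
  ccvg (fun t => \sum_(i <- r | P i) f i t) (\sum_(i <- r | P i) k i).
Proof.
move=> fk; elim: r => [|i r ih].
  by rewrite big_nil; under eq_fun do rewrite big_nil; apply: ccvg_cst.
rewrite big_cons; under eq_fun do rewrite big_cons.
by case: ifP => // Pi; apply: ccvgD ih; apply: fk.
Qed.

Lemma ccvg_prod (I : Type) (r : seq I) (P : pred I) (f : I -> T -> C) (k : I -> C) :
  (forall i, P i -> ccvg (f i) (k i)) ->
  ccvg (fun t => \prod_(i <- r | P i) f i t) (\prod_(i <- r | P i) k i).
Proof.
move=> fk; elim: r => [|i r ih].
  by rewrite big_nil; under eq_fun do rewrite big_nil; apply: ccvg_cst.
rewrite big_cons; under eq_fun do rewrite big_cons.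
by case: ifP => // Pi; apply: ccvgM ih; apply: fk.
Qed.

Lemma ccvgX f k m : ccvg f k -> ccvg (fun t => f t ^+ m) (k ^+ m).
Proof.
move=> fk; elim: m => [|m ih]; first exact: ccvg_cst.
by rewrite exprS; under eq_fun do rewrite exprS; apply: ccvgM.
Qed.

Lemma ccvgP f l : ccvg f l <->
  (forall e : R, 0 < e -> \forall t \near F, cm (f t - l) < e).
Proof.
split=> [[f1 f2] e e0|fl].
  have e20 : 0 < e / 2 by rewrite divr_gt0.
  have /cvgrPdist_lt /(_ _ e20) h1 := f1; have /cvgrPdist_lt /(_ _ e20) h2 := f2.
  near=> t; apply: le_lt_trans (cm_le _) _.
  rewrite cReD cImD cReN cImN (splitr e); apply: ltrD.
    by rewrite distrC; near: t.
  by rewrite distrC; near: t.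
split; apply/cvgrPdist_lt => e e0; near=> t; rewrite distrC.
  rewrite -cReN -cReD; apply: le_lt_trans (Re_le_cm _) _; near: t; exact: fl.
rewrite -cImN -cImD; apply: le_lt_trans (Im_le_cm _) _; near: t; exact: fl.
Unshelve. all: end_near. Qed.

Lemma ccvg_cm f l : ccvg f l -> cm (f t) @[t --> F] --> cm l.
Proof.
move=> /ccvgP fl; apply/cvgrPdist_lt => e e0; near=> t.
apply: (@le_lt_trans _ _ (cm (f t - l))); last by near: t; exact: fl.
rewrite ler_norml; apply/andP; split.
  by rewrite lerNl opprB lerBlDr -{1}(subrK l (f t)) cmD.
by rewrite lerBlDr cmB -{1}(subrK (f t) l) cmD.
Unshelve. all: end_near. Qed.

End ComplexConvergence.

Section RootContinuity.
Variable R : realType.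
Local Notation C := (complex R).

Lemma nearest_in_seq (f : C -> R) (r : seq C) : r != [::] ->
  exists2 b, b \in r & forall z, z \in r -> f b <= f z.
Proof.
elim: r => [//|y [|y' r] ih] _.
  by exists y; rewrite ?mem_seq1 // => z; rewrite inE => /eqP ->.
have [b br bmin] := ih isT.
have [fby|fyb] := leP (f b) (f y).
  exists b; first by rewrite inE br orbT.
  by move=> z; rewrite inE => /orP[/eqP ->//|]; exact: bmin.
exists y; first by rewrite inE eqxx.
move=> z; rewrite inE => /orP[/eqP ->//|/bmin]; exact: le_trans (ltW fyb).
Qed.

Lemma monic_roots (p : {poly C}) : p \is monic ->
  exists r : seq C, [/\ (size r).+1 = size p & p = \prod_(z <- r) ('X - z%:P)].
Proof.
move=> pm; have [r pr] := closed_field_poly_normal p.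
rewrite (monicP pm) scale1r in pr; exists r; split => //.
by rewrite pr size_prod_XsubC.
Qed.

(** The modulus of p at x is the product of the distances from x to the roots, each at least the
    smallest one. *)
Lemma nearest_root (p : {poly C}) (x : C) m : p \is monic -> size p = m.+2 ->
  exists bq : C * {poly C}, [/\ p = ('X - bq.1%:P) * bq.2, bq.2 \is monic,
    size bq.2 = m.+1 & cm (x - bq.1) ^+ m.+1 <= cm p.[x]].
Proof.
move=> pm sp; have [r [sr pr]] := monic_roots pm.
have sr' : size r = m.+1 by case: (sr); rewrite sp => -[].
have [|b br bmin] := nearest_in_seq (fun z => cm (x - z)) (r := r).
  by rewrite -size_eq0 sr'.
have pe := perm_to_rem br.
have srem : size (rem b r) = m by rewrite size_rem // sr'.
exists (b, \prod_(z <- rem b r) ('X - z%:P)); split => /=.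
- by rewrite pr (perm_big _ pe) big_cons.
- exact: monic_prod_XsubC.
- by rewrite size_prod_XsubC srem.
- rewrite pr horner_prod cm_prod -sr'.
  have -> : cm (x - b) ^+ size r = \prod_(z <- r) cm (x - b).
    by rewrite big_const_seq count_predT -Monoid.iteropE.
  rewrite big_seq [leRHS]big_seq; apply: ler_prod => z zr.
  by rewrite cm_ge0 /= hornerXsubC bmin.
Qed.

(** Induction on the limit roots: since G t tends to 0 at the first limit root x, the root of G t
    nearest to x tends to x by [nearest_root]; dividing it out leaves polynomials whose coefficients
    converge again. *)
Lemma roots_cont (T : Type) (F : set_system T) {FF : Filter F}
    (G : T -> {poly C}) (rs : seq C) :
  (forall t, G t \is monic) -> (forall t, size (G t) = (size rs).+1) ->
  (forall k, ccvg F (fun t => (G t)`_k) (\prod_(z <- rs) ('X - z%:P))`_k) ->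
  exists B : T -> seq C,
   (forall t, size (B t) = size rs /\ G t = \prod_(z <- B t) ('X - z%:P)) /\
   (forall i, (i < size rs)%N -> ccvg F (fun t => nth 0 (B t) i) (nth 0 rs i)).
Proof.
elim: rs G => [|x rs ih] G Gm sG Gc.
  exists (fun=> [::]); split => // t; split => //.
  have := sG t => /eqP/size_poly1P [c c0 Gt].
  by rewrite Gt big_nil; have /monicP := Gm t; rewrite Gt lead_coefC => ->.
have /choice [bq hbq] t := nearest_root x (Gm t) (sG t).
set m := size rs in sG hbq.
pose b t := (bq t).1; pose H t := (bq t).2.
have bx : ccvg F b x.
  apply/ccvgP => e e0.
  have G0 : ccvg F (fun t => (G t).[x]) 0.
    have -> : 0 = (\prod_(z <- x :: rs) ('X - z%:P)).[x].
      by rewrite big_cons hornerM hornerXsubC subrr mul0r.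
    rewrite (@horner_coef_wide _ m.+2); last by rewrite size_prod_XsubC.
    under eq_fun => t do rewrite (@horner_coef_wide _ m.+2 (G t)) ?sG //.
    by apply: ccvg_sum => i _; apply: ccvgM; [exact: Gc|exact: ccvg_cst].
  have /ccvgP /(_ (e ^+ m.+1)) := G0; rewrite exprn_gt0 // => /(_ isT).
  apply: filterS => t; rewrite subr0 => ht.
  have [_ _ _ h4] := hbq t.
  rewrite cmB -(@ltr_pXn2r _ m.+1) ?nnegrE ?cm_ge0 ?(ltW e0) //.
  exact: le_lt_trans h4 ht.
have coefM1 (c : C) (p : {poly C}) k : (('X - c%:P) * p)`_k.+1 = p`_k - c * p`_k.+1.
  by rewrite mulrBl coefB coefXM /= coefCM.
(* Synthetic division produces the coefficients of the quotient from the top down, so the induction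
   starts above the degree and j measures the descent. *)
have Hc j : forall k, (m < k + j)%N ->
    ccvg F (fun t => (H t)`_k) (\prod_(z <- rs) ('X - z%:P))`_k.
  elim: j => [|j ihj] k hk.
    rewrite nth_default ?size_prod_XsubC; last by rewrite addn0 in hk.
    have -> : (fun t => (H t)`_k) = fun=> 0.
      apply/funext => t; rewrite nth_default //.
      by have [_ _ -> _] := hbq t; rewrite addn0 in hk.
    exact: ccvg_cst.
  have -> : (\prod_(z <- rs) ('X - z%:P))`_k =
     (\prod_(z <- x :: rs) ('X - z%:P))`_k.+1 + x * (\prod_(z <- rs) ('X - z%:P))`_k.+1.
    by rewrite big_cons coefM1 subrK.
  have -> : (fun t => (H t)`_k) = (fun t => (G t)`_k.+1 + b t * (H t)`_k.+1).
    by apply/funext => t; have [-> _ _ _] := hbq t; rewrite coefM1 subrK.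
  by apply: ccvgD => //; apply: ccvgM => //; apply: ihj; rewrite addSnnS.
have [||k|B' [hB' cB']] := ih H.
- by move=> t; have [] := hbq t.
- by move=> t; have [_ _ ->] := hbq t.
- by apply: (Hc m.+1); rewrite addnS ltnS leq_addl.
exists (fun t => b t :: B' t); split => [t|[|i] hi].
- have [s1 e1] := hB' t; have [e2 _ _ _] := hbq t.
  by rewrite /= s1; split => //; rewrite big_cons -e1.
- exact: bx.
- exact: cB'.
Qed.

End RootContinuity.

Section Matching.
Variable R : realType.

(** Connectedness of the segment: the local equivalence makes both the truth set of [P] and its
    complement relatively open. *)
Lemma locally_constant_01 (P : R -> Prop) :
  (forall t0 : R, t0 \in `[0, 1] ->
     \forall t \near t0, t \in `[0, 1] -> (P t <-> P t0)) ->
  P 0 -> P 1.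
Proof.
move=> loc P0.
pose A : set R := [set` `[0%R, 1%R]].
have A0 : A 0 by rewrite /A /= in_itv /= lexx ler01.
have A1 : A 1 by rewrite /A /= in_itv /= lexx ler01.
suff /seteqP [_ /(_ _ A1) []] : A `&` P = A by [].
apply: (@segment_connected R 0 1).
- by exists 0.
- exists (interior [set t | A t -> P t]); first exact: open_interior.
  apply/seteqP; split => t [At Pt]; split => //.
    by apply: filterS (loc t At) => u hu Au; apply/hu.
  exact: (nbhs_singleton Pt).
- exists (~` interior [set t | A t -> ~ P t]).
    exact/open_closedC/open_interior.
  apply/seteqP; split => t [At Pt]; split => //.
    by move=> /nbhs_singleton /(_ At).
  apply: contrapT => nPt; apply: Pt.
  by apply: filterS (loc t At) => u hu Au Pu; apply: nPt; apply/(hu Au).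
Qed.

End Matching.

Section RootMatching.
Variable R : realType.
Local Notation C := (complex R).

Lemma ccvgV (T : Type) (F : set_system T) {FF : Filter F} (f : T -> C) (k : C) :
  k != 0 -> ccvg F f k -> ccvg F (fun t => (f t)^-1) k^-1.
Proof.
move=> k0 [f1 f2].
have E z : z^-1 = Complex (complex.Re z / cabs2 z) (- (complex.Im z / cabs2 z)) :> C.
  by case: z => x y.
have n0 : cabs2 k != 0 by rewrite cabs2E sqrf_eq0 cm_eq0.
have nc : cabs2 (f t) @[t --> F] --> cabs2 k.
  rewrite /cabs2 !expr2; under eq_fun do rewrite !expr2.
  by apply: cvgD; apply: cvgM.
have nV : (cabs2 (f t))^-1 @[t --> F] --> (cabs2 k)^-1 by exact: cvgV.
split; rewrite E /=.
  have -> : (fun t => complex.Re (f t)^-1) = (fun t => complex.Re (f t) / cabs2 (f t)).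
    by apply/funext => t; rewrite E.
  exact: (cvgM f1 nV).
have -> : (fun t => complex.Im (f t)^-1) = (fun t => - (complex.Im (f t) / cabs2 (f t))).
  by apply/funext => t; rewrite E.
exact: (cvgN (cvgM f2 nV)).
Qed.

(** Carries a pairing of nearby roots at two times over to the order in which the chained list of
    roots happens to be written. *)
Lemma perm_transfer (T : eqType) (x0 : T) (l1 l2 l3 : seq T) :
  perm_eq l1 l2 -> size l3 = size l2 ->
  exists l4, [/\ perm_eq l4 l3, size l4 = size l1 &
   forall i, (i < size l1)%N -> exists j, [/\ (j < size l2)%N,
     nth x0 l1 i = nth x0 l2 j & nth x0 l4 i = nth x0 l3 j]].
Proof.
move=> /(perm_iotaP x0) [Is pI ->] s3; exists [seq nth x0 l3 i | i <- Is]; split.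
- by apply/(perm_iotaP x0); exists Is => //; rewrite s3.
- by rewrite !size_map.
- move=> i; rewrite size_map => hi; exists (nth 0%N Is i).
  rewrite !(nth_map 0%N) //; split => //.
  have := perm_mem pI (nth 0%N Is i); rewrite mem_nth //.
  by rewrite mem_iota add0n => /esym.
Qed.

(* A path from 0 to 1 in the complex plane; varying [kap] makes it avoid any given finite
   set of parameters. *)
Definition bentpath (kap t : R) : C := Complex t (kap * (t * (1 - t))).

(** Keeps the leading coefficient along the path nonzero, so that no root escapes to infinity. There
    is one bad parameter. If it is not real, the straight segment misses it; if it is real, the bent
    path meets the real axis only at 0 and 1, where the coefficient is [lg] or [lh]. *)
Lemma bentpath_avoids (lg lh : C) : lg != 0 -> lh != 0 ->
  exists2 kap : R, 0 <= kap <= 1 & forall t, lg + bentpath kap t * (lh - lg) != 0.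
Proof.
move=> g0 h0; have [e|ne] := eqVneq (lh - lg) 0.
  by exists 0; [rewrite lexx ler01 | move=> t; rewrite e mulr0 addr0].
pose ts := - lg / (lh - lg).
have tsP kap t : lg + bentpath kap t * (lh - lg) = 0 -> bentpath kap t = ts.
  move=> e; rewrite /ts; apply: (mulIf ne); rewrite divfK //.
  by apply/eqP; rewrite -addr_eq0 addrC e.
have [ti|ti] := eqVneq (complex.Im ts) 0; last first.
  exists 0; first by rewrite lexx ler01.
  by move=> t; apply: contra ti => /eqP/tsP <-; rewrite /= mul0r.
exists 1; first by rewrite lexx ler01.
move=> t; apply/eqP => e; have := tsP _ _ e => e2.
move: ti; rewrite -e2 /= mul1r => /eqP; rewrite mulf_eq0 subr_eq0 => /orP[/eqP t0|/eqP t1].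
  move: e; rewrite /bentpath t0 mul0r mulr0 -[Complex 0 0]/(0 : C) mul0r addr0 => /eqP.
  by rewrite (negPf g0).
move: e; rewrite /bentpath -t1 subrr !mulr0 -[Complex 1 0]/(1 : C) mul1r.
by rewrite addrC subrK => /eqP; rewrite (negPf h0).
Qed.

Lemma cm_bentpath kap t : 0 <= kap <= 1 -> 0 <= t <= 1 -> cm (bentpath kap t) <= 2.
Proof.
move=> /andP[k0 k1] /andP[t0 t1]; apply: le_trans (cm_le _) _ => /=.
have t2 : 0 <= 1 - t by lra.
rewrite (ger0_norm t0) ger0_norm ?mulr_ge0 //.
have : t * (1 - t) <= 1 by nra.
have : 0 <= t * (1 - t) by nra.
nra.
Qed.

Lemma ccvg_bentpath kap (t0 : R) : ccvg (nbhs t0) (bentpath kap) (bentpath kap t0).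
Proof.
split => /=; first exact: cvg_id.
apply: cvgMr; apply: cvgM; first exact: cvg_id.
by apply: cvgB; [exact: cvg_cst | exact: cvg_id].
Qed.

Variables (a w : R) (h : C).
Hypotheses (a_gt0 : 0 < a) (w_gt0 : 0 < w).
Local Notation s := (ls a w h).
Local Notation N := (lN a w h).

Lemma ls_le_cm x y : s x y <= a / w * cm (x - y).
Proof.
have N0 z : 0 < N z := lN_gt0 h a_gt0 w_gt0 z.
rewrite lsE // ler_pdivrMr ?mulr_gt0 //.
have hN z : w / Num.sqrt a <= N z.
  rewrite lN_jb // -mulrA -[leLHS]mul1r ler_wpM2r ?divr_ge0 ?sqrtr_ge0 ?(ltW w_gt0) //.
  rewrite -(@ler_pXn2r _ 2) ?nnegrE ?(ltW (jb_gt0 _)) // jb_sqr expr1n lerDl.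
  by rewrite sqr_ge0.
have wa : 0 < w / Num.sqrt a by rewrite divr_gt0 ?sqrtr_gt0.
have : (w / Num.sqrt a) * (w / Num.sqrt a) <= N x * N y.
  by apply: ler_pM => //; exact: ltW.
have -> : (w / Num.sqrt a) * (w / Num.sqrt a) = w ^+ 2 / a.
  by rewrite -expr2 exprMn exprVn sqr_sqrtr // ltW.
move=> hh.
have -> : w * cm (x - y) = a / w * cm (x - y) * (w ^+ 2 / a).
  by field; rewrite !gt_eqF.
by rewrite ler_wpM2l // mulr_ge0 ?cm_ge0 // divr_ge0 // ltW.
Qed.

(* The set of times at which the initial roots are chained to the current ones is open and
   closed, by continuity of roots. *)
Lemma match_path (d : nat) (G : R -> {poly C}) (V : C -> Prop) (eps : R) (ra : seq C) :
  (forall t, G t \is monic) -> (forall t, size (G t) = d.+1) ->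
  (forall t0 k, ccvg (nbhs t0) (fun t => (G t)`_k) (G t0)`_k) ->
  (forall t z, 0 <= t <= 1 -> root (G t) z -> V z) ->
  0 < eps -> size ra = d -> G 0 = \prod_(z <- ra) ('X - z%:P) ->
  exists B, [/\ size B = d, G 1 = \prod_(z <- B) ('X - z%:P) &
    forall i, (i < d)%N -> chainrel a w h V eps (nth 0 ra i) (nth 0 B i)].
Proof.
move=> Gm sG Gc GV eps0 sra G0.
pose Rel := chainrel a w h V eps.
pose P t := exists B, [/\ size B = d, G t = \prod_(z <- B) ('X - z%:P) &
    forall i, (i < d)%N -> Rel (nth 0 ra i) (nth 0 B i)].
apply: (@locally_constant_01 _ P); last first.
  by exists ra; split => // i _; exact: chainrel_refl.
move=> t0 t0I.
have [rs [srs Grs]] := monic_roots (Gm t0).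
have srs' : size rs = d by move: srs; rewrite sG => -[].
have sG' t : size (G t) = (size rs).+1 by rewrite sG srs'.
have Gc' k : ccvg (nbhs t0) (fun t => (G t)`_k) (\prod_(z <- rs) ('X - z%:P))`_k.
  by rewrite -Grs; apply: Gc.
have [Bf [hB cB]] := roots_cont Gm sG' Gc'.
have e0 : 0 < eps * (w / a) by rewrite mulr_gt0 // divr_gt0.
have near_all : \forall t \near t0, forall i : 'I_d,
    cm (nth 0 (Bf t) i - nth 0 rs i) < eps * (w / a).
  apply: (@filter_forall R 'I_d (fun (i : 'I_d) (t : R) =>
    cm (nth 0 (Bf t) i - nth 0 rs i) < eps * (w / a)) (nbhs t0) _) => i; have := cB i; rewrite srs' => /(_ (ltn_ord i)).
  by move=> /ccvgP; apply.
apply: filterS near_all => t small tI.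
have [sBf GBf] := hB t.
have VB i : (i < d)%N -> V (nth 0 (Bf t) i).
  move=> id; apply: (GV t); first by move: tI; rewrite in_itv.
  by rewrite GBf root_prod_XsubC mem_nth // sBf srs'.
have Vr i : (i < d)%N -> V (nth 0 rs i).
  move=> id; apply: (GV t0); first by move: t0I; rewrite in_itv.
  by rewrite Grs root_prod_XsubC mem_nth // srs'.
have dist i : (i < d)%N -> s (nth 0 rs i) (nth 0 (Bf t) i) <= eps.
  move=> id; apply: le_trans (ls_le_cm _ _) _.
  have := small (Ordinal id); rewrite /= cmB => /ltW sm.
  apply: (@le_trans _ _ (a / w * (eps * (w / a)))).
    by rewrite ler_wpM2l // divr_ge0 // ltW.
  by rewrite le_eqVlt; apply/orP; left; apply/eqP; field; rewrite !gt_eqF.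
split=> -[B [sB GB RB]].
  have pe : perm_eq B (Bf t) by apply: prod_XsubC_eq; rewrite -GB -GBf.
  have [|B' [pB' sB' hB']] := @perm_transfer _ 0 B (Bf t) rs pe; first by rewrite sBf.
  exists B'; split; [by rewrite sB' sB | by rewrite Grs (perm_big _ pB') |].
  move=> i id; have [|j [jd e1 e2]] := hB' i; first by rewrite sB.
  rewrite e2; apply: chainrel_trans (RB i id) _; rewrite e1.
  rewrite sBf srs' in jd.
  by apply: chainrel_step; [exact: Vr | rewrite lsC dist].
have pe : perm_eq B rs by apply: prod_XsubC_eq; rewrite -GB -Grs.
have [|B' [pB' sB' hB']] := @perm_transfer _ 0 B rs (Bf t) pe; first by rewrite sBf.
exists B'; split; [by rewrite sB' sB | by rewrite GBf (perm_big _ pB') |].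
move=> i id; have [|j [jd e1 e2]] := hB' i; first by rewrite sB.
rewrite e2; apply: chainrel_trans (RB i id) _; rewrite e1.
rewrite srs' in jd.
by apply: chainrel_step; [exact: VB | rewrite dist].
Qed.

(** At a root of g + b (f - g), where b is a point of the bent path, |g| = |b| |f - g|, and |b| <= 2
    by [cm_bentpath]: this is the zone in which the chain runs. The family is divided by its leading
    coefficient to meet the monic form of [roots_cont]. *)
Lemma root_matching (d : nat) (g f : {poly C}) (ra rb : 'I_d -> C) (dl eps : R) :
  size g = d.+1 -> size f = d.+1 ->
  g = lead_coef g *: \prod_i ('X - (ra i)%:P) ->
  f = lead_coef f *: \prod_i ('X - (rb i)%:P) ->
  (forall z, cm (f.[z] - g.[z]) <= dl * N z ^+ d) -> 0 < eps ->
  exists sg : {perm 'I_d}, forall i,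
    chainrel a w h (fun z => cm g.[z] <= 2 * dl * N z ^+ d) eps (ra i) (rb (sg i)).
Proof.
move=> szg szf ga fb fg eps0.
have lg0 : lead_coef g != 0 by rewrite lead_coef_eq0 -size_poly_eq0 szg.
have lf0 : lead_coef f != 0 by rewrite lead_coef_eq0 -size_poly_eq0 szf.
have [kap kap01 kapP] := bentpath_avoids lg0 lf0.
pose l t := lead_coef g + bentpath kap t * (lead_coef f - lead_coef g).
pose G0 t := g + bentpath kap t *: (f - g).
have G0d t : (G0 t)`_d = l t.
  by rewrite coefD coefZ coefB /l /lead_coef szg szf.
have sG0 t : size (G0 t) = d.+1.
  apply/eqP; rewrite eqn_leq; apply/andP; split; last first.
    by apply: contraT; rewrite -leqNgt => le; move: (kapP t); rewrite -/(l t) -G0d nth_default ?eqxx.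
  apply: leq_trans (size_polyD _ _) _; rewrite szg geq_max leqnn /=.
  apply: leq_trans (size_scale_leq _ _) _; apply: leq_trans (size_polyD _ _) _.
  by rewrite size_polyN szg szf maxnn.
pose G t := (l t)^-1 *: G0 t.
have sG t : size (G t) = d.+1 by rewrite size_scale ?sG0 // invr_eq0 kapP.
have Gm t : G t \is monic.
  by rewrite monicE /lead_coef sG /= coefZ G0d mulVf // kapP.
pose ta := [tuple ra i | i < d]; pose tb := [tuple rb i | i < d].
have bt0 : bentpath kap 0 = 0 by rewrite /bentpath mul0r mulr0.
have bt1 : bentpath kap 1 = 1 by rewrite /bentpath subrr !mulr0.
have Gc t0 k : ccvg (nbhs t0) (fun t => (G t)`_k) (G t0)`_k.
  rewrite /G coefZ; under eq_fun do rewrite coefZ.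
  apply: ccvgM.
    apply: ccvgV (kapP _) _; apply: ccvgD; first exact: ccvg_cst.
    by apply: ccvgM; [exact: ccvg_bentpath | exact: ccvg_cst].
  rewrite coefD; under eq_fun do rewrite coefD; apply: ccvgD; first exact: ccvg_cst.
  rewrite coefZ; under eq_fun do rewrite coefZ.
  by apply: ccvgM; [exact: ccvg_bentpath | exact: ccvg_cst].
have GV t z : 0 <= t <= 1 -> root (G t) z -> cm g.[z] <= 2 * dl * N z ^+ d.
  move=> t01; rewrite rootE hornerZ mulf_eq0 invr_eq0 (negPf (kapP _)) /=.
  rewrite !hornerE addr_eq0 => /eqP ->; rewrite cmN cmM -mulrA.
  by apply: ler_pM; rewrite ?cm_ge0 ?cm_bentpath //; exact: fg.
have G00 : G 0 = \prod_(z <- ta) ('X - z%:P).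
  rewrite /G /l /G0 bt0 mul0r scale0r !addr0 big_tuple [X in _ *: X = _]ga scalerA mulVf // scale1r.
  by apply: eq_bigr => i _; rewrite tnth_mktuple.
have [B [sB GB RB]] := match_path Gm sG Gc GV eps0 (size_tuple ta) G00.
have e1 : G 1 = \prod_(z <- tb) ('X - z%:P).
  rewrite /G /l /G0 bt1 mul1r scale1r addrC subrK addrC subrK.
  rewrite [X in _ *: X = _]fb scalerA mulVf // scale1r big_tuple.
  by apply: eq_bigr => i _; rewrite tnth_mktuple.
have /tuple_permP [sg Bsg] : perm_eq B tb by apply: prod_XsubC_eq; rewrite -GB -e1.
exists sg => i; have := RB i (ltn_ord i).
rewrite Bsg -!tnth_nth !tnth_mktuple; apply.
Qed.

(** The factor of [chain_bound], times the bound 2 on the path parameter in [root_matching]. *)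
Definition match_const (d : nat) : R := d.+1%:R * (8 * d%:R) ^+ d * 2.

Lemma match_const_ge0 d : 0 <= match_const d.
Proof. by rewrite !mulr_ge0 // exprn_ge0 // mulr_ge0. Qed.

Lemma matched_ball (d : nat) (g f : {poly C}) (ra rb : 'I_d -> C) (dl : R) :
  (0 < d)%N -> size g = d.+1 -> size f = d.+1 ->
  g = lead_coef g *: \prod_i ('X - (ra i)%:P) ->
  f = lead_coef f *: \prod_i ('X - (rb i)%:P) ->
  0 <= dl ->
  (forall z, cm (f.[z] - g.[z]) <= dl * N z ^+ d) ->
  exists sg : {perm 'I_d}, forall i, 0 < s (ra i) (rb (sg i)) ->
   forall z, s z (ra i) <= 2 * s (ra i) (rb (sg i)) ->
     cm g.[z] <= match_const d * dl * N z ^+ d.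
Proof.
move=> d0 szg szf ga fb dl0 fg.
have d0' : 0 < d%:R :> R by rewrite ltr0n.
(* The jump size has to be fixed before the permutation is known, so [S^-1] lies below the threshold
   of [chain_bound] for all pairs at positive distance at once. Pairs at distance 0 contribute
   [0^-1 = 0]. *)
pose S : R := 1 + \sum_(i < d) \sum_(j < d) (s (ra i) (rb j) / (2 * d%:R))^-1.
have tge0 i j : 0 <= (s (ra i) (rb j) / (2 * d%:R))^-1.
  by rewrite invr_ge0 divr_ge0 ?ls_ge0 // mulr_ge0.
have S0 : 0 < S by rewrite ltr_pwDl // sumr_ge0 // => i _; rewrite sumr_ge0.
have epsP i j : 0 < s (ra i) (rb j) -> S^-1 <= s (ra i) (rb j) / (2 * d%:R).
  move=> sij; rewrite -[leRHS]invrK lef_pV2 ?posrE //; last first.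
    by rewrite invr_gt0 divr_gt0 // mulr_gt0.
  apply: (@le_trans _ _ (\sum_(i < d) \sum_(j < d) (s (ra i) (rb j) / (2 * d%:R))^-1)).
    rewrite (bigD1 i) //= (bigD1 j) //= -addrA lerDl addr_ge0 // ?sumr_ge0 // => k _.
    by rewrite sumr_ge0.
  by rewrite lerDr.
have Sv0 : 0 < S^-1 by rewrite invr_gt0.
have [sg hsg] := root_matching szg szf ga fb fg Sv0.
exists sg => i si z zi.
have -> : match_const d * dl * N z ^+ d = d.+1%:R * (8 * d%:R) ^+ d * (2 * dl) * N z ^+ d.
  by rewrite /match_const; ring.
apply: (chain_bound _ _ d0 _ _ _ _ (hsg i)) => //.
- by rewrite szg.
- by rewrite mulr_ge0.
- exact: ltW.
- rewrite [in X in X <= _]ga hornerZ horner_prod (bigD1 i) //= hornerXsubC subrr mul0r mulr0 cm0.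
  by rewrite !mulr_ge0 // exprn_ge0 // sqrtr_ge0.
- exact: epsP.
Qed.

End RootMatching.

(** * Lines in projective space *)

Section VectorGeometry.
Variable R : realType.
Local Notation C := (complex R).
Variable n : nat.
Implicit Types u v x y : cvec R n.

Definition lin (z : C) u v : cvec R n := [ffun i => z * u i + v i].
Definition vscale (z : C) u : cvec R n := [ffun i => z * u i].

Lemma cabs2_ge0 (z : C) : 0 <= cabs2 z.
Proof. by rewrite cabs2E sqr_ge0. Qed.

Lemma cabs2M (z t : C) : cabs2 (z * t) = cabs2 z * cabs2 t.
Proof. by rewrite !cabs2E cmM exprMn. Qed.

Lemma vnorm2_ge0 u : 0 <= vnorm2 u.
Proof. by apply: sumr_ge0 => i _; exact: cabs2_ge0. Qed.

Lemma cabs2_le_vnorm2 u i : cabs2 (u i) <= vnorm2 u.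
Proof.
by rewrite /vnorm2 (bigD1 i) //= lerDl sumr_ge0 // => j _; exact: cabs2_ge0.
Qed.

Lemma vnorm2_eq0 u : (vnorm2 u == 0) = (u == 0).
Proof.
apply/eqP/eqP => [u0|->].
  apply/ffunP => i; rewrite ffunE; apply/eqP; rewrite -cm_eq0 -sqrf_eq0 -cabs2E.
  by rewrite eq_le cabs2_ge0 andbT -[leRHS]u0 cabs2_le_vnorm2.
by rewrite /vnorm2 big1 // => i _; rewrite ffunE /cabs2 expr0n addr0.
Qed.

Lemma vnorm2_gt0 u : (0 < vnorm2 u) = (u != 0).
Proof. by rewrite lt_def vnorm2_ge0 andbT vnorm2_eq0. Qed.

Lemma vnorm2_scale z u : vnorm2 (vscale z u) = cabs2 z * vnorm2 u.
Proof. by rewrite /vnorm2 mulr_sumr; apply: eq_bigr => i _; rewrite ffunE cabs2M. Qed.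

Lemma hdot_scale z t u v : hdot (vscale z u) (vscale t v) = z * cconj t * hdot u v.
Proof.
rewrite /hdot mulr_sumr; apply: eq_bigr => i _; rewrite !ffunE cconjM; ring.
Qed.

Lemma hdotC u v : hdot u v = cconj (hdot v u).
Proof.
by rewrite /hdot cconj_sum; apply: eq_bigr => i _; rewrite cconjM cconjK mulrC.
Qed.

Lemma hdotxx u : hdot u u = realC (vnorm2 u).
Proof. by rewrite /hdot /vnorm2 realC_sum; apply: eq_bigr => i _; rewrite mulc_conj. Qed.

Lemma hdot_linl z u v x : hdot (lin z u v) x = z * hdot u x + hdot v x.
Proof.
rewrite /hdot mulr_sumr -big_split /=; apply: eq_bigr => i _; rewrite ffunE; ring.
Qed.

Lemma hdot_linr z u v x : hdot x (lin z u v) = cconj z * hdot x u + hdot x v.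
Proof.
rewrite /hdot mulr_sumr -big_split /=; apply: eq_bigr => i _.
rewrite ffunE cconjD cconjM; ring.
Qed.

Definition gram u v : R := vnorm2 u * vnorm2 v - cabs2 (hdot u v).

Lemma gramC u v : gram u v = gram v u.
Proof. by rewrite /gram mulrC (hdotC u) !cabs2E cm_conj. Qed.

Lemma hdot_lin_lin z t u v : hdot (lin z u v) (lin t u v) =
  z * cconj t * realC (vnorm2 u) + z * hdot u v + cconj t * cconj (hdot u v)
  + realC (vnorm2 v).
Proof. rewrite hdot_linl !hdot_linr !hdotxx -(hdotC v u); ring. Qed.

Lemma vnorm2_lin z u v : vnorm2 (lin z u v) =
  cabs2 z * vnorm2 u + 2 * complex.Re (z * hdot u v) + vnorm2 v.
Proof.
have := hdotxx (lin z u v); rewrite hdot_lin_lin => /(congr1 (@complex.Re R)).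
rewrite Re_realC => <-; rewrite /cabs2 /realC.
by case: z (hdot u v) => z1 z2 [h1 h2] /=; ring.
Qed.

Lemma gram_lin_lin z t u v : gram (lin z u v) (lin t u v) = cabs2 (z - t) * gram u v.
Proof.
rewrite /gram !vnorm2_lin hdot_lin_lin /cabs2 /realC.
by case: z t (hdot u v) => z1 z2 [t1 t2] [h1 h2] /=; ring.
Qed.

Lemma gram_linl z u v : gram (lin z u v) u = gram u v.
Proof.
rewrite gramC /gram vnorm2_lin hdot_linr hdotxx /cabs2 /realC.
by case: z (hdot u v) => z1 z2 [h1 h2] /=; ring.
Qed.

Lemma gram_ge0 u v : 0 <= gram u v.
Proof.
have [u0|u0] := eqVneq (vnorm2 u) 0.
  move/eqP: u0; rewrite vnorm2_eq0 => /eqP ->.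
  rewrite /gram /vnorm2 /hdot [X in X * _]big1 ?mul0r; last first.
    by move=> i _; rewrite ffunE /cabs2 expr0n addr0.
  by rewrite big1 /cabs2 /= ?expr0n ?addr0 ?subr0 // => i _; rewrite ffunE mul0r.
have u1 : 0 < vnorm2 u by rewrite lt_def u0 vnorm2_ge0.
(* The multiple of u that makes z u + v orthogonal to u. *)
pose z := - realC (vnorm2 u)^-1 * cconj (hdot u v).
have := mulr_ge0 (vnorm2_ge0 u) (vnorm2_ge0 (lin z u v)).
rewrite vnorm2_lin.
suff -> : vnorm2 u * (cabs2 z * vnorm2 u + 2 * complex.Re (z * hdot u v) + vnorm2 v) =
    gram u v by [].
rewrite /gram /z /cabs2 /realC /cconj; case: (hdot u v) => h1 h2 /=.
field; exact: u0.
Qed.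

Lemma gram_le u v : gram u v <= vnorm2 u * vnorm2 v.
Proof. by rewrite /gram lerBlDr lerDl cabs2_ge0. Qed.

Definition wedge u v : R := Num.sqrt (gram u v).

Lemma wedge_sqr u v : wedge u v ^+ 2 = gram u v.
Proof. by rewrite sqr_sqrtr // gram_ge0. Qed.

Lemma lN2_vnorm2 u v z : vnorm2 u != 0 ->
  lN2 (vnorm2 u) (wedge u v) (hdot v u) z = vnorm2 (lin z u v).
Proof.
move=> u0; rewrite /lN2 wedge_sqr vnorm2_lin (hdotC v u) /gram /cabs2 /realC /cconj.
by case: z (hdot u v) => z1 z2 [h1 h2] /=; field.
Qed.

(* The squared sine of the angle between the lines of [u] and [v] (0 if [u] or [v] is 0). *)
Definition gap u v : R := gram u v / (vnorm2 u * vnorm2 v).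

Lemma gapC u v : gap u v = gap v u.
Proof. by rewrite /gap gramC mulrC [in RHS]mulrC [vnorm2 v * _]mulrC. Qed.

Lemma gap_ge0 u v : 0 <= gap u v.
Proof. by rewrite divr_ge0 ?gram_ge0 ?mulr_ge0 ?vnorm2_ge0. Qed.

Lemma gap_scale z t u v : z != 0 -> t != 0 ->
  gap (vscale z u) (vscale t v) = gap u v.
Proof.
move=> z0 t0; rewrite /gap /gram !vnorm2_scale hdot_scale !cabs2M.
have -> : cabs2 (cconj t) = cabs2 t by rewrite !cabs2E cm_conj.
have z1 : cabs2 z != 0 by rewrite cabs2E sqrf_eq0 cm_eq0.
have t1 : cabs2 t != 0 by rewrite cabs2E sqrf_eq0 cm_eq0.
have -> : cabs2 z * vnorm2 u * (cabs2 t * vnorm2 v) - cabs2 z * cabs2 t * cabs2 (hdot u v)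
  = (cabs2 z * cabs2 t) * (vnorm2 u * vnorm2 v - cabs2 (hdot u v)) by ring.
have -> : cabs2 z * vnorm2 u * (cabs2 t * vnorm2 v) =
  (cabs2 z * cabs2 t) * (vnorm2 u * vnorm2 v) by ring.
by rewrite -mulf_div divff ?mul1r // mulf_neq0.
Qed.

Lemma ls_gap u v z t : u != 0 -> wedge u v != 0 ->
  ls (vnorm2 u) (wedge u v) (hdot v u) z t ^+ 2 = gap (lin z u v) (lin t u v).
Proof.
move=> u0 w0; have u1 : 0 < vnorm2 u by rewrite vnorm2_gt0.
have w1 : 0 < wedge u v by rewrite lt_def w0 sqrtr_ge0.
rewrite lsE // !exprMn exprVn exprMn !lN_sqr // !lN2_vnorm2 ?gt_eqF //.
by rewrite /gap gram_lin_lin wedge_sqr cabs2E [gram u v * _]mulrC.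
Qed.

End VectorGeometry.

(** * Measurability *)

Section GaussianIntegral.
Variable R : realType.
Local Open Scope ereal_scope.
Local Notation gam := (@normal_prob R 0 1).

(** [gint] integrates functions of untyped sequences, while the sigma-algebra lives on tuples of a
    fixed length. *)
Definition gmeas (m : nat) (f : seq R -> \bar R) : Prop :=
  measurable_fun [set: m.-tuple R] ((fun t => f t) : m.-tuple R -> \bar R).

Definition tcons m (x : measurableTypeR R * m.-tuple R) : m.+1.-tuple R := [tuple of x.1 :: x.2].

Lemma measurable_tcons m : measurable_fun setT (@tcons m).
Proof. exact: (measurable_cons (f := fst) (g := snd)). Qed.

HB.instance Definition _ m :=
  isMeasurableFun.Build _ _ _ _ (@tcons m) (@measurable_tcons m).

Lemma gmeas_cons m f x : gmeas m.+1 f -> gmeas m (fun s => f (x :: s)).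
Proof.
move=> mf.
have h : measurable_fun setT (fun t : m.-tuple R => [tuple of x :: t] : m.+1.-tuple R).
  exact: (measurable_cons (@measurable_cst _ _ _ _ setT x) (@measurable_id _ _ setT)).
exact: (measurableT_comp mf h).
Qed.

(** Turns the iterated integral into an integral against one probability measure, the image of a
    product measure under [tcons], so that Tonelli and almost-everywhere arguments apply. *)
Lemma gint_tuple m : exists P : probability (m.-tuple R) R,
  forall f : seq R -> \bar R, (forall s, 0 <= f s) -> gmeas m f ->
    gint m f = \int[P]_t f t.
Proof.
elim: m => [|m [P IH]].
  exists (dirac [tuple]) => f f0 mf /=.
  by rewrite integral_dirac // diracT mul1e.
pose Q : probability _ R := (gam \x P).
exists (distribution Q (@tcons m)) => f f0 mf /=.
rewrite ge0_integral_pushforward //.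
rewrite (fubini_tonelli1 _ (measurableT_comp mf (@measurable_tcons m)) (fun x => f0 _)).
by apply: eq_integral => x _; rewrite IH //; exact: gmeas_cons.
Qed.

Lemma eq_gint m (f g : seq R -> \bar R) : (forall s, size s = m -> f s = g s) ->
  gint m f = gint m g.
Proof.
elim: m f g => [|m IH] f g fg /=; first exact: fg.
by apply: eq_integral => x _; apply: IH => s ss; apply: fg; rewrite /= ss.
Qed.

Lemma gint_ge0 m (f : seq R -> \bar R) : (forall s, 0 <= f s) -> 0 <= gint m f.
Proof.
by elim: m f => [|m IH] f f0 //=; apply: integral_ge0 => x _; apply: IH.
Qed.

Definition upd (j : nat) (s : seq R) (y : R) : seq R := set_nth 0%R s j y.

Lemma tnth_upd_size m j (t : m.-tuple R) y : (j < m)%N -> size (upd j t y) == m.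
Proof. by move=> jm; rewrite size_set_nth size_tuple (maxn_idPr jm). Qed.

Lemma gmeas_upd m j (f : seq R -> \bar R) : (j < m)%N -> gmeas m f ->
  measurable_fun [set: (m.-tuple R * R)%type] (fun x => f (upd j x.1 x.2)).
Proof.
move=> jm mf.
pose phi (x : m.-tuple R * R) : m.-tuple R := Tuple (tnth_upd_size x.1 x.2 jm).
suff h : measurable_fun setT phi by exact: (measurableT_comp mf h).
apply/measurable_fun_tnthP => i.
have [ij|ij] := eqVneq (i : nat) j.
  have -> : (@tnth m R ^~ i) \o phi = snd.
    by apply/funext => x; rewrite /= (tnth_nth 0%R) /= nth_set_nth /= ij eqxx.
  exact: measurable_snd.
have -> : (@tnth m R ^~ i) \o phi = (fun x => tnth x.1 i).
  by apply/funext => x; rewrite /= !(tnth_nth 0%R) /= nth_set_nth /= (negPf ij).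
exact: (measurableT_comp (measurable_tnth i) measurable_fst).
Qed.

Lemma gmeas_int m j (f : seq R -> \bar R) : (j < m)%N -> (forall s, 0 <= f s) ->
  gmeas m f -> gmeas m (fun s => \int[gam]_y f (upd j s y)).
Proof.
move=> jm f0 mf.
exact: (measurable_fun_fubini_tonelli_F (m2 := gam) _ (gmeas_upd jm mf) (fun x => f0 _)).
Qed.

(* Fubini: a coordinate of a Gaussian vector may be integrated first. *)
Lemma gint_resample m j (f : seq R -> \bar R) : (j < m)%N -> (forall s, 0 <= f s) ->
  gmeas m f -> gint m f = gint m (fun s => \int[gam]_y f (upd j s y)).
Proof.
elim: m j f => [//|m IH] [|j] f jm f0 mf /=; last first.
  apply: eq_integral => x _; rewrite (IH j) //; exact: gmeas_cons.
have [P hP] := gint_tuple m.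
(* Once the first entry is resampled, the integrand is constant in the outer variable, whose law has
   mass 1. *)
rewrite [RHS](_ : _ = gint m (fun s => \int[gam]_y f (y :: s))); last first.
  rewrite integral_cst // -[RHS]mule1; congr (_ * _); exact: probability_setT.
have mf2 : measurable_fun [set: (R * m.-tuple R)%type] (fun x => f (x.1 :: x.2)).
  exact: (measurableT_comp mf (@measurable_tcons m)).
rewrite [RHS]hP; last 2 first.
- by move=> s; exact: integral_ge0.
- exact: (measurable_fun_fubini_tonelli_G (m1 := gam) _ mf2 (fun x => f0 _)).
transitivity (\int[gam]_x \int[P]_t f (x :: t)).
  by apply: eq_integral => x _; rewrite hP //; exact: gmeas_cons.
have := fubini_tonelli (m1 := gam) (m2 := P) _ mf2 (fun x => f0 _).
exact.
Qed.

End GaussianIntegral.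

Section Measurability.
Variable R : realType.
Local Notation C := (complex R).

(** The integral of a nonnegative function is a supremum over the simple functions below it, and
    this supremum is monotone for arbitrary integrands. *)
Lemma ge0_le_integral_nomeas d (T : measurableType d) (mu : {measure set T -> \bar R})
    (D : set T) (f g : T -> \bar R) :
  (forall x, D x -> (0 <= f x)%E) -> (forall x, D x -> (f x <= g x)%E) ->
  (\int[mu]_(x in D) f x <= \int[mu]_(x in D) g x)%E.
Proof.
move=> f0 fg; rewrite !ge0_integralE //; last first.
  by move=> x Dx; exact: le_trans (f0 _ Dx) (fg _ Dx).
apply: le_ereal_sup => _ [h hf <-]; exists h => // x.
apply: le_trans (hf x) _; rewrite /patch; case: ifPn => // /set_mem; exact: fg.
Qed.

Context d (T : measurableType d).

Lemma mset (b : T -> bool) : measurable_fun setT b -> measurable [set t | b t].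
Proof.
move=> mb; have -> : [set t | b t] = setT `&` b @^-1` [set true].
  by apply/seteqP; split => t /=; [move=> ->|case].
exact: mb.
Qed.

Lemma mset_bool (b : T -> bool) : measurable [set t | b t] -> measurable_fun setT b.
Proof.
move=> mb; apply: (@measurable_fun_bool _ _ _ _ true); rewrite setTI.
have -> // : b @^-1` [set true] = [set t | b t].
by apply/seteqP; split => t /=.
Qed.

Definition cmeas (f : T -> C) : Prop :=
  measurable_fun setT (fun t => complex.Re (f t)) /\
  measurable_fun setT (fun t => complex.Im (f t)).

Lemma cmeas_cst (k : C) : cmeas (fun=> k).
Proof. by split; exact: measurable_cst. Qed.

Lemma cmeas_ext (f g : T -> C) : (forall t, f t = g t) -> cmeas f -> cmeas g.
Proof. by move=> /funext ->. Qed.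

Lemma cmeasD (f g : T -> C) : cmeas f -> cmeas g -> cmeas (fun t => f t + g t).
Proof.
move=> [f1 f2] [g1 g2]; split.
  by under eq_fun do rewrite cReD; exact: measurable_funD.
by under eq_fun do rewrite cImD; exact: measurable_funD.
Qed.

Lemma cmeasM (f g : T -> C) : cmeas f -> cmeas g -> cmeas (fun t => f t * g t).
Proof.
move=> [f1 f2] [g1 g2]; split.
  by under eq_fun do rewrite cReM; apply: measurable_funB; exact: measurable_funM.
by under eq_fun do rewrite cImM; apply: measurable_funD; exact: measurable_funM.
Qed.

Lemma cmeas_sum (I : Type) (r : seq I) (P : pred I) (f : I -> T -> C) :
  (forall i, cmeas (f i)) -> cmeas (fun t => \sum_(i <- r | P i) f i t).
Proof.
move=> fm; elim: r => [|i r ih].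
  by under eq_fun do rewrite big_nil; exact: cmeas_cst.
under eq_fun do rewrite big_cons.
by case: (P i) => //; apply: cmeasD.
Qed.

Lemma cmeas_prod (I : Type) (r : seq I) (P : pred I) (f : I -> T -> C) :
  (forall i, cmeas (f i)) -> cmeas (fun t => \prod_(i <- r | P i) f i t).
Proof.
move=> fm; elim: r => [|i r ih].
  by under eq_fun do rewrite big_nil; exact: cmeas_cst.
under eq_fun do rewrite big_cons.
by case: (P i) => //; apply: cmeasM.
Qed.

Lemma cmeasX (f : T -> C) m : cmeas f -> cmeas (fun t => f t ^+ m).
Proof.
move=> fm; elim: m => [|m ih]; first exact: cmeas_cst.
by under eq_fun do rewrite exprS; apply: cmeasM.
Qed.

Lemma cmeas_conj (f : T -> C) : cmeas f -> cmeas (fun t => cconj (f t)).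
Proof. by move=> [f1 f2]; split => //=; exact: measurable_funN. Qed.

Lemma cmeas_cabs2 (f : T -> C) : cmeas f -> measurable_fun setT (fun t => cabs2 (f t)).
Proof. by move=> [f1 f2]; apply: measurable_funD; exact: measurable_funX. Qed.

Lemma cmeas_if (b : T -> bool) (f g : T -> C) : measurable_fun setT b ->
  cmeas f -> cmeas g -> cmeas (fun t => if b t then f t else g t).
Proof.
move=> mb [f1 f2] [g1 g2]; split.
  by under eq_fun do rewrite fun_if; exact: measurable_fun_ifT.
by under eq_fun do rewrite fun_if; exact: measurable_fun_ifT.
Qed.

Lemma cmeas_neq0 (f : T -> C) : cmeas f -> measurable_fun setT (fun t => f t != 0).
Proof.
move=> /cmeas_cabs2 m.
have -> : (fun t => f t != 0) = (fun t => 0 < cabs2 (f t)).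
  by apply/funext => t; rewrite lt_def cabs2E sqr_ge0 andbT sqrf_eq0 cm_eq0.
by apply: measurable_fun_ltr => //; exact: measurable_cst.
Qed.

Definition pmeas (G : T -> {poly C}) : Prop := forall k, cmeas (fun t => (G t)`_k).

Lemma pmeas_cst g : pmeas (fun=> g). Proof. by move=> k; exact: cmeas_cst. Qed.

Lemma pmeas_C (f : T -> C) : cmeas f -> pmeas (fun t => (f t)%:P).
Proof.
move=> fm k; under eq_fun do rewrite coefC.
by case: eqP => _ //; exact: cmeas_cst.
Qed.

Lemma pmeasD (F G : T -> {poly C}) : pmeas F -> pmeas G -> pmeas (fun t => F t + G t).
Proof. by move=> Fm Gm k; under eq_fun do rewrite coefD; exact: cmeasD. Qed.

Lemma pmeasM (F G : T -> {poly C}) : pmeas F -> pmeas G -> pmeas (fun t => F t * G t).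
Proof.
move=> Fm Gm k; under eq_fun do rewrite coefM; apply: cmeas_sum => i; exact: cmeasM.
Qed.

Lemma pmeasZ (f : T -> C) (G : T -> {poly C}) : cmeas f -> pmeas G ->
  pmeas (fun t => f t *: G t).
Proof. by move=> fm Gm k; under eq_fun do rewrite coefZ; exact: cmeasM. Qed.

Lemma pmeas_sum (I : Type) (r : seq I) (P : pred I) (f : I -> T -> {poly C}) :
  (forall i, pmeas (f i)) -> pmeas (fun t => \sum_(i <- r | P i) f i t).
Proof.
move=> fm; elim: r => [|i r ih].
  by under eq_fun do rewrite big_nil; exact: pmeas_cst.
under eq_fun do rewrite big_cons.
by case: (P i) => //; apply: pmeasD.
Qed.

Lemma pmeas_prod (I : Type) (r : seq I) (P : pred I) (f : I -> T -> {poly C}) :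
  (forall i, pmeas (f i)) -> pmeas (fun t => \prod_(i <- r | P i) f i t).
Proof.
move=> fm; elim: r => [|i r ih].
  by under eq_fun do rewrite big_nil; exact: pmeas_cst.
under eq_fun do rewrite big_cons.
by case: (P i) => //; apply: pmeasM.
Qed.

Lemma pmeasX (F : T -> {poly C}) m : pmeas F -> pmeas (fun t => F t ^+ m).
Proof.
move=> fm; elim: m => [|m ih]; first exact: pmeas_cst.
by under eq_fun do rewrite exprS; apply: pmeasM.
Qed.

Lemma pmeas_horner (G : T -> {poly C}) D (z : C) : pmeas G ->
  (forall t, (size (G t) <= D)%N) -> cmeas (fun t => (G t).[z]).
Proof.
move=> Gm sG; under eq_fun => t do rewrite (horner_coef_wide _ (sG t)).
by apply: cmeas_sum => i; apply: cmeasM => //; exact: cmeas_cst.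
Qed.

Lemma pmeas_size_leq (G : T -> {poly C}) m : pmeas G ->
  measurable_fun setT (fun t => (size (G t) <= m)%N).
Proof.
move=> Gm; apply: mset_bool.
have -> : [set t | (size (G t) <= m)%N] =
    \bigcap_(k in [set k | (m <= k)%N]) [set t | ~~ ((G t)`_k != 0)].
  apply/seteqP; split => t /=.
    by move=> sm k /= mk; rewrite negbK nth_default // (leq_trans sm).
  move=> h; apply/leq_sizeP => k mk; apply/eqP; rewrite -[_ == _]negbK.
  exact: h.
apply: bigcap_measurableType => k _.
by apply: mset; apply: measurable_neg; exact: cmeas_neq0.
Qed.

Lemma pmeas_size_eq (G : T -> {poly C}) m : pmeas G ->
  measurable_fun setT (fun t => size (G t) == m).
Proof.
move=> Gm; under eq_fun do rewrite eqn_leq.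
case: m => [|m].
  under eq_fun do rewrite leq0n andbT; exact: pmeas_size_leq.
under eq_fun do rewrite [(m.+1 <= _)%N]ltnNge.
by apply: measurable_and; [exact: pmeas_size_leq | apply: measurable_neg; exact: pmeas_size_leq].
Qed.

End Measurability.

(** * Measurable selection of roots *)

Section RootSelection.
Variable R : realType.
Local Notation C := (complex R).

Lemma small_natSinv (x : R) : 0 < x -> exists k : nat, k.+1%:R^-1 < x.
Proof.
move=> x0; have xv : 0 <= x^-1 by rewrite invr_ge0 ltW.
exists (Num.bound x^-1); rewrite -[ltRHS]invrK ltf_pV2 ?posrE ?invr_gt0 ?ltr0n //.
by apply: lt_trans (archi_boundP xv) _; rewrite ltr_nat.
Qed.

Lemma finite_gap (rs : seq C) (al be : R) :
  (forall z, z \in rs -> al < complex.Re z \/ be < complex.Im z) ->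
  exists2 e : R, 0 < e & forall z, z \in rs -> al + e < complex.Re z \/ be + e < complex.Im z.
Proof.
elim: rs => [_|y rs ih h]; first by exists 1.
have [|e e0 he] := ih; first by move=> z zr; apply: h; rewrite inE zr orbT.
have [e' e'0 he'] : exists2 e' : R, 0 < e' & al + e' < complex.Re y \/ be + e' < complex.Im y.
  have [ly|ly] := h y (mem_head _ _).
    by exists ((complex.Re y - al) / 2); [rewrite divr_gt0 ?subr_gt0 | left; lra].
  by exists ((complex.Im y - be) / 2); [rewrite divr_gt0 ?subr_gt0 | right; lra].
exists (Num.min e e'); first by rewrite lt_min e0.
move=> z; rewrite inE => /orP[/eqP ->|zr].
  by case: he' => hh; [left|right]; apply: le_lt_trans hh; rewrite lerD2l ge_min lexx orbT.
by case: (he z zr) => hh; [left|right]; apply: le_lt_trans hh; rewrite lerD2l ge_min lexx.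
Qed.

Lemma gap_contra (al e A B D : R) :
  al + e < A -> - (e / 2) <= B - A -> B < al + D -> D < e / 2 -> False.
Proof. by move=> *; lra. Qed.

(** If the closed quadrant contained no root, every root would miss it by some e > 0. A value of g
    below |lead coefficient| (e/2)^(number of roots) forces a point within e/2 of some root, which
    would then be too close to the quadrant. *)
Lemma approx_root (g : {poly C}) (al be : R) : (1 < size g)%N ->
  (forall k : nat, exists z : C, [/\ complex.Re z < al + k.+1%:R^-1,
     complex.Im z < be + k.+1%:R^-1 & cm g.[z] < k.+1%:R^-1]) ->
  exists z, [/\ root g z, complex.Re z <= al & complex.Im z <= be].
Proof.
move=> sg happ; apply: contrapT => nz.
have [rs grs] := closed_field_poly_normal g.
have g0 : g != 0 by rewrite -size_poly_gt0 (ltn_trans _ sg).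
have lg0 : 0 < cm (lead_coef g) by rewrite cm_gt0 lead_coef_eq0.
have rootP z : z \in rs -> root g z.
  by move=> zr; rewrite grs rootZ ?lead_coef_eq0 // root_prod_XsubC.
have [|e e0 he] := @finite_gap rs al be.
  move=> z /rootP rz; have [l1|l1] := ltP al (complex.Re z); first by left.
  have [l2|l2] := ltP be (complex.Im z); first by right.
  by case: nz; exists z.
have e20 : 0 < e / 2 by rewrite divr_gt0.
pose x := Num.min (e / 2) (cm (lead_coef g) * (e / 2) ^+ size rs).
have x0 : 0 < x by rewrite lt_min e20 mulr_gt0 // exprn_gt0.
have [k kx] := small_natSinv x0; have [q [q1 q2 q3]] := happ k.
have /andP[kx1 kx2] : (k.+1%:R^-1 < e / 2) && (k.+1%:R^-1 < cm (lead_coef g) * (e / 2) ^+ size rs).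
  by rewrite -lt_min.
suff [z zr zq] : exists2 z, z \in rs & cm (q - z) <= e / 2.
  have hR := le_trans (Re_le_cm (q - z)) zq; have hI := le_trans (Im_le_cm (q - z)) zq.
  rewrite !(cReD, cImD, cReN, cImN) in hR hI.
  move: hR hI; rewrite !ler_norml => /andP[h1 _] /andP[h2 _].
  case: (he z zr) => hz.
    exact: gap_contra hz h1 q1 kx1.
  exact: gap_contra hz h2 q2 kx1.
apply: contrapT => nz2.
have : cm g.[q] < cm (lead_coef g) * (e / 2) ^+ size rs by apply: lt_trans q3 kx2.
rewrite grs hornerZ cmM lead_coefZ lead_coef_prod_XsubC mulr1.
rewrite ltr_pM2l // ltNge => /negP; apply.
rewrite horner_prod cm_prod.
have -> : (e / 2) ^+ size rs = \prod_(z <- rs) (e / 2).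
  by rewrite big_const_seq count_predT -Monoid.iteropE.
rewrite big_seq [leRHS]big_seq; apply: ler_prod => z zr.
rewrite (ltW e20) /= hornerXsubC leNgt; apply/negP => /ltW lt; apply: nz2.
by exists z.
Qed.

Definition cq (q : rat * rat) : C := Complex (ratr q.1) (ratr q.2).

(** Together with [approx_root], this turns a quantifier over complex roots into countable
    operations on rational points. *)
Lemma rational_near_root (g : {poly C}) z (e : R) : root g z -> 0 < e ->
  exists q : rat * rat, [/\ complex.Re (cq q) < complex.Re z + e,
    complex.Im (cq q) < complex.Im z + e & cm g.[cq q] < e].
Proof.
move=> /factor_theorem [h gh] e0.
pose B := \sum_(i < size h) cm h`_i * (cm z + 1) ^+ i.
have B0 : 0 <= B.
  by apply: sumr_ge0 => i _; rewrite mulr_ge0 ?cm_ge0 // exprn_ge0 // addr_ge0 ?cm_ge0.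
have B1 : 0 < B + 1 by rewrite ltr_wpDl.
(* The bound 1 keeps q in the disc on which B controls the cofactor h, and e / (B + 1) then makes
   |g(q)| < e; the half leaves room for two real coordinates. *)
pose eta := Num.min (Num.min e 1) (e / (B + 1)) / 2.
have mp : 0 < Num.min (Num.min e 1) (e / (B + 1)) by rewrite !lt_min e0 ltr01 divr_gt0.
have eta0 : 0 < eta by rewrite divr_gt0.
have eta2 : eta + eta = Num.min (Num.min e 1) (e / (B + 1)) by rewrite /eta -splitr.
have : eta + eta <= e by rewrite eta2 !ge_min lexx.
have : eta + eta <= 1 by rewrite eta2 !ge_min lexx orbT.
have : eta + eta <= e / (B + 1) by rewrite eta2 ge_min lexx orbT.
move=> h3 h2 h1.
have [a] := @rat_in_itvoo R (complex.Re z - eta) (complex.Re z + eta) ltac:(lra).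
have [b] := @rat_in_itvoo R (complex.Im z - eta) (complex.Im z + eta) ltac:(lra).
rewrite !in_itv /= => /andP[b1 b2] /andP[a1 a2].
exists (a, b); rewrite /cq /=; split; [lra|lra|].
set q : C := Complex _ _.
have qz : cm (q - z) < eta + eta.
  apply: le_lt_trans (cm_le _) _; rewrite !(cReD, cImD, cReN, cImN) /=.
  by apply: ltrD; rewrite ltr_norml; apply/andP; split; lra.
have cq1 : cm q <= cm z + 1.
  have -> : q = (q - z) + z by rewrite subrK.
  apply: le_trans (cmD _ _) _; rewrite addrC lerD2l; lra.
have hB : cm h.[q] <= B.
  rewrite horner_coef; apply: le_trans (cm_sum _ _ _) _; apply: ler_sum => i _.
  rewrite cmM cmX; apply: ler_pM => //; rewrite ?cm_ge0 ?exprn_ge0 ?cm_ge0 //.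
  by apply: lerXn2r; rewrite ?nnegrE ?addr_ge0 ?cm_ge0.
rewrite gh hornerM hornerXsubC cmM.
apply: (@le_lt_trans _ _ (B * cm (q - z))); first by rewrite ler_wpM2r ?cm_ge0.
apply: (@le_lt_trans _ _ ((B + 1) * cm (q - z))).
  by rewrite ler_wpM2r ?cm_ge0 // lerDl.
rewrite mulrC -ltr_pdivlMr //; exact: lt_le_trans qz h3.
Qed.

Context d (T : measurableType d).

Lemma measurable_fun_le (f : T -> R) :
  (forall c, measurable [set t | f t <= c]) -> measurable_fun setT f.
Proof.
move=> mf; apply: (measurability (@RGenOInfty.G R)); first exact: RGenOInfty.measurableE.
move=> _ [_ [x ->] <-]; rewrite setTI.
have -> : f @^-1` `]x, +oo[ = ~` [set t | f t <= x].
  by apply/seteqP; split => t /=; rewrite in_itv /= andbT ltNge => /negP.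
exact: measurableC.
Qed.

Variables (G : T -> {poly C}) (D : nat).
Hypotheses (mG : pmeas G) (sG : forall t, (size (G t) <= D)%N).

Lemma measurable_set_root (al be : T -> R) :
  measurable_fun setT al -> measurable_fun setT be ->
  measurable [set t | (1 < size (G t))%N /\
    exists z, [/\ root (G t) z, complex.Re z <= al t & complex.Im z <= be t]].
Proof.
move=> mal mbe.
have -> : [set t | (1 < size (G t))%N /\
    exists z, [/\ root (G t) z, complex.Re z <= al t & complex.Im z <= be t]] =
  [set t | ~~ (size (G t) <= 1)%N] `&` \bigcap_(k : nat) \bigcup_(q : rat * rat)
    [set t | [&& ratr q.1 < al t + k.+1%:R^-1, ratr q.2 < be t + k.+1%:R^-1 &
       cabs2 (G t).[cq q] < k.+1%:R^-1 ^+ 2]].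
  apply/seteqP; split => t /=.
    move=> [s1 [z [rz z1 z2]]]; split; first by rewrite -ltnNge.
    move=> k _; have [q [q1 q2 q3]] := rational_near_root rz (e := k.+1%:R^-1) ltac:(by rewrite invr_gt0).
    exists q => //=; apply/and3P; split.
    - by apply: lt_le_trans q1 _; rewrite lerD2r.
    - by apply: lt_le_trans q2 _; rewrite lerD2r.
    - by rewrite cabs2E ltr_pXn2r ?nnegrE ?cm_ge0 ?invr_ge0.
  move=> [/negP s1 h]; have s1' : (1 < size (G t))%N by rewrite ltnNge; exact/negP.
  split => //; apply: approx_root => // k; have [q _ /and3P[q1 q2 q3]] := h k I.
  exists (cq q); split => //.
  by move: q3; rewrite cabs2E ltr_pXn2r ?nnegrE ?cm_ge0 ?invr_ge0.
apply: measurableI.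
  by apply: mset; apply: measurable_neg; exact: pmeas_size_leq.
apply: bigcap_measurableType => k _; apply: countable_bigcupT_measurable.
  exact: countableP.
move=> q; apply: mset; apply: measurable_and.
  by apply: measurable_fun_ltr; [exact: measurable_cst|exact: measurable_funD].
apply: measurable_and.
  by apply: measurable_fun_ltr; [exact: measurable_cst|exact: measurable_funD].
apply: measurable_fun_ltr; last exact: measurable_cst.
by apply: cmeas_cabs2; apply: pmeas_horner sG.
Qed.

Lemma lexmin_seq (rs : seq C) : rs != [::] -> exists2 r, r \in rs &
  forall z, z \in rs -> complex.Re r <= complex.Re z /\
    (complex.Re z <= complex.Re r -> complex.Im r <= complex.Im z).
Proof.
elim: rs => [//|y [|y' rs] ih] _.
  by exists y; rewrite ?mem_head // => z; rewrite inE => /eqP ->.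
have [r rr hr] := ih isT.
have [c|c] := boolP ((complex.Re r < complex.Re y) ||
   ((complex.Re r == complex.Re y) && (complex.Im r <= complex.Im y))).
  exists r; first by rewrite inE rr orbT.
  move=> z; rewrite inE => /orP[/eqP ->|/hr //].
  by case/orP: c => [c|/andP[/eqP -> c]]; split => //; [exact: ltW|rewrite leNgt c].
exists y; first by rewrite mem_head.
move: c; rewrite negb_or -leNgt negb_and => /andP[c1 c2].
move=> z; rewrite inE => /orP[/eqP -> //|/hr [z1 z2]]; split; first exact: le_trans z1.
move=> zy; have ry : complex.Re r = complex.Re y.
  by apply/eqP; rewrite eq_le c1 andbT (le_trans z1).
move: c2; rewrite ry eqxx /= -ltNge => /ltW c2; apply: le_trans c2 (z2 _).
by rewrite ry.
Qed.

(* The lexicographically least root is measurable: the existence of a root in a quadrant is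
   tested on rational approximate roots. *)
Lemma root_selection : exists2 r : T -> C, cmeas r &
  forall t, (1 < size (G t))%N -> root (G t) (r t).
Proof.
have /choice [r hr] : forall t, exists r, if (1 < size (G t))%N then
    root (G t) r /\ forall z, root (G t) z -> complex.Re r <= complex.Re z /\
    (complex.Re z <= complex.Re r -> complex.Im r <= complex.Im z) else r = 0.
  move=> t; case: (boolP (1 < size (G t))%N) => s1; last by exists 0.
  have [rs grs] := closed_field_poly_normal (G t).
  have g0 : G t != 0 by rewrite -size_poly_gt0 (ltn_trans _ s1).
  have rE z : root (G t) z = (z \in rs).
    by rewrite grs rootZ ?lead_coef_eq0 // root_prod_XsubC.
  have [|r rr hr] := @lexmin_seq rs.
    apply: contraTneq s1 => e; rewrite grs e big_nil alg_polyC size_polyC.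
    by case: eqP.
  by exists r; rewrite rE; split => // z; rewrite rE; exact: hr.
have good t : (1 < size (G t))%N -> root (G t) (r t) /\ forall z, root (G t) z ->
    complex.Re (r t) <= complex.Re z /\
    (complex.Re z <= complex.Re (r t) -> complex.Im (r t) <= complex.Im z).
  by move=> s1; have := hr t; rewrite s1.
have bad t : (size (G t) <= 1)%N -> r t = 0.
  by move=> s1; have := hr t; rewrite ltnNge s1.
exists r; last by move=> t /good [].
have mRe : measurable_fun setT (fun t => complex.Re (r t)).
  apply: measurable_fun_le => c.
  (* A half plane is exhausted by the quadrants Im z <= N. Polynomials without roots have the
     default [r t = 0], whence the condition [0 <= c]. *)
  have -> : [set t | complex.Re (r t) <= c] =
     ([set t | (size (G t) <= 1)%N] `&` [set _ | 0 <= c]) `|`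
     \bigcup_(N : nat) [set t | (1 < size (G t))%N /\
       exists z, [/\ root (G t) z, complex.Re z <= c & complex.Im z <= N%:R]].
    apply/seteqP; split => t /=.
      have [s1|s1] := leqP (size (G t)) 1; first by rewrite (bad _ s1); left.
      move=> rc; right; have [r1 _] := good t s1.
      exists (Num.bound `|complex.Im (r t)|) => //=; split => //; exists (r t); split => //.
      apply: le_trans (ler_norm _) _; apply: ltW; exact: archi_boundP.
    move=> [[s1 c0]|[N _ [s1 [z [rz zc zN]]]]]; first by rewrite bad.
    by have [_ /(_ _ rz) [h _]] := good t s1; exact: le_trans zc.
  apply: measurableU.
    apply: measurableI; first by apply: mset; exact: pmeas_size_leq.
    by apply: mset; exact: measurable_cst.
  by apply: bigcupT_measurable => N; apply: measurable_set_root; exact: measurable_cst.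
split => //; apply: measurable_fun_le => c.
(* The real part, now known to be measurable, bounds the quadrant: among the roots with this least
   real part, [r t] has the least imaginary part. *)
have -> : [set t | complex.Im (r t) <= c] =
   ([set t | (size (G t) <= 1)%N] `&` [set _ | 0 <= c]) `|`
   [set t | (1 < size (G t))%N /\
     exists z, [/\ root (G t) z, complex.Re z <= complex.Re (r t) & complex.Im z <= c]].
  apply/seteqP; split => t /=.
    have [s1|s1] := leqP (size (G t)) 1; first by rewrite (bad _ s1); left.
    by move=> rc; right; have [r1 _] := good t s1; split => //; exists (r t).
  move=> [[s1 c0]|[s1 [z [rz z1 zc]]]]; first by rewrite bad.
  by have [_ /(_ _ rz) [_ h]] := good t s1; exact: le_trans (h z1) zc.
apply: measurableU.
  apply: measurableI; first by apply: mset; exact: pmeas_size_leq.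
  by apply: mset; exact: measurable_cst.
by apply: measurable_set_root => //; exact: measurable_cst.
Qed.

End RootSelection.

Section RootListSelection.
Variable R : realType.
Local Notation C := (complex R).
Context d (T : measurableType d).

(** Synthetic division: each coefficient of the quotient is a polynomial expression in [r t] and the
    higher coefficients of [G t]. When [G t] has size at most 1 the quotient is 0 and the recursion
    holds trivially. *)
Lemma pmeas_div_XsubC (G : T -> {poly C}) (r : T -> C) D : pmeas G -> cmeas r ->
  (forall t, (size (G t) <= D.+1)%N) ->
  (forall t, (1 < size (G t))%N -> root (G t) (r t)) ->
  pmeas (fun t => G t %/ ('X - (r t)%:P)).
Proof.
move=> mG mr sG hr.
pose H t := G t %/ ('X - (r t)%:P).
have sH t : (size (H t) <= D)%N.
  rewrite size_divp ?polyXsubC_eq0 // size_XsubC /= leq_subLR add1n; exact: sG.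
have rec t k : (H t)`_k = (G t)`_k.+1 + r t * (H t)`_k.+1.
  have [s1|s1] := leqP (size (G t)) 1.
    have -> : H t = 0 by rewrite /H divp_small // size_XsubC.
    by rewrite !coef0 mulr0 addr0 nth_default // (leq_trans s1).
  have e : G t = H t * ('X - (r t)%:P) by rewrite divpK // dvdp_XsubCl hr.
  by rewrite e mulrBr coefB coefMX /= coefMC mulrC subrK.
have main j : forall k, (D <= k + j)%N -> cmeas (fun t => (H t)`_k).
  elim: j => [|j ih] k hk.
    rewrite addn0 in hk; apply: (cmeas_ext (f := fun=> 0)); last exact: cmeas_cst.
    by move=> t; rewrite nth_default // (leq_trans (sH t)).
  apply: (cmeas_ext (f := fun t => (G t)`_k.+1 + r t * (H t)`_k.+1)).
    by move=> t; rewrite [RHS]rec.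
  by apply: cmeasD => //; apply: cmeasM => //; apply: ih; rewrite addSnnS.
by move=> k; apply: (main D); rewrite leq_addl.
Qed.

Lemma root_list_selection D (G : T -> {poly C}) : pmeas G ->
  (forall t, (size (G t) <= D.+1)%N) ->
  exists2 rs : nat -> T -> C, (forall i, cmeas (rs i)) &
   forall t, G t = lead_coef (G t) *: \prod_(i < (size (G t)).-1) ('X - (rs i t)%:P).
Proof.
elim: D G => [|D ih] G mG sG.
  exists (fun _ _ => 0) => [i|t]; first exact: cmeas_cst.
  have -> : (size (G t)).-1 = 0%N by apply/eqP; rewrite -leqn0; move: (sG t); case: (size _).
  rewrite big_ord0 alg_polyC; have e := size1_polyC (sG t).
  by rewrite e lead_coefC.
have [r mr hr] := root_selection mG sG.
have sH t : (size (G t %/ ('X - (r t)%:P))%R <= D.+1)%N.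
  rewrite size_divp ?polyXsubC_eq0 // size_XsubC /= leq_subLR add1n; exact: sG.
have [rs mrs hrs] := ih _ (pmeas_div_XsubC mG mr sG hr) sH.
exists (fun i => if i is j.+1 then rs j else r) => [[|i] //|t].
have [s1|s1] := leqP (size (G t)) 1.
  have -> : (size (G t)).-1 = 0%N by move: s1; case: (size _) => [|[]].
  by rewrite big_ord0 alg_polyC [in LHS](size1_polyC s1) [in RHS](size1_polyC s1) lead_coefC.
have sHt := sH t; have hrst := hrs t; move: sHt hrst; set H := G t %/ ('X - (r t)%:P) => sHt hrst.
have e : G t = H * ('X - (r t)%:P) by rewrite divpK // dvdp_XsubCl hr.
have H0 : H != 0 by apply: contraTneq s1 => h; rewrite e h mul0r size_poly0.
have -> : (size (G t)).-1 = (size H).-1.+1.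
  by rewrite e size_Mmonic ?monicXsubC // size_XsubC addn2 /= prednK // size_poly_gt0.
have -> : lead_coef (G t) = lead_coef H by rewrite e lead_coef_Mmonic ?monicXsubC.
rewrite big_ord_recl /= scalerAr -hrst; exact: etrans e (mulrC _ _).
Qed.

End RootListSelection.

(** * Angles, gaps and the Fubini-Study distance *)

Section AngleEstimates.
Variable R : realType.

Lemma sin_MVT (x : R) : 0 < x -> exists2 y, 0 < y < x & sin x = cos y * x.
Proof.
move=> x0.
have [y yI e] := @MVT R sin cos 0 x x0 (fun y _ => is_derive_sin y)
  (continuous_subspaceT (@continuous_sin R)).
by exists y; [move: yI; rewrite in_itv | move: e; rewrite sin0 !subr0].
Qed.

Lemma sin_le_id (x : R) : 0 <= x -> sin x <= x.
Proof.
rewrite le_eqVlt => /orP[/eqP <-|x0]; first by rewrite sin0.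
by have [y _ ->] := sin_MVT x0; rewrite ler_piMl ?(ltW x0) // cos_le1.
Qed.

Lemma one_minus_cos_le (x : R) : 0 <= x -> 1 - cos x <= x ^+ 2.
Proof.
rewrite le_eqVlt => /orP[/eqP <-|x0]; first by rewrite cos0 subrr sqr_ge0.
have [y] := @MVT R cos (fun y => - sin y) 0 x x0 (fun y _ => is_derive_cos y)
  (continuous_subspaceT (@continuous_cos R)).
rewrite in_itv /= cos0 subr0 => /andP[y0 yx] e.
have -> : 1 - cos x = sin y * x by rewrite -opprB e mulNr opprK.
rewrite expr2 ler_wpM2r ?(ltW x0) //.
by apply: le_trans (sin_le_id (ltW y0)) (ltW yx).
Qed.

(** Let c = cos t, so the right-hand side is 20 sin^2 t. If c >= 1/4, the mean value theorem gives
    sin t >= c t >= t/4, hence t^2 <= 16 sin^2 t. If c < 1/4, then t^2 <= 16 while 20 (1 - 1/16) >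
    16. *)
Lemma acos_sqr_le (c : R) : 0 <= c <= 1 -> acos c ^+ 2 <= 20 * (1 - c ^+ 2).
Proof.
move=> /andP[c0 c1]; have cI : -1 <= c <= 1 by rewrite c1 andbT (le_trans _ c0) // lerN10.
have t0 := acos_ge0 cI; have tpi := acos_lepi cI.
have tc : cos (acos c) = c by apply: acosK; rewrite in_itv.
have [ts|tp] := eqVneq (acos c) 0.
  by rewrite ts expr0n /= mulr_ge0 // subr_ge0 expr_le1.
have tgt : 0 < acos c by rewrite lt_def tp.
have [y /andP[y0 yx] e] := sin_MVT tgt.
have sc : 1 - c ^+ 2 = (cos y * acos c) ^+ 2 by rewrite -e sin2cos2 tc.
have cy : c <= cos y.
  rewrite -{1}tc ltW // ltr_cos // in_itv /= ?t0 ?tpi //.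
  by rewrite (ltW y0) (le_trans (ltW yx)).
have [lc|lc] := leP (4%:R^-1) c.
  rewrite sc exprMn mulrA ler_peMl ?sqr_ge0 //.
  have : 4%:R^-1 ^+ 2 <= cos y ^+ 2 by apply: lerXn2r; rewrite ?nnegrE ?(le_trans _ cy) //; lra.
  lra.
have pi4 : acos c <= 4.
  by apply: le_trans tpi _; have := pihalf_lt2 R; lra.
have : acos c ^+ 2 <= 4 ^+ 2 by apply: lerXn2r; rewrite ?nnegrE.
have : c ^+ 2 <= 4%:R^-1 ^+ 2 by apply: lerXn2r; rewrite ?nnegrE ?(ltW lc).
lra.
Qed.

Lemma le_acos_sqr (c : R) : 0 <= c <= 1 -> 1 - c ^+ 2 <= acos c ^+ 2.
Proof.
move=> /andP[c0 c1]; have cI : -1 <= c <= 1 by rewrite c1 andbT (le_trans _ c0) // lerN10.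
have t0 := acos_ge0 cI.
have tc : cos (acos c) = c by apply: acosK; rewrite in_itv.
have -> : 1 - c ^+ 2 = sin (acos c) ^+ 2 by rewrite sin2cos2 tc.
by apply: lerXn2r; rewrite ?nnegrE ?sin_le_id // sin_ge0_pi // t0 acos_lepi.
Qed.

End AngleEstimates.

Section ProjectiveSpace.
Variables (R : realType) (n : nat).
Local Notation C := (complex R).
Implicit Types (x y q : cvec R n) (z : CPn R n).

Lemma lead_coord_neq0 x : x != 0 -> lead_coord x != 0.
Proof.
move=> x0; rewrite /lead_coord.
set s := [seq c <- _ | _]; have : s != [::].
  rewrite -has_filter; apply/hasP.
  have /existsP [i xi] : [exists i, x i != 0].
    rewrite -negb_forall; apply: contra x0 => /forallP h.
    by apply/eqP/ffunP => i; rewrite ffunE; apply/eqP/h.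
  by exists (x i) => //; apply/mapP; exists i => //; rewrite mem_enum.
have : all (fun c => c != 0) s by exact: filter_all.
by case: s => //= c s /andP[].
Qed.

Lemma lead_coord_scale k x : k != 0 -> lead_coord (vscale k x) = k * lead_coord x.
Proof.
move=> k0; rewrite /lead_coord.
have -> : [seq vscale k x i | i <- enum 'I_n.+1] = [seq k * c | c <- [seq x i | i <- enum 'I_n.+1]].
  by elim: (enum 'I_n.+1) => [//|i s ih] /=; rewrite ih ffunE.
rewrite filter_map (eq_filter (a2 := fun c => c != 0)); last first.
  by move=> c; rewrite /= mulf_eq0 negb_or k0.
by case: [seq c <- _ | _] => [|c s] /=; rewrite ?mulr0.
Qed.

Definition phase x : C := (`|lead_coord x| / lead_coord x) * realC (Num.sqrt (vnorm2 x))^-1.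

Lemma nrm_vscale x : nrm x = vscale (phase x) x.
Proof. by apply/ffunP => i; rewrite !ffunE. Qed.

Lemma normC_cm (c : C) : `|c| = realC (cm c).
Proof. by rewrite normc_def; case: c. Qed.

Lemma cabs2_phase x : x != 0 -> cabs2 (phase x) = (vnorm2 x)^-1.
Proof.
move=> x0; have l0 := lead_coord_neq0 x0.
rewrite /phase cabs2E !cmM cmV normC_cm !cm_realC !ger0_norm ?cm_ge0 ?invr_ge0 ?sqrtr_ge0 //.
by rewrite divff ?cm_eq0 // mul1r exprVn sqr_sqrtr // vnorm2_ge0.
Qed.

Lemma phase_neq0 x : x != 0 -> phase x != 0.
Proof.
move=> x0; rewrite -cm_eq0 -sqrf_eq0 -cabs2E cabs2_phase // invr_eq0 vnorm2_eq0 //.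
Qed.

Lemma nrm_rep x : x != 0 -> is_rep (nrm x).
Proof.
move=> x0; have l0 := lead_coord_neq0 x0; have v0 : 0 < vnorm2 x by rewrite vnorm2_gt0.
rewrite /is_rep nrm_vscale vnorm2_scale cabs2_phase // mulVf ?(gt_eqF v0) // eqxx /=.
rewrite lead_coord_scale ?phase_neq0 // /phase mulrAC divfK // normC_cm -realCM.
by rewrite /realC ltcR mulr_gt0 ?cm_gt0 // invr_gt0 sqrtr_gt0.
Qed.

Lemma val_proj x : x != 0 -> val (Defs.proj x) = nrm x.
Proof. by move=> x0; rewrite /Defs.proj val_insubd nrm_rep. Qed.

Lemma val_unit z : vnorm2 (val z) = 1.
Proof. by have /andP[/eqP] := valP z. Qed.

Lemma gap_unit x y : vnorm2 x = 1 -> vnorm2 y = 1 -> gap x y = 1 - cabs2 (hdot x y).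
Proof. by move=> hx hy; rewrite /gap /gram hx hy !mul1r divr1. Qed.

Lemma fs_dist_unit x y : vnorm2 x = 1 -> vnorm2 y = 1 ->
  fs_dist x y = acos (cm (hdot x y)).
Proof.
move=> hx hy; rewrite /fs_dist /fs_of hx hy mul1r sqrtr1 divr1 cabs2E.
by rewrite sqrtr_sqr ger0_norm // cm_ge0.
Qed.

Lemma cm_hdot_unit x y : vnorm2 x = 1 -> vnorm2 y = 1 -> 0 <= cm (hdot x y) <= 1.
Proof.
move=> hx hy; rewrite cm_ge0 /=; have := gap_ge0 x y; rewrite gap_unit // subr_ge0 cabs2E.
by rewrite expr_le1 ?cm_ge0.
Qed.

Lemma fs_dist_sqr_le x y : vnorm2 x = 1 -> vnorm2 y = 1 ->
  fs_dist x y ^+ 2 <= 20 * gap x y.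
Proof.
by move=> hx hy; rewrite fs_dist_unit // gap_unit // cabs2E acos_sqr_le // cm_hdot_unit.
Qed.

Lemma gap_le_fs_dist x y : vnorm2 x = 1 -> vnorm2 y = 1 ->
  gap x y <= fs_dist x y ^+ 2.
Proof.
by move=> hx hy; rewrite fs_dist_unit // gap_unit // cabs2E le_acos_sqr // cm_hdot_unit.
Qed.

Lemma gap_proj x y : x != 0 -> y != 0 -> gap (val (Defs.proj x)) (val (Defs.proj y)) = gap x y.
Proof.
by move=> x0 y0; rewrite !val_proj // !nrm_vscale gap_scale // phase_neq0.
Qed.

(* The entries of the orthogonal projector onto the line of a unit vector; the gap is
   half the squared Hilbert-Schmidt distance of projectors. *)
Definition ent x i j : C := x i * cconj (x j).

Lemma cabs2_hdot_ent x y : realC (cabs2 (hdot x y)) =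
  \sum_i \sum_j ent x i j * cconj (ent y i j).
Proof.
rewrite -mulc_conj /hdot cconj_sum mulr_suml; apply: eq_bigr => i _.
rewrite mulr_sumr; apply: eq_bigr => j _.
rewrite /ent !cconjM !cconjK; ring.
Qed.

Lemma cabs2_sub (a b : C) : cabs2 (a - b) = cabs2 a + cabs2 b - 2 * complex.Re (a * cconj b).
Proof. by case: a b => a1 a2 [b1 b2]; rewrite /cabs2 /cconj /=; ring. Qed.

Lemma gap_HS x y : vnorm2 x = 1 -> vnorm2 y = 1 ->
  \sum_i \sum_j cabs2 (ent x i j - ent y i j) = 2 * gap x y.
Proof.
move=> hx hy; rewrite gap_unit //.
have E u : vnorm2 u = 1 -> \sum_i \sum_j cabs2 (ent u i j) = 1.
  move=> hu; have : realC (\sum_i \sum_j cabs2 (ent u i j)) = realC (cabs2 (hdot u u)).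
    rewrite cabs2_hdot_ent realC_sum; apply: eq_bigr => i _; rewrite realC_sum.
    by apply: eq_bigr => j _; rewrite mulc_conj.
  by move=> /realC_inj ->; rewrite hdotxx hu cabs2E cm_realC normr1 expr1n.
under eq_bigr do under eq_bigr do rewrite cabs2_sub.
under eq_bigr do rewrite big_split big_split /=.
rewrite !big_split /= !E //.
have -> : \sum_i \sum_j - (2 * complex.Re (ent x i j * cconj (ent y i j))) =
   - 2 * complex.Re (\sum_i \sum_j ent x i j * cconj (ent y i j)).
  rewrite cRe_sum mulr_sumr; apply: eq_bigr => i _; rewrite cRe_sum mulr_sumr.
  by apply: eq_bigr => j _; rewrite mulNr.
rewrite -cabs2_hdot_ent Re_realC; ring.
Qed.

(** By [gap_HS] the gap is half of a squared norm distance, and |a + b|^2 <= 2 |a|^2 + 2 |b|^2. *)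
Lemma gap_quasi_triangle x y q : vnorm2 x = 1 -> vnorm2 y = 1 -> vnorm2 q = 1 ->
  gap x y <= 2 * (gap x q + gap q y).
Proof.
move=> hx hy hq; rewrite -(@ler_pM2l _ 2) //.
have -> : 2 * (2 * (gap x q + gap q y)) = 2 * (2 * gap x q + 2 * gap q y) by ring.
rewrite -(gap_HS hx hy) -(gap_HS hx hq) -(gap_HS hq hy) -big_split mulr_sumr.
apply: ler_sum => i _; rewrite -big_split mulr_sumr; apply: ler_sum => j _ /=.
have -> : ent x i j - ent y i j = (ent x i j - ent q i j) + (ent q i j - ent y i j).
  by rewrite addrA subrK.
move: (_ - _) (_ - _) => [a1 a2] [b1 b2]; rewrite /cabs2 /=.
have := sqr_ge0 (a1 - b1); have := sqr_ge0 (a2 - b2); nra.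
Qed.

Lemma ent_dist x y i j : vnorm2 x = 1 -> vnorm2 y = 1 ->
  cabs2 (ent x i j - ent y i j) <= 2 * gap x y.
Proof.
move=> hx hy; rewrite -gap_HS // (bigD1 i) //= (bigD1 j) //= -addrA lerDl.
rewrite addr_ge0 // ?sumr_ge0 // => [k _|k _]; first exact: cabs2_ge0.
by rewrite sumr_ge0 // => l _; exact: cabs2_ge0.
Qed.

End ProjectiveSpace.

(** * Measurability on projective space *)

Section ProjectiveMeasurability.
Variables (R : realType) (n : nat).
Local Notation C := (complex R).

Lemma measurable_fun_lt d (T : measurableType d) (f : T -> R) :
  (forall c, measurable [set t | f t < c]) -> measurable_fun setT f.
Proof.
move=> mf; apply: (measurability (@RGenInftyO.G R)); first exact: RGenInftyO.measurableE.
move=> _ [_ [x ->] <-]; rewrite setTI.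
have -> // : f @^-1` `]-oo, x[ = [set t | f t < x].
by apply/seteqP; split => t /=; rewrite in_itv.
Qed.

Lemma fs_open_measurable (U : set (CP R n)) : fs_open U -> measurable U.
Proof. by move=> oU; apply: sub_sigma_algebra. Qed.

Lemma cabs2_ge_Re (z : C) : complex.Re z ^+ 2 <= cabs2 z.
Proof. by rewrite /cabs2 lerDl sqr_ge0. Qed.
Lemma cabs2_ge_Im (z : C) : complex.Im z ^+ 2 <= cabs2 z.
Proof. by rewrite /cabs2 lerDr sqr_ge0. Qed.

(** By [gap_le_fs_dist] such an f is Lipschitz with constant sqrt 2 for the Fubini-Study distance;
    the radius (c - f x)/2 suffices because sqrt 2 / 2 < 1. *)
Lemma fs_lipschitz_open (f : CPn R n -> R) (c : R) :
  (forall x y, (f x - f y) ^+ 2 <= 2 * gap (val x) (val y)) ->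
  fs_open [set z | f z < c].
Proof.
move=> hf x /= fx; exists ((c - f x) / 2); first by rewrite divr_gt0 // subr_gt0.
move=> y xy; have d0 : 0 < c - f x by rewrite subr_gt0.
have fs0 : 0 <= fs_dist (val x) (val y).
  rewrite fs_dist_unit ?val_unit // acos_ge0 //.
  by have /andP[h0 h1] := cm_hdot_unit (val_unit x) (val_unit y); rewrite h1 andbT; apply: le_trans h0; lra.
have h1 := hf x y; have h2 := gap_le_fs_dist (val_unit x) (val_unit y).
have h3 : fs_dist (val x) (val y) ^+ 2 < ((c - f x) / 2) ^+ 2.
  by rewrite ltr_pXn2r ?nnegrE // divr_ge0 // ltW.
rewrite ltNge; apply/negP => cy.
have h4 : (c - f x) ^+ 2 <= (f x - f y) ^+ 2.
  rewrite -sqrrN [leRHS]expr2 -[leRHS]mulrNN -expr2 sqrrN.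
  by apply: lerXn2r; rewrite ?nnegrE ?(ltW d0) //; lra.
have e : ((c - f x) / 2) ^+ 2 * 4 = (c - f x) ^+ 2 by field.
have := sqr_ge0 (c - f x); lra.
Qed.

(** The coordinates of the canonical representative may jump where its leading coordinate vanishes;
    projector entries are independent of the phase and continuous, so measurability is tested on
    them. *)
Lemma cmeas_ent (i j : 'I_n.+1) : cmeas (fun z : CP R n => ent (val z) i j).
Proof.
split; apply: measurable_fun_lt => c; apply: fs_open_measurable;
  apply: fs_lipschitz_open => x y.
  rewrite -cReN -cReD; apply: le_trans (cabs2_ge_Re _) _.
  by apply: ent_dist; rewrite val_unit.
rewrite -cImN -cImD; apply: le_trans (cabs2_ge_Im _) _.
by apply: ent_dist; rewrite val_unit.
Qed.

Lemma ball_contra (g g1 g2 m f r : R) : g <= 2 * (g1 + g2) -> f <= 20 * g ->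
  m < r / 80 -> g1 < m -> g2 < m -> r <= f -> False.
Proof. by move=> *; lra. Qed.

Lemma cmeas_comp d d' (T : measurableType d) (T' : measurableType d')
    (f : T' -> C) (g : T -> T') :
  cmeas f -> measurable_fun setT g -> cmeas (fun t => f (g t)).
Proof. by move=> [f1 f2] mg; split; [exact: (measurableT_comp f1)|exact: (measurableT_comp f2)]. Qed.

Lemma measurable_gap : measurable_fun setT
  (fun zz : (CP R n * CP R n)%type => gap (val zz.1) (val zz.2)).
Proof.
have -> : (fun zz : (CP R n * CP R n)%type => gap (val zz.1) (val zz.2)) =
  (fun zz => 1 - complex.Re (\sum_i \sum_j ent (val zz.1) i j * cconj (ent (val zz.2) i j))).
  apply/funext => zz; rewrite gap_unit ?val_unit //.
  by rewrite -cabs2_hdot_ent Re_realC.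
apply: measurable_funB; first exact: measurable_cst.
suff [] : cmeas (fun zz : (CP R n * CP R n)%type =>
    \sum_i \sum_j ent (val zz.1) i j * cconj (ent (val zz.2) i j)) by [].
apply: cmeas_sum => i; apply: cmeas_sum => j; apply: cmeasM.
  exact: (cmeas_comp (cmeas_ent i j) measurable_fst).
exact/cmeas_conj/(cmeas_comp (cmeas_ent i j) measurable_snd).
Qed.

Definition cqv (k : {ffun 'I_n.+1 -> rat * rat}) : cvec R n := [ffun i => cq R (k i)].

Lemma rational_vector_dense (x : cvec R n) (e : R) : vnorm2 x = 1 -> 0 < e ->
  exists k, cqv k != 0 /\ gap x (cqv k) < e.
Proof.
move=> hx e0.
(* The approximation satisfies |q - x|^2 <= m. Then m <= 1/4 gives |q|^2 >= 1/4, and m <= e/5 < e/4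
   gives gram q x <= m < e |q|^2. *)
pose m := Num.min (4%:R^-1) (e / 5).
have m0 : 0 < m by rewrite lt_min invr_gt0 ltr0n divr_gt0.
have m1 : m <= 4%:R^-1 by rewrite ge_min lexx.
have m2 : m <= e / 5 by rewrite ge_min lexx orbT.
pose eta := m / (2 * n.+1%:R).
have eta0 : 0 < eta by rewrite divr_gt0 // mulr_gt0.
have eta1 : eta <= 1.
  rewrite ler_pdivrMr ?mulr_gt0 // mul1r.
  have : 1 <= n.+1%:R :> R by rewrite ler1n.
  move: m1; lra.
have /choice [k hk] : forall i : 'I_n.+1, exists q : rat * rat,
    `|ratr q.1 - complex.Re (x i)| < eta /\ `|ratr q.2 - complex.Im (x i)| < eta.
  move=> i.
  have [a] := @rat_in_itvoo R (complex.Re (x i) - eta) (complex.Re (x i) + eta) ltac:(lra).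
  have [b] := @rat_in_itvoo R (complex.Im (x i) - eta) (complex.Im (x i) + eta) ltac:(lra).
  rewrite !in_itv /= => /andP[b1 b2] /andP[a1 a2].
  by exists (a, b); rewrite !ltr_norml /=; split; apply/andP; split; lra.
pose q := cqv [ffun i => k i]; pose v : cvec R n := [ffun i => q i - x i].
have qE : q = lin 1 x v by apply/ffunP => i; rewrite !ffunE mul1r addrC subrK.
have hv : vnorm2 v <= m.
  apply: (@le_trans _ _ (\sum_(i < n.+1) (2 * eta))).
    apply: ler_sum => i _; rewrite /cabs2 !ffunE !(cReD, cImD, cReN, cImN) /=.
    have [h1 h2] := hk i.
    rewrite -(real_normK (num_real (_ - complex.Re _))) -(real_normK (num_real (_ - complex.Im _))).
    have g1 := normr_ge0 (ratr (k i).1 - complex.Re (x i)).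
    have g2 := normr_ge0 (ratr (k i).2 - complex.Im (x i)).
    move: g1 g2 h1 h2; move: `|_| `|_| => A B; nra.
  suff -> : \sum_(i < n.+1) (2 * eta) = m by [].
  rewrite sumr_const card_ord -[LHS]mulr_natr /eta.
  by field; rewrite gt_eqF // ltr_wpDr.
have hq : 4%:R^-1 <= vnorm2 q.
  have : 1 <= 2 * vnorm2 q + 2 * vnorm2 v.
    rewrite -[X in X <= _]hx /vnorm2 !mulr_sumr -big_split; apply: ler_sum => i _ /=.
    rewrite [v i]ffunE; case: (q i) (x i) => q1 q2 [x1 x2]; rewrite /cabs2 /=.
    have := sqr_ge0 (2 * q1 - x1); have := sqr_ge0 (2 * q2 - x2); clear; lra.
  move: hv m1; lra.
have q0 : 0 < vnorm2 q by apply: lt_le_trans hq; rewrite invr_gt0 ltr0n.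
exists [ffun i => k i]; rewrite -/q -vnorm2_gt0; split => //.
rewrite gapC /gap hx mulr1 ltr_pdivrMr //.
have -> : gram q x = gram x v by rewrite qE gram_linl.
apply: le_lt_trans (gram_le _ _) _; rewrite hx mul1r.
apply: le_lt_trans hv _.
have : e / 4 <= e * vnorm2 q by rewrite ler_pM2l.
move: m2 e0; lra.
Qed.

Variables (d : measure_display) (T : measurableType d) (W : T -> cvec R n).
Hypothesis mW : forall i, cmeas (fun t => W t i).

Lemma measurable_vnorm2 : measurable_fun setT (fun t => vnorm2 (W t)).
Proof.
rewrite /vnorm2; apply: measurable_sum => i; exact: cmeas_cabs2.
Qed.

(** The sigma-algebra is generated by all open sets, so each open U is written as a countable union
    of gap balls contained in U, with rational centres and radii 1/(m + 1). The vector 0 is sent to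
    a default point and is treated apart. *)
Lemma measurable_proj : measurable_fun setT (fun t => Defs.proj (W t) : CP R n).
Proof.
apply: (measurability (@fs_open R n : set (set (CP R n)))) => //.
move=> _ [U oU <-]; rewrite setTI.
pose I (k : {ffun 'I_n.+1 -> rat * rat}) (m : nat) : Prop := cqv k != 0 /\
  forall z : CPn R n, gap (val z) (cqv k) < m.+1%:R^-1 -> U z.
have gapE (x y : cvec R n) (e : R) : x != 0 -> y != 0 ->
    (gap x y < e) = (gram x y < e * (vnorm2 x * vnorm2 y)).
  by move=> x0 y0; rewrite /gap ltr_pdivrMr // mulr_gt0 ?vnorm2_gt0.
have gapP (x y : cvec R n) : x != 0 -> gap (val (Defs.proj x)) y = gap x y.
  move=> x0; rewrite val_proj // nrm_vscale.
  have {1}-> : y = vscale 1 y by apply/ffunP => i; rewrite ffunE mul1r.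
  by rewrite gap_scale ?oner_eq0 // phase_neq0.
have -> : (fun t => Defs.proj (W t)) @^-1` U =
   ([set t | vnorm2 (W t) == 0] `&` [set _ | U (Defs.proj (0 : cvec R n))]) `|`
   \bigcup_(k : {ffun 'I_n.+1 -> rat * rat}) \bigcup_(m : nat)
     ([set t | (0 < vnorm2 (W t)) && (gram (W t) (cqv k) <
            m.+1%:R^-1 * (vnorm2 (W t) * vnorm2 (cqv k)))] `&` [set _ | I k m]).
  apply/seteqP; split => t /=.
    have [W0|W0] := eqVneq (W t) 0.
      by rewrite W0 => Ut; left; split => //; rewrite vnorm2_eq0.
    move=> Ut; right; have [r r0 hr] := oU _ Ut.
    (* 80 = 20 * 2 * 2: the factor of [fs_dist_sqr_le], that of [gap_quasi_triangle], and two
       gaps. *)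
    have [m hm] : exists m : nat, m.+1%:R^-1 < r ^+ 2 / 80.
      by apply: small_natSinv; rewrite divr_gt0 // exprn_gt0.
    have [k [k0 hk]] := @rational_vector_dense (val (Defs.proj (W t))) m.+1%:R^-1
       (val_unit _) ltac:(by rewrite invr_gt0).
    exists k => //; exists m => //; split.
      by rewrite /= vnorm2_gt0 W0 /= -gapE // -gapP.
    split => // z hz; apply: hr.
    have uq : vnorm2 (nrm (cqv k)) = 1 by have /andP[/eqP] := nrm_rep k0.
    have gq (z' : CPn R n) : gap (val z') (nrm (cqv k)) = gap (val z') (cqv k).
      rewrite nrm_vscale; have {1}-> : val z' = vscale 1 (val z').
        by apply/ffunP => i; rewrite ffunE mul1r.
      by rewrite gap_scale ?oner_eq0 // phase_neq0.
    have h := gap_quasi_triangle (val_unit (Defs.proj (W t))) (val_unit z) uq.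
    rewrite (gapC (nrm _)) !gq in h.
    have h2 := fs_dist_sqr_le (val_unit (Defs.proj (W t))) (val_unit z).
    rewrite ltNge; apply/negP => hh.
    have : r ^+ 2 <= fs_dist (val (Defs.proj (W t))) (val z) ^+ 2.
      by apply: lerXn2r; rewrite ?nnegrE ?(ltW r0) // (le_trans (ltW r0)).
    exact: ball_contra h h2 hm hk hz.
  move=> [[/eqP W0 U0]|[k _ [m _ [/andP[W0 hg] [k0 hI]]]]].
    by move/eqP: W0; rewrite vnorm2_eq0 => /eqP ->.
  apply: hI; rewrite gapP -?vnorm2_gt0 // gapE // -?vnorm2_gt0 //.
have mc (P : Prop) : measurable [set _ : T | P].
  have [p|np] := pselect P.
    by have -> : [set _ : T | P] = setT by apply/seteqP; split.
  by have -> : [set _ : T | P] = set0 by apply/seteqP; split.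
have mv := measurable_vnorm2.
apply: measurableU.
  apply: measurableI => //; apply: mset.
  by apply: measurable_fun_eqr => //; exact: measurable_cst.
apply: countable_bigcupT_measurable; first exact: countableP.
move=> k; apply: bigcupT_measurable => m; apply: measurableI => //.
apply: mset; apply: measurable_and.
  by apply: measurable_fun_ltr => //; exact: measurable_cst.
apply: measurable_fun_ltr.
  apply: measurable_funB.
    by apply: measurable_funM => //; exact: measurable_cst.
  apply: cmeas_cabs2; apply: cmeas_sum => i; apply: cmeasM => //; exact: cmeas_cst.
apply: measurable_funM; first exact: measurable_cst.
by apply: measurable_funM => //; exact: measurable_cst.
Qed.

End ProjectiveMeasurability.

(** * Area of the zone around a root *)

Section DiscMass.
Variable R : realType.
Local Notation C := (complex R).
Local Notation leb := (@lebesgue_measure R).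

Lemma integral_const_itv (a b k : R) : a <= b -> 0 <= k ->
  (\int[leb]_x (k * \1_(`[a, b]%classic) x)%:E = (k * (b - a))%:E)%E.
Proof.
move=> ab k0; under eq_integral do rewrite EFinM.
rewrite ge0_integralZl_EFin //.
- rewrite integral_indic //= setIT lebesgue_measure_itv /= lte_fin.
  case: ltP => // ba; last by have -> : b = a by [apply/eqP; rewrite eq_le ab ba]; rewrite subrr mulr0 mule0.
- by apply/measurable_EFinP; exact: measurable_indic.
Qed.

Lemma square_lower_bound (f : R -> R -> R) (a1 a2 r m : R) :
  0 <= r -> 0 <= m -> (forall x y, 0 <= f x y) ->
  (forall x y, a1 <= x <= a1 + r -> a2 <= y <= a2 + r -> m <= f x y) ->
  ((m * r ^+ 2)%:E <= \int[leb]_x \int[leb]_y (f x y)%:E)%E.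
Proof.
move=> r0 m0 f0 hf.
have i0 (A : set R) x : 0 <= (\1_A x : R) by rewrite indicE; case: (_ \in _).
apply: (@le_trans _ _ (\int[leb]_x \int[leb]_y
    (m * \1_(`[a1, a1 + r]%classic) x * \1_(`[a2, a2 + r]%classic) y)%:E)%E).
  under eq_integral => x _.
    rewrite integral_const_itv ?mulr_ge0 ?lerDl //.
    have -> : m * \1_(`[a1, a1 + r]%classic) x * (a2 + r - a2) =
      (m * r) * \1_(`[a1, a1 + r]%classic) x :> R by ring.
    over.
  rewrite integral_const_itv ?mulr_ge0 ?lerDl //.
  by rewrite lee_fin le_eqVlt; apply/orP; left; apply/eqP; ring.
apply: ge0_le_integral_nomeas => x _.
  by apply: integral_ge0 => y _; rewrite lee_fin !mulr_ge0.
apply: ge0_le_integral_nomeas => y _; rewrite lee_fin; first by rewrite !mulr_ge0.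
rewrite !indicE; case: (boolP (x \in _)) => hx; last by rewrite mulr0 mul0r f0.
case: (boolP (y \in _)) => hy; last by rewrite mulr0 f0.
by rewrite !mulr1; apply: hf; [move: hx|move: hy]; rewrite inE /= in_itv.
Qed.

Variables (a w : R) (h : C).
Hypotheses (a_gt0 : 0 < a) (w_gt0 : 0 < w).
Local Notation s := (ls a w h).

(** In the coordinate [lX] the Fubini-Study area has density 1/(1 + |X|^2)^2; this is its expression
    in the coordinate z, restricted to [H] (see [line_density]). *)
Definition line_weight (H : C -> bool) (z : C) : R :=
  if H z then w ^+ 2 / lN2 a w h z ^+ 2 else 0.

Lemma line_weight_ge0 H z : 0 <= line_weight H z.
Proof.
by rewrite /line_weight; case: ifP => // _; rewrite divr_ge0 // exprn_ge0 // ltW ?lN2_gt0.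
Qed.

Lemma line_density z : w ^+ 2 / lN2 a w h z ^+ 2 = (a / w) ^+ 2 / jb (lX a w h z) ^+ 4.
Proof.
have j0 := jb_gt0 (lX a w h z); have n0 := lN2_gt0 h a_gt0 w_gt0 z.
have e : lN2 a w h z = jb (lX a w h z) ^+ 2 * w ^+ 2 / a.
  by rewrite -(lN_sqr h a_gt0 w_gt0) (lN_jb h a_gt0 w_gt0) !exprMn exprVn [Num.sqrt a ^+ 2]sqr_sqrtr ?(ltW a_gt0).
rewrite e; field; rewrite ?gt_eqF //.
Qed.

Lemma jb_lip (x y : C) : jb x <= jb y + cm (x - y).
Proof.
have c := cm_ge0 (x - y); have jy := jb_gt0 y.
rewrite -(@ler_pXn2r _ 2) ?nnegrE ?(ltW (jb_gt0 _)) ?addr_ge0 ?(ltW jy) //.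
rewrite sqrrD !jb_sqr.
have t : cm x <= cm y + cm (x - y) by rewrite addrC -{1}(subrK y x) cmD.
have yj : cm y <= jb y.
  by rewrite -(@ler_pXn2r _ 2) ?nnegrE ?cm_ge0 ?(ltW jy) // jb_sqr lerDr.
have : cm x ^+ 2 <= (cm y + cm (x - y)) ^+ 2.
  by apply: lerXn2r; rewrite ?nnegrE ?addr_ge0 ?cm_ge0.
rewrite sqrrD => t2.
have : cm y * cm (x - y) *+ 2 <= jb y * cm (x - y) *+ 2.
  by rewrite lerMn2r /= ler_wpM2r.
move: t2; lra.
Qed.

Lemma chi_le_jb (x y : C) : chi x y <= (jb x)^-1 + (jb y)^-1.
Proof.
have jx := jb_gt0 x; have jy := jb_gt0 y.
have xj z : cm z <= jb z :> R.
  by rewrite -(@ler_pXn2r _ 2) ?nnegrE ?cm_ge0 ?(ltW (jb_gt0 _)) // jb_sqr lerDr.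
rewrite /chi ler_pdivrMr ?mulr_gt0 //.
have -> : ((jb x)^-1 + (jb y)^-1) * (jb x * jb y) = jb y + jb x by field; rewrite !gt_eqF.
apply: le_trans (cmD _ _) _; rewrite cmN addrC.
by apply: lerD; exact: xj.
Qed.

(** A chordal disc of radius 2 D has area of order D^2, bounded below by an explicit square inside
    it. The chordal distance from c to infinity is [j^-1]. If it is at least D, the square is
    centred at c and the density varies by bounded factors on it, with (3/2)^4 = 81/16. If it is
    less than D, the square consists of the points whose [lX] has real and imaginary parts in
    [1/D, 2/D]; there [J ^+ 2 <= 9 / D^2], and 9^2 = 81. *)
Lemma disc_mass (H : C -> bool) (c : C) (D : R) : 0 < D <= 1 ->
  (forall z, s z c <= 2 * D -> H z) ->
  ((D ^+ 2 / 81)%:E <= \int[leb]_x \int[leb]_y (line_weight H (Complex x y))%:E)%E.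
Proof.
move=> /andP[D0 D1] hH.
have ReX x y : complex.Re (lX a w h (Complex x y)) = (a * x + complex.Re h) / w.
  by rewrite /lX /realC; case: h => h1 h2 /=; ring.
have ImX x y : complex.Im (lX a w h (Complex x y)) = (a * y + complex.Im h) / w.
  by rewrite /lX /realC; case: h => h1 h2 /=; ring.
set j := jb (lX a w h c); have j0 : 0 < j := jb_gt0 _.
have wa : 0 < w / a by rewrite divr_gt0.
have [case1|case2] := leP (D * j) 1.
- pose r := D * j ^+ 2 / 2 * (w / a).
  have r0 : 0 < r by rewrite mulr_gt0 // divr_gt0 // mulr_gt0 // exprn_gt0.
  apply: le_trans (@square_lower_bound _ (complex.Re c - r / 2) (complex.Im c - r / 2) r
     ((a / w) ^+ 2 / (81%:R / 16%:R * j ^+ 4)) (ltW r0) _ _ _).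
  + rewrite lee_fin /r.
    have -> : (a / w) ^+ 2 / (81%:R / 16%:R * j ^+ 4) * (D * j ^+ 2 / 2 * (w / a)) ^+ 2 =
      4 * (D ^+ 2 / 81) by field; rewrite !gt_eqF.
    by rewrite ler_peMl // ?divr_ge0 ?sqr_ge0 // ler1n.
  + by rewrite divr_ge0 ?sqr_ge0 // mulr_ge0 ?divr_ge0 // exprn_ge0 // ltW.
  + by move=> *; exact: line_weight_ge0.
  move=> x y /andP[x1 x2] /andP[y1 y2].
  set z := Complex x y.
  have dz : cm (z - c) <= r.
    apply: le_trans (cm_le _) _; rewrite !(cReD, cImD, cReN, cImN) /=.
    have : `|x - complex.Re c| <= r / 2 by rewrite ler_norml; apply/andP; split; lra.
    have : `|y - complex.Im c| <= r / 2 by rewrite ler_norml; apply/andP; split; lra.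
    lra.
  have dX : cm (lX a w h z - lX a w h c) <= D * j ^+ 2 / 2.
    have -> : lX a w h z - lX a w h c = realC (a / w) * (z - c).
      by rewrite /lX realCM; ring.
    have aw : 0 <= a / w by rewrite divr_ge0 // ltW.
    rewrite cmM cm_realC (ger0_norm aw).
    apply: (@le_trans _ _ (a / w * r)); first by rewrite ler_wpM2l // divr_ge0 // ltW.
    by rewrite /r le_eqVlt; apply/orP; left; apply/eqP; field; rewrite !gt_eqF.
  have dX2 : D * j ^+ 2 / 2 <= j / 2.
    by rewrite ler_wpM2r // expr2 mulrA ler_piMl // ltW.
  set J := jb (lX a w h z); have J0 : 0 < J := jb_gt0 _.
  have J1 : J <= 3 / 2 * j.
    have := jb_lip (lX a w h z) (lX a w h c); rewrite -/J -/j.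
    move: dX dX2; lra.
  have J2 : j <= 2 * J.
    have := jb_lip (lX a w h c) (lX a w h z); rewrite -/J -/j cmB.
    move: dX dX2; lra.
  rewrite /line_weight hH; last first.
    rewrite /ls /chi -/J -/j ler_pdivrMr ?mulr_gt0 //.
    apply: le_trans dX _.
    have : j * j <= 2 * J * j by rewrite ler_wpM2r // ltW.
    rewrite expr2 => jj.
    have : D * (j * j) <= D * (2 * J * j) by rewrite ler_wpM2l // ltW.
    have : 0 <= D * (2 * J * j) by rewrite !mulr_ge0 // ltW.
    lra.
  rewrite line_density -/J ler_wpM2l ?sqr_ge0 // lef_pV2 ?posrE ?mulr_gt0 ?divr_gt0 ?exprn_gt0 //.
  have -> : 81%:R / 16%:R * j ^+ 4 = (3 / 2 * j) ^+ 4 by field.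
  have j3 : 0 <= 3 / 2 * j by move: j0; lra.
  by apply: lerXn2r; rewrite ?nnegrE // ltW.
- have jD : j^-1 <= D.
    by rewrite -div1r ler_pdivrMr // ltW.
  pose r := D^-1.
  have r0 : 0 < r by rewrite invr_gt0.
  have r1 : 1 <= r by rewrite invf_ge1.
  pose q := r * (w / a).
  have q0 : 0 < q by rewrite mulr_gt0.
  apply: le_trans (@square_lower_bound _ (q - complex.Re h / a) (q - complex.Im h / a) q
     ((a / w) ^+ 2 / (81%:R * r ^+ 4)) (ltW q0) _ _ _).
  + rewrite lee_fin /q.
    have -> : (a / w) ^+ 2 / (81%:R * r ^+ 4) * (r * (w / a)) ^+ 2 = r^-1 ^+ 2 / 81.
      by field; rewrite !gt_eqF.
    by rewrite /r invrK.
  + by rewrite divr_ge0 ?sqr_ge0 // mulr_ge0 // exprn_ge0 // ltW.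
  + by move=> *; exact: line_weight_ge0.
  move=> x y /andP[x1 x2] /andP[y1 y2].
  set z := Complex x y.
  have bound t k : q - k / a <= t -> t <= q - k / a + q -> r <= (a * t + k) / w <= 2 * r.
    move=> t1 t2; rewrite ler_pdivlMr // ler_pdivrMr //.
    have -> : r * w = a * q by rewrite /q; field; rewrite gt_eqF.
    have -> : 2 * r * w = a * (2 * q) by rewrite /q; field; rewrite gt_eqF.
    have e : a * (k / a) = k by field; rewrite gt_eqF.
    apply/andP; split.
      have : a * (q - k / a) <= a * t by rewrite ler_wpM2l // ltW.
      rewrite mulrBr e; lra.
    have : a * t <= a * (q - k / a + q) by rewrite ler_wpM2l // ltW.
    rewrite mulrDr mulrBr e; lra.
  have /andP[b1 b2] := bound _ _ x1 x2; have /andP[c1 c2] := bound _ _ y1 y2.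
  set J := jb (lX a w h z); have J0 : 0 < J := jb_gt0 _.
  have J2 : J ^+ 2 = 1 + ((a * x + complex.Re h) / w) ^+ 2 + ((a * y + complex.Im h) / w) ^+ 2.
    by rewrite jb_sqr -cabs2E /cabs2 ReX ImX addrA.
  have J3 : r ^+ 2 <= J ^+ 2 <= 9 * r ^+ 2.
    rewrite J2; move: b1 b2 c1 c2; move: (_ / w) (_ / w) => X Y *.
    by apply/andP; split; nra.
  have /andP[J4 J5] := J3.
  have J6 : r <= J by move: J4; rewrite ler_pXn2r ?nnegrE ?(ltW r0) ?(ltW J0).
  rewrite /line_weight hH; last first.
    apply: le_trans (chi_le_jb _ _) _; rewrite -/J -/j.
    have : J^-1 <= D by rewrite -[D]invrK lef_pV2 ?posrE.
    move: jD; lra.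
  rewrite line_density -/J ler_wpM2l ?sqr_ge0 // lef_pV2 ?posrE ?mulr_gt0 ?exprn_gt0 //.
  have -> : 81%:R * r ^+ 4 = (9 * r ^+ 2) ^+ 2 by ring.
  have -> : J ^+ 4 = (J ^+ 2) ^+ 2 by rewrite -exprM.
  by apply: lerXn2r J5; rewrite nnegrE ?sqr_ge0 // mulr_ge0 // sqr_ge0.
Qed.

End DiscMass.

(** * Expected area of the zone *)

Section GaussianBounds.
Variable R : realType.
Local Notation leb := (@lebesgue_measure R).
Local Notation gam := (@normal_prob R 0 1).
Local Notation pdf := (@normal_pdf R 0 1).

Import HBNNSimple.

Lemma integral_normal_nnsfun (h : {nnsfun (measurableTypeR R) >-> R}) :
  (\int[gam]_x (h x)%:E = \int[leb]_x ((h x)%:E * (pdf x)%:E))%E.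
Proof.
have mpdf : measurable_fun setT (EFin \o pdf).
  by apply/measurable_EFinP; exact: measurable_normal_pdf.
transitivity (\sum_(k \in range h)
    \int[gam]_x (k * \1_(h @^-1` [set k]) x)%:E)%E.
  under eq_integral do rewrite fimfunE -fsumEFin//.
  rewrite ge0_integral_fsum//.
  - by move=> y; exact/measurable_EFinP/measurable_funM.
  - by move=> y x _; rewrite nnfun_muleindic_ge0.
transitivity (\sum_(k \in range h)
    \int[leb]_x ((k * \1_(h @^-1` [set k]) x)%:E * (pdf x)%:E))%E; last first.
  rewrite -ge0_integral_fsum//.
  - apply: eq_integral => x _; rewrite -ge0_mule_fsuml.
      by rewrite fsumEFin// -fimfunE.
    by move=> k; rewrite nnfun_muleindic_ge0.
  - move=> r; apply: emeasurable_funM => //.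
    exact/measurable_EFinP/measurable_funM.
  - move=> r x _; apply: mule_ge0; first by rewrite nnfun_muleindic_ge0.
    by rewrite lee_fin normal_pdf_ge0.
apply: eq_fsbigr => k _.
have [k0|k0] := ltP k 0.
  rewrite !integral0_eq // => x _; rewrite preimage_nnfun0 // indic0 mulr0 ?mul0e //.
have mA : measurable (h @^-1` [set k]) by exact: measurable_sfunP.
under eq_integral do rewrite EFinM.
rewrite ge0_integralZl_EFin //; last by apply/measurable_EFinP; exact: measurable_indic.
under [RHS]eq_integral do rewrite EFinM -muleA.
rewrite ge0_integralZl_EFin //; last 2 first.
- by move=> x _; rewrite mule_ge0 ?lee_fin ?normal_pdf_ge0.
- apply: emeasurable_funM => //; apply/measurable_EFinP; exact: measurable_indic.
congr (_ * _)%E; rewrite integral_indic //= setIT /normal_prob.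
rewrite integral_mkcond; apply: eq_integral => x _; rewrite patchE indicE.
by case: ifP => _; rewrite ?mul1e ?mul0e.
Qed.

Lemma integral_normal (f : measurableTypeR R -> \bar R) : measurable_fun setT f ->
  (forall x, 0 <= f x)%E ->
  (\int[gam]_x f x = \int[leb]_x (f x * (pdf x)%:E))%E.
Proof.
move=> mf f0.
have mpdf : measurable_fun setT (EFin \o pdf).
  by apply/measurable_EFinP; exact: measurable_normal_pdf.
pose f_ := nnsfun_approx measurableT mf.
have fcvg x : ((f_ n x)%:E @[n --> \oo] --> f x)%E.
  by apply: cvg_nnsfun_approx => // *; exact: f0.
transitivity (limn (fun n => \int[gam]_x (f_ n x)%:E))%E.
  rewrite -monotone_convergence//.
  - by apply: eq_integral => y _; apply/esym/cvg_lim.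
  - by move=> n; exact/measurable_EFinP/measurable_funP.
  - by move=> n y _; rewrite lee_fin.
  - by move=> y _ m n mn; rewrite lee_fin; exact/lefP/nd_nnsfun_approx.
transitivity (limn (fun n => \int[leb]_x ((f_ n x)%:E * (pdf x)%:E)))%E.
  by apply: congr_lim; apply/funext => n; exact: integral_normal_nnsfun.
rewrite -monotone_convergence//.
- apply: eq_integral => y _; apply/cvg_lim => //.
  by apply: cvgeZr => //; exact: fcvg.
- move=> n; apply: emeasurable_funM => //.
  exact/measurable_EFinP/measurable_funP.
- by move=> n y _; rewrite mule_ge0 ?lee_fin ?normal_pdf_ge0.
- move=> y _ m n mn; apply: lee_wpmul2r; rewrite lee_fin ?normal_pdf_ge0 //.
  exact/lefP/nd_nnsfun_approx.
Qed.

Lemma pdf_peak_le1 : normal_peak (1 : R) <= 1.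
Proof.
rewrite /normal_peak invf_le1 ?sqrtr_gt0 ?expr1n ?mul1r; last first.
  by rewrite pmulrn_lgt0 // pi_gt0.
rewrite -[leLHS]sqrtr1 ler_wsqrtr // -mulr_natr.
have := pi_ge2 R; lra.
Qed.

Lemma normal_itv_le (a b : R) : a <= b -> (gam `[a, b]%classic <= (b - a)%:E)%E.
Proof.
move=> ab; rewrite /normal_prob.
apply: (@le_trans _ _ (\int[leb]_(x in `[a, b]) (cst 1%:E x)))%E.
  apply: ge0_le_integral_nomeas => x _; rewrite lee_fin ?normal_pdf_ge0 //.
  by apply: le_trans (normal_pdf_ub _ _ (oner_neq0 R)) pdf_peak_le1.
rewrite integral_cst //= mul1e lebesgue_measure_itv /= lte_fin.
by case: ifP => //; rewrite lee_fin subr_ge0.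
Qed.

Definition moment2 : \bar R := (\int[gam]_x (x ^+ 2)%:E)%E.

(** The inequality y <= e^y with y = 3 x^2 / 8 dominates x^2 times the standard density by a
    multiple of the density of standard deviation 2. *)
Lemma moment2_lty : (moment2 < +oo)%E.
Proof.
rewrite /moment2 integral_normal; last 2 first.
- by apply/measurable_EFinP; exact: measurable_funX.
- by move=> x; rewrite lee_fin sqr_ge0.
pose K : R := 8 / 3 * (normal_peak 1 / normal_peak 2).
have p2 : 0 < normal_peak (2 : R) by rewrite normal_peak_gt0.
have p1 : 0 < normal_peak (1 : R) by rewrite normal_peak_gt0 // oner_neq0.
have K0 : 0 <= K by rewrite mulr_ge0 // divr_ge0 // ltW.
apply: (@le_lt_trans _ _ (\int[leb]_x (K%:E * (normal_pdf 0 2 x)%:E)))%E; last first.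
  rewrite ge0_integralZl_EFin //; last 2 first.
  - by move=> x _; rewrite lee_fin normal_pdf_ge0.
  - by apply/measurable_EFinP; exact: measurable_normal_pdf.
  by rewrite integral_normal_pdf mule1 ltry.
apply: ge0_le_integral_nomeas => x _.
  by rewrite mule_ge0 // lee_fin ?sqr_ge0 ?normal_pdf_ge0.
rewrite -!EFinM lee_fin !normal_pdfE ?oner_neq0 ?pnatr_eq0 // /normal_fun.
rewrite /K subr0 expr1n.
have -> : 8 / 3 * (normal_peak 1 / normal_peak 2) * (normal_peak 2 * expR (- x ^+ 2 / (2 ^+ 2 *+ 2)))
  = normal_peak 1 * (8 / 3 * expR (- x ^+ 2 / (2 ^+ 2 *+ 2))) :> R.
  by field; rewrite gt_eqF.
rewrite mulrCA ler_wpM2l ?(ltW p1) //.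
have -> : - x ^+ 2 / (2 ^+ 2 *+ 2) = - x ^+ 2 / (1 *+ 2) + 3 / 8 * x ^+ 2 :> R by field.
rewrite expRD mulrCA mulrC ler_wpM2l ?expR_ge0 //.
have := expR_ge1Dx (3 / 8 * x ^+ 2); lra.
Qed.

Lemma integral_cauchy_lty : (\int[leb]_x ((1 + x ^+ 2)^-1)%:E < +oo)%E.
Proof.
rewrite (@ge0_symfun_integralT _ (fun x => (1 + x ^+ 2)^-1)).
- by rewrite -set_itvcy [X in (_ * X)%E](integral0y_oneDsqr R) -EFinM ltry.
- by move=> x; rewrite invr_ge0 addr_ge0 // sqr_ge0.
- exact: continuous_oneDsqrV.
- by move=> x; rewrite /= sqrrN.
Qed.

End GaussianBounds.

(** * Restriction to coordinate lines *)

Section Slices.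
Variables (R : realType) (n d : nat).
Local Notation C := (complex R).
Implicit Types (p : hpoly R n d) (w : cvec R n).

Definition vn w : R := Num.sqrt (vnorm2 w).

Lemma vn_ge0 w : 0 <= vn w. Proof. exact: sqrtr_ge0. Qed.
Lemma vn_sqr w : vn w ^+ 2 = vnorm2 w. Proof. by rewrite sqr_sqrtr // vnorm2_ge0. Qed.

Definition updv w (i : 'I_n.+1) (c : C) : cvec R n := [ffun j => if j == i then c else w j].

Definition slice p w i : {poly C} :=
  \sum_a p a *: ((\prod_(j | j != i) w j ^+ (val a j))%:P * 'X^(val a i)).

Lemma updvE w i c j : updv w i c j = if j == i then c else w j.
Proof. by rewrite ffunE. Qed.

Lemma slice_horner p w i c : (slice p w i).[c] = peval p (updv w i c).
Proof.
rewrite /slice horner_sum; apply: eq_bigr => a _.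
rewrite hornerZ hornerM hornerC hornerXn; congr (_ * _).
rewrite /mono [RHS](bigD1 i) //= updvE eqxx mulrC; congr (_ * _).
by apply: eq_bigr => j /negbTE ji; rewrite updvE ji.
Qed.

Lemma slice_deriv p w i c : (slice p w i)^`().[c] = pderiv_eval p i (updv w i c).
Proof.
rewrite /slice raddf_sum horner_sum; apply: eq_bigr => a _ /=.
rewrite derivZ hornerZ derivM derivC mul0r add0r hornerM hornerC derivXn hornerMn hornerXn.
congr (_ * _); rewrite [in RHS](bigD1 i) //= updvE !eqxx subn1 -mulr_natl mulrCA; congr (_ * _).
rewrite mulrC; congr (_ * _); apply: eq_bigr => j /negbTE ji.
by rewrite updvE ji subn0.
Qed.

Lemma size_slice p w i : (size (slice p w i) <= d.+1)%N.
Proof.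
apply: leq_trans (size_sum _ _ _) _; apply/bigmax_leqP => a _.
apply: leq_trans (size_scale_leq _ _) _.
apply: leq_trans (size_polyMleq _ _) _; rewrite size_polyXn.
have h := size_polyC_leq1 (\prod_(j | j != i) w j ^+ (val a j)).
by move: h (ltn_ord (val a i)); move: (size _) (nat_of_ord _) => s k; lia.
Qed.

(** The logarithmic derivative is the sum of 1/(c - z) over the roots z, each at most 1/t in
    modulus; the inequality is multiplied out so that it also covers the zeros of the product. *)
Lemma log_deriv_prod (rs : seq C) (c : C) (t : R) : 0 <= t ->
  (forall z, z \in rs -> t <= cm (c - z)) ->
  cm (\prod_(z <- rs) ('X - z%:P))^`().[c] * t <=
    (size rs)%:R * cm (\prod_(z <- rs) ('X - z%:P)).[c].
Proof.
move=> t0; elim: rs => [_|z rs ih h].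
  by rewrite big_nil -polyC1 derivC horner0 cm0 !mul0r.
rewrite big_cons derivM derivXsubC mul1r hornerD !hornerM hornerXsubC.
set P := \prod_(_ <- _) _.
have ih' : cm P^`().[c] * t <= (size rs)%:R * cm P.[c].
  by apply: ih => y yr; apply: h; rewrite inE yr orbT.
have hz : t <= cm (c - z) by apply: h; rewrite mem_head.
apply: (@le_trans _ _ ((cm P.[c] + cm (c - z) * cm P^`().[c]) * t)).
  by rewrite ler_wpM2r // -cmM cmD.
rewrite cmM /= -[(size rs).+1%:R]natr1 !mulrDl mul1r addrC; apply: lerD.
  by rewrite -mulrA [leRHS]mulrCA ler_wpM2l ?cm_ge0.
by rewrite mulrC ler_wpM2r ?cm_ge0.
Qed.

(** [log_deriv_prod] is applied with t the distance to the nearest root: a small value with a large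
    derivative forces t to be small, whatever the multiplicities of the roots. *)
Lemma nearby_root (g : {poly C}) (rs : seq C) (c : C) (al be : R) :
  g = lead_coef g *: \prod_(z <- rs) ('X - z%:P) ->
  0 < be -> 0 <= al -> cm g.[c] <= al -> be <= cm g^`().[c] ->
  exists2 z, z \in rs & cm (c - z) * be <= (size rs)%:R * al.
Proof.
move=> grs be0 al0 gal gbe.
have rs0 : rs != [::].
  apply: contraTneq gbe => e; rewrite grs e big_nil alg_polyC derivC horner0 cm0.
  by rewrite -ltNge.
have [z zr zmin] := nearest_in_seq (fun z => cm (c - z)) rs0.
exists z => //.
have h := log_deriv_prod (cm_ge0 (c - z)) zmin.
have h2 : cm g^`().[c] * cm (c - z) <= (size rs)%:R * cm g.[c].
  rewrite [X in cm X^`().[c]]grs [X in _ * cm X.[c]]grs derivZ !hornerZ !cmM.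
  by rewrite -mulrA [leRHS]mulrCA ler_wpM2l ?cm_ge0.
apply: (@le_trans _ _ (cm g^`().[c] * cm (c - z))).
  by rewrite mulrC ler_wpM2r ?cm_ge0.
by apply: le_trans h2 _; rewrite ler_wpM2l.
Qed.

Lemma vnorm2_updv w i c : vnorm2 (updv w i c) = cabs2 c + \sum_(j | j != i) cabs2 (w j).
Proof.
rewrite /vnorm2 (bigD1 i) //= updvE eqxx; congr (_ + _).
by apply: eq_bigr => j /negbTE ji; rewrite updvE ji.
Qed.

Lemma vn_lip w i c c' : vn (updv w i c) <= vn (updv w i c') + cm (c - c').
Proof.
have g := cm_ge0 (c - c').
have g2 : 0 <= vn (updv w i c') + cm (c - c') by rewrite addr_ge0 // vn_ge0.
rewrite -(@ler_pXn2r _ 2) ?nnegrE ?vn_ge0 //.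
rewrite sqrrD !vn_sqr !vnorm2_updv !cabs2E.
have t : cm c <= cm c' + cm (c - c') by rewrite addrC -{1}(subrK c' c) cmD.
have yj : cm c' <= vn (updv w i c').
  rewrite -(@ler_pXn2r _ 2) ?nnegrE ?cm_ge0 ?vn_ge0 // vn_sqr vnorm2_updv cabs2E lerDl.
  by apply: sumr_ge0 => j _; exact: cabs2_ge0.
have : cm c ^+ 2 <= (cm c' + cm (c - c')) ^+ 2.
  by apply: lerXn2r; rewrite ?nnegrE ?addr_ge0 ?cm_ge0.
rewrite sqrrD => t2.
have : cm c' * cm (c - c') *+ 2 <= vn (updv w i c') * cm (c - c') *+ 2.
  by rewrite lerMn2r /= ler_wpM2r.
move: t2; lra.
Qed.

(** Squares stand in for discs so that the Gaussian integral factors over the two real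
    coordinates. *)
Definition boxf (k a1 a2 s : R) (y1 y2 : R) : R :=
  k * \1_(`[a1, a1 + s]%classic) y1 * \1_(`[a2, a2 + s]%classic) y2.

Lemma indic01 (T : Type) (A : set T) x : 0 <= (\1_A x : R).
Proof. by rewrite indicE; case: (_ \in _). Qed.

Lemma boxf_ge0 k a1 a2 s y1 y2 : 0 <= k -> 0 <= boxf k a1 a2 s y1 y2.
Proof. by move=> k0; rewrite !mulr_ge0 // indic01. Qed.

(* The points of a coordinate line close to a root [z], relative to their norm, form
   a disc of area proportional to the squared norm. *)
Lemma disc_box w i (z kap b : C) (tau : R) : kap != 0 -> 0 <= tau <= 1 / 2 ->
  exists k a1 a2 s : R, [/\ 0 <= k, 0 <= s, k * s ^+ 2 <= 36 * tau ^+ 2 / cm kap ^+ 2 &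
   forall y1 y2, let c := kap * Complex y1 y2 + b in
    cm (c - z) <= tau * vn (updv w i c) ->
    (vnorm2 (updv w i c))^-1 <= boxf k a1 a2 s y1 y2].
Proof.
move=> kap0 /andP[tau0 tau1].
have k0 : 0 < cm kap by rewrite cm_gt0.
pose Nz := vn (updv w i z); pose r := 2 * tau * Nz / cm kap; pose m := (z - b) / kap.
have Nz0 : 0 <= Nz by exact: vn_ge0.
have r0 : 0 <= r by rewrite divr_ge0 ?(ltW k0) // !mulr_ge0.
(* As tau <= 1/2, the norms at c and z satisfy Nc <= 2 Nz and Nz <= 3/2 Nc. The first gives the
   radius 2 tau Nz, the second the height 9/4 / Nz^2; then 9/4 times the squared side 4 r^2 produces
   the constant 36. *)
exists (9 / 4 / Nz ^+ 2), (complex.Re m - r), (complex.Im m - r), (2 * r); split.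
- by rewrite divr_ge0 ?exprn_ge0.
- by rewrite mulr_ge0.
- have [e|ne] := eqVneq Nz 0.
    by rewrite e expr0n /= invr0 mulr0 mul0r divr_ge0 ?exprn_ge0 ?(ltW k0) // mulr_ge0 ?exprn_ge0.
  rewrite le_eqVlt; apply/orP; left; apply/eqP; rewrite /r; field.
  by rewrite ne gt_eqF.
move=> y1 y2 c hc.
have h1 : cm (c - z) <= vn (updv w i c) / 2.
  by apply: le_trans hc _; rewrite mulrC ler_wpM2l ?vn_ge0 //; lra.
have h2 := vn_lip w i z c; rewrite cmB -/Nz in h2.
have h3 := vn_lip w i c z; rewrite -/Nz in h3.
set Nc := vn (updv w i c) in hc h1 h2 h3.
have Nc0 : 0 <= Nc by exact: vn_ge0.
rewrite -vn_sqr -/Nc.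
have [e|ne] := eqVneq Nc 0.
  by rewrite e expr0n /= invr0 boxf_ge0 // divr_ge0 ?exprn_ge0.
have Ncp : 0 < Nc by rewrite lt_def ne.
have Nzp : 0 < Nz by move: h3 h1; lra.
have h4 : Nc <= 2 * Nz by move: h3 h1; lra.
have h5 : Nz <= 3 / 2 * Nc by move: h2 h1; lra.
have E : c - z = kap * (Complex y1 y2 - m).
  by rewrite /c /m mulrBr [kap * (_ / _)]mulrC divfK //; ring.
have hr : cm (Complex y1 y2 - m) <= r.
  have : cm kap * cm (Complex y1 y2 - m) <= 2 * tau * Nz.
    rewrite -cmM -E; apply: le_trans hc _.
    by rewrite [2 * tau]mulrC -mulrA ler_wpM2l.
  by rewrite mulrC -ler_pdivlMr.
have hR := le_trans (Re_le_cm _) hr; have hI := le_trans (Im_le_cm _) hr.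
rewrite !(cReD, cImD, cReN, cImN) /= in hR hI.
move: hR hI; rewrite !ler_norml => /andP[hR1 hR2] /andP[hI1 hI2].
rewrite /boxf !indicE !mem_set ?mulr1 /=; last 2 first.
- by rewrite in_itv /=; apply/andP; split; lra.
- by rewrite in_itv /=; apply/andP; split; lra.
have -> : 9 / 4 / Nz ^+ 2 = ((2 / 3 * Nz) ^+ 2)^-1 by field; rewrite gt_eqF.
rewrite lef_pV2 ?posrE ?exprn_gt0 ?mulr_gt0 ?divr_gt0 //.
apply: lerXn2r; rewrite ?nnegrE ?mulr_ge0 ?divr_ge0 //; lra.
Qed.

Local Notation gam := (@normal_prob R 0 1).

Lemma integral_gauss_box (a s k : R) : 0 <= s -> 0 <= k ->
  (\int[gam]_x (k * \1_(`[a, (a + s)%R]%classic) x)%:E <= (k * s)%:E)%E.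
Proof.
move=> s0 k0; under eq_integral do rewrite EFinM.
rewrite ge0_integralZl_EFin //; last by apply/measurable_EFinP; exact: measurable_indic.
rewrite integral_indic //= setIT EFinM; apply: lee_wpmul2l; first by rewrite lee_fin.
have := @normal_itv_le R a (a + s); rewrite lerDl => /(_ s0) h.
by apply: le_trans h _; rewrite addrC addKr.
Qed.

Lemma integral_gauss_boxes (I : Type) (rs : seq I) (k a1 a2 s : I -> R) (B : R) :
  (forall z, 0 <= k z) -> (forall z, 0 <= s z) -> (forall z, k z * s z ^+ 2 <= B) ->
  (\int[gam]_y1 \int[gam]_y2 (\sum_(z <- rs) boxf (k z) (a1 z) (a2 z) (s z) y1 y2)%:E
    <= ((size rs)%:R * B)%:E)%E.
Proof.
move=> k0 s0 hB.
have mb (z : I) (y1 : R) : measurable_fun setT (fun y2 => (boxf (k z) (a1 z) (a2 z) (s z) y1 y2)%:E).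
  apply/measurable_EFinP; apply: measurable_funM; first exact: measurable_cst.
  exact: measurable_indic.
apply: (@le_trans _ _ (\int[gam]_y1 (\sum_(z <- rs)
   ((k z * s z) * \1_(`[a1 z, (a1 z + s z)%R]%classic) y1)%:E))%E).
  apply: ge0_le_integral_nomeas => y1 _.
    apply: integral_ge0 => y2 _; rewrite lee_fin sumr_ge0 // => z _; exact: boxf_ge0.
  under eq_integral do rewrite -sumEFin.
  rewrite ge0_integral_sum //; last 2 first.
  - by move=> z; exact: mb.
  - by move=> z y2 _; rewrite lee_fin boxf_ge0.
  apply: lee_sum => z _.
  apply: le_trans (integral_gauss_box _ _ _) _ => //.
    by rewrite mulr_ge0 // indic01.
  by rewrite lee_fin le_eqVlt; apply/orP; left; apply/eqP; ring.
rewrite ge0_integral_sum //; last 2 first.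
- move=> z; apply/measurable_EFinP; apply: measurable_funM; first exact: measurable_cst.
  exact: measurable_indic.
- by move=> z y _; rewrite lee_fin mulr_ge0 ?indic01 // mulr_ge0.
apply: (@le_trans _ _ (\sum_(z <- rs) B%:E)%E).
  apply: lee_sum => z _; apply: le_trans (integral_gauss_box _ _ _) _ => //.
    by rewrite mulr_ge0.
  by rewrite lee_fin -mulrA -expr2.
by rewrite sumEFin lee_fin big_const_seq count_predT iter_addr_0 mulr_natl.
Qed.

End Slices.

Section SmallBall.
Variables (R : realType) (n d : nat).
Local Notation C := (complex R).
Local Notation gam := (@normal_prob R 0 1).
Implicit Types (p : hpoly R n d) (w u v : cvec R n).

Definition zone p (eta : R) w : bool := cm (peval p w) <= eta * vn w ^+ d.

Definition zone_dir p (eta dl : R) (i : 'I_n.+1) w : bool :=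
  zone p eta w && (dl * vn w ^+ d.-1 <= cm (pderiv_eval p i w)).

(* Being at positive distance from the discriminant enters the estimates only through
   this condition. *)
Definition good (dl : R) p : Prop :=
  forall w, exists i, dl * vn w ^+ d.-1 <= cm (pderiv_eval p i w).

Definition zone_inv p eta dl i w : R :=
  if zone_dir p eta dl i w then (vnorm2 w)^-1 else 0.

Lemma zone_inv_ge0 p eta dl i w : 0 <= zone_inv p eta dl i w.
Proof. by rewrite /zone_inv; case: ifP => // _; rewrite invr_ge0 vnorm2_ge0. Qed.

(** By [nearby_root] the part of the zone with large derivative lies within relative distance tau =
    d eta / dl of the at most d roots of the slice. Each root is covered by a box from [disc_box],
    and the Gaussian density is at most 1, so Lebesgue areas bound the Gaussian ones. *)
Lemma integral_zone_inv p eta dl i w (kap b : C) : (0 < d)%N -> 0 < dl -> 0 <= eta ->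
  d%:R * eta / dl <= 1 / 2 -> kap != 0 ->
  (\int[gam]_y1 \int[gam]_y2 (zone_inv p eta dl i (updv w i (kap * Complex y1 y2 + b)))%:E
   <= (d%:R * (36 * (d%:R * eta / dl) ^+ 2 / cm kap ^+ 2))%:E)%E.
Proof.
move=> d0 dl0 eta0 tau1 kap0; set tau := d%:R * eta / dl in tau1 *.
have tau0 : 0 <= tau by rewrite divr_ge0 ?mulr_ge0 // ltW.
have tau01 : 0 <= tau <= 1 / 2 by rewrite tau0.
have [rs [srs hrs]] : exists rs : seq C, (size rs <= d)%N /\
    forall c, zone_dir p eta dl i (updv w i c) -> 0 < vn (updv w i c) ->
     exists2 z, z \in rs & cm (c - z) <= tau * vn (updv w i c).
  have [s0|s0] := eqVneq (slice p w i) 0.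
    exists [::]; split => // c /andP[_ h] v0; move: h.
    by rewrite -slice_deriv s0 derivC horner0 cm0 leNgt mulr_gt0 // exprn_gt0.
  have [rs grs] := closed_field_poly_normal (slice p w i).
  have srs : (size rs).+1 = size (slice p w i).
    by rewrite [in RHS]grs size_scale ?lead_coef_eq0 // size_prod_XsubC.
  have srsd : (size rs <= d)%N by rewrite -ltnS srs size_slice.
  exists rs; split => // c /andP[h1 h2] v0.
  rewrite /zone -slice_horner in h1; rewrite -slice_deriv in h2.
  have be0 : 0 < dl * vn (updv w i c) ^+ d.-1 by rewrite mulr_gt0 // exprn_gt0.
  have al0 : 0 <= eta * vn (updv w i c) ^+ d by rewrite mulr_ge0 // exprn_ge0 // vn_ge0.
  have [z zr hz] := nearby_root grs be0 al0 h1 h2.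
  exists z => //; rewrite /tau.
  rewrite -(@ler_pM2r _ (dl * vn (updv w i c) ^+ d.-1)) //; apply: le_trans hz _.
  have -> : d%:R * eta / dl * vn (updv w i c) * (dl * vn (updv w i c) ^+ d.-1) =
     d%:R * (eta * vn (updv w i c) ^+ d).
    have -> : vn (updv w i c) ^+ d = vn (updv w i c) * vn (updv w i c) ^+ d.-1.
      by rewrite -exprS prednK.
    by field; rewrite gt_eqF.
  by rewrite ler_wpM2r // ler_nat.
have /choice [k0 hk0] : forall z : C, exists kk : (R * R) * (R * R), let k := kk.1.1 in
    [/\ 0 <= k, 0 <= kk.2.2, k * kk.2.2 ^+ 2 <= 36 * tau ^+ 2 / cm kap ^+ 2 &
   forall y1 y2, let c := kap * Complex y1 y2 + b in
    cm (c - z) <= tau * vn (updv w i c) ->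
    (vnorm2 (updv w i c))^-1 <= boxf k kk.1.2 kk.2.1 kk.2.2 y1 y2].
  move=> z; have [k [a1 [a2 [s h]]]] := disc_box w i z b kap0 tau01.
  by exists ((k, a1), (a2, s)).
have kge z : 0 <= (k0 z).1.1 by have [] := hk0 z.
have sge z : 0 <= (k0 z).2.2 by have [] := hk0 z.
have kB z : (k0 z).1.1 * (k0 z).2.2 ^+ 2 <= 36 * tau ^+ 2 / cm kap ^+ 2 by have [] := hk0 z.
apply: (@le_trans _ _ ((size rs)%:R * (36 * tau ^+ 2 / cm kap ^+ 2))%:E); last first.
  rewrite lee_fin; apply: ler_wpM2r; last by rewrite ler_nat.
  by apply: divr_ge0; [apply: mulr_ge0 => //; exact: sqr_ge0|exact: sqr_ge0].
apply: le_trans (integral_gauss_boxes rs (fun z => (k0 z).1.2) (fun z => (k0 z).2.1) kge sge kB).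
apply: ge0_le_integral_nomeas => y1 _.
  by apply: integral_ge0 => y2 _; rewrite lee_fin zone_inv_ge0.
apply: ge0_le_integral_nomeas => y2 _; rewrite lee_fin ?zone_inv_ge0 //.
have sumge0 : 0 <= \sum_(z <- rs) boxf (k0 z).1.1 (k0 z).1.2 (k0 z).2.1 (k0 z).2.2 y1 y2.
  by apply: sumr_ge0 => z _; exact: boxf_ge0.
rewrite /zone_inv; case: ifP => // hc.
set c := kap * Complex y1 y2 + b in hc *.
have [v0|v0] := eqVneq (vn (updv w i c)) 0.
  by rewrite -vn_sqr v0 expr0n invr0.
have [|z zr hz] := hrs c hc; first by rewrite lt_def v0 vn_ge0.
have [_ _ _ h] := hk0 z; apply: le_trans (h y1 y2 hz) _.
rewrite (perm_big _ (perm_to_rem zr)) big_cons lerDl.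
by apply: sumr_ge0 => z' _; exact: boxf_ge0.
Qed.

(* The density, in the affine coordinate [x], of the Fubini-Study area on the line of [u]
   and [v], restricted to the zone; it is dominated in two ways so that either [u] or [v]
   can be integrated out. *)
Definition zone_density p eta u v (x : C) : R :=
  if zone p eta (lin x u v) then gram u v / vnorm2 (lin x u v) ^+ 2 else 0.

Lemma zone_density_ge0 p eta u v x : 0 <= zone_density p eta u v x.
Proof.
by rewrite /zone_density; case: ifP => // _; rewrite divr_ge0 ?gram_ge0 // exprn_ge0 // vnorm2_ge0.
Qed.

Lemma gram_linr z u v : gram (lin z u v) v = cabs2 z * gram u v.
Proof.
have -> : v = lin 0 u v by apply/ffunP => i; rewrite !ffunE mul0r add0r.
rewrite -{1}[lin z u _]/(lin z u (lin 0 u v)).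
have -> : lin z u (lin 0 u v) = lin z u v.
  by apply/ffunP => i; rewrite !ffunE mul0r add0r.
rewrite gram_lin_lin subr0; congr (_ * gram _ _).
by apply/ffunP => i; rewrite !ffunE mul0r add0r.
Qed.

(** With w = x u + v, the hypothesis on [Tb] trades [gram u v / |w|^4] for [Tb / |w|^2]. The sum
    over i appears because the direction of large derivative provided by [good] depends on w. *)
Lemma zone_density_le_gen p eta dl u v x (Tb : R) : good dl p ->
  gram u v <= vnorm2 (lin x u v) * Tb -> 0 <= Tb ->
  zone_density p eta u v x <= \sum_i Tb * zone_inv p eta dl i (lin x u v).
Proof.
move=> gp hT T0; rewrite /zone_density; case: ifP => hs; last first.
  by apply: sumr_ge0 => i _; rewrite mulr_ge0 // zone_inv_ge0.
have [i hi] := gp (lin x u v).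
rewrite (bigD1 i) //= {1}/zone_inv /zone_dir hs hi /=.
apply: (@le_trans _ _ (Tb / vnorm2 (lin x u v))); last first.
  by rewrite lerDl sumr_ge0 // => j _; rewrite mulr_ge0 // zone_inv_ge0.
have [v0|v0] := eqVneq (vnorm2 (lin x u v)) 0.
  by rewrite v0 expr0n invr0 !mulr0.
have vp : 0 < vnorm2 (lin x u v) by rewrite lt_def v0 vnorm2_ge0.
rewrite ler_pdivrMr ?exprn_gt0 //; apply: le_trans hT _.
rewrite le_eqVlt; apply/orP; left; apply/eqP; field; exact: v0.
Qed.

Lemma zone_density_le1 p eta dl u v x : good dl p ->
  zone_density p eta u v x <= \sum_i vnorm2 u * zone_inv p eta dl i (lin x u v).
Proof.
move=> gp; apply: zone_density_le_gen => //; last exact: vnorm2_ge0.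
by rewrite -(gram_linl x) gram_le.
Qed.

(** Here the Gram determinant of x u + v and v is |x|^2 times that of u and v, which yields a factor
    decaying in x. *)
Lemma zone_density_le2 p eta dl u v x : good dl p -> x != 0 ->
  zone_density p eta u v x <= \sum_i (vnorm2 v / cabs2 x) * zone_inv p eta dl i (lin x u v).
Proof.
move=> gp x0; have cx : 0 < cabs2 x by rewrite cabs2E exprn_gt0 // cm_gt0.
apply: zone_density_le_gen => //; last by rewrite divr_ge0 ?vnorm2_ge0 // ltW.
rewrite mulrA ler_pdivlMr // mulrC -gram_linr gram_le //.
Qed.

Lemma updv_lin1 x u v i c : lin x u (updv v i c) = updv (lin x u v) i (1 * c + x * u i).
Proof.
apply/ffunP => j; rewrite !ffunE; case: eqP => [->|//]; ring.
Qed.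

Lemma updv_lin2 x u v i c : lin x (updv u i c) v = updv (lin x u v) i (x * c + v i).
Proof. by apply/ffunP => j; rewrite !ffunE; case: eqP => [->|//]. Qed.

End SmallBall.

Section MeasurableBall.
Variables (R : realType) (n d : nat) (dsp : measure_display) (T : measurableType dsp).
Local Notation C := (complex R).
Implicit Types (p : hpoly R n d).

Lemma measurable_sqrtr (f : T -> R) : measurable_fun setT f ->
  measurable_fun setT (fun t => Num.sqrt (f t)).
Proof.
by move=> mf; apply: (measurableT_comp _ mf); apply: continuous_measurable_fun; exact: sqrt_continuous.
Qed.

Lemma measurable_invr (f : T -> R) : (forall t, 0 <= f t) -> measurable_fun setT f ->
  measurable_fun setT (fun t => (f t)^-1).
Proof.
move=> f0 mf; apply: measurable_fun_le => c.
have -> : [set t | (f t)^-1 <= c] = [set t | (0 <= c) && ((f t <= 0) || (1 <= c * f t))].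
  apply/seteqP; split => t /=; have := f0 t; rewrite le_eqVlt => /orP[/eqP e|e].
  - by rewrite -e invr0 lexx /= andbT.
  - have i0 : 0 < (f t)^-1 by rewrite invr_gt0.
    move=> h; have c0 : 0 < c by exact: lt_le_trans h.
    by rewrite (ltW c0) /= -ler_pdivrMr // mul1r h orbT.
  - by rewrite -e invr0 lexx /= andbT.
  - by case/andP => _; rewrite leNgt e /= -ler_pdivrMr // mul1r.
apply: mset; apply: measurable_and; first exact: measurable_cst.
apply: measurable_or; apply: measurable_fun_ler => //; try exact: measurable_cst.
by apply: measurable_funM => //; exact: measurable_cst.
Qed.

Lemma cmeas_cm (f : T -> C) : cmeas f -> measurable_fun setT (fun t => cm (f t)).
Proof.
move=> /cmeas_cabs2 /measurable_sqrtr; apply: eq_measurable_fun => t _.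
by rewrite cabs2E sqrtr_sqr ger0_norm ?cm_ge0.
Qed.

Variable W : T -> cvec R n.
Hypothesis mW : forall i, cmeas (fun t => W t i).

Lemma cmeas_peval p : cmeas (fun t => peval p (W t)).
Proof.
apply: cmeas_sum => a; apply: cmeasM; first exact: cmeas_cst.
by apply: cmeas_prod => i; exact: cmeasX.
Qed.

Lemma cmeas_pderiv p i : cmeas (fun t => pderiv_eval p i (W t)).
Proof.
apply: cmeas_sum => a; apply: cmeasM; first exact: cmeas_cst.
apply: cmeasM; first exact: cmeas_cst.
by apply: cmeas_prod => j; exact: cmeasX.
Qed.

Lemma measurable_zone p eta : measurable_fun setT (fun t => zone p eta (W t)).
Proof.
apply: measurable_fun_ler; first exact/cmeas_cm/cmeas_peval.
apply: measurable_funM; first exact: measurable_cst.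
by apply: measurable_funX; apply: measurable_sqrtr; exact: measurable_vnorm2.
Qed.

Lemma measurable_zone_inv p eta dl i : measurable_fun setT (fun t => zone_inv p eta dl i (W t)).
Proof.
apply: measurable_fun_ifT; last exact: measurable_cst.
  apply: measurable_and; first exact: measurable_zone.
  apply: measurable_fun_ler; last exact/cmeas_cm/cmeas_pderiv.
  apply: measurable_funM; first exact: measurable_cst.
  by apply: measurable_funX; apply: measurable_sqrtr; exact: measurable_vnorm2.
by apply: measurable_invr => [t|]; [exact: vnorm2_ge0|exact: measurable_vnorm2].
Qed.

Variables (U V : T -> cvec R n) (x : T -> C).
Hypotheses (mU : forall i, cmeas (fun t => U t i)) (mV : forall i, cmeas (fun t => V t i)).
Hypothesis mx : cmeas x.

Lemma cmeas_lin i : cmeas (fun t => lin (x t) (U t) (V t) i).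
Proof.
apply: (@cmeas_ext _ _ _ (fun t => x t * U t i + V t i)) => [t|]; first by rewrite ffunE.
by apply: cmeasD => //; exact: cmeasM.
Qed.

Lemma cmeas_hdot : cmeas (fun t => hdot (U t) (V t)).
Proof. by apply: cmeas_sum => i; apply: cmeasM => //; exact: cmeas_conj. Qed.

Lemma measurable_gram : measurable_fun setT (fun t => gram (U t) (V t)).
Proof.
apply: measurable_funB; last exact/cmeas_cabs2/cmeas_hdot.
by apply: measurable_funM; exact: measurable_vnorm2.
Qed.

End MeasurableBall.

Section MeasurableZoneDensity.
Variables (R : realType) (n d : nat) (dsp : measure_display) (T : measurableType dsp).
Local Notation C := (complex R).
Variables (p : hpoly R n d) (U V : T -> cvec R n) (x : T -> C).
Hypotheses (mU : forall i, cmeas (fun t => U t i)) (mV : forall i, cmeas (fun t => V t i)).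
Hypothesis mx : cmeas x.

Lemma measurable_zone_density eta : measurable_fun setT (fun t => zone_density p eta (U t) (V t) (x t)).
Proof.
have ml := cmeas_lin mU mV mx.
apply: measurable_fun_ifT; last exact: measurable_cst.
  exact: (measurable_zone ml).
apply: measurable_funM; first exact: measurable_gram.
apply: measurable_invr => [t|]; first by rewrite exprn_ge0 // vnorm2_ge0.
by apply: measurable_funX; exact: (measurable_vnorm2 ml).
Qed.

End MeasurableZoneDensity.

Section GaussianVectors.
Variables (R : realType) (n d m : nat).
Local Notation gam := (@normal_prob R 0 1).

Lemma measurable_nth k : measurable_fun setT (fun t : m.-tuple R => nth 0 t k).
Proof.
have [km|mk] := ltnP k m; last first.
  rewrite (_ : (fun t => _) = cst 0); first exact: measurable_cst.
  by apply/funext => t; rewrite nth_default // size_tuple.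
rewrite (_ : (fun t => _) = (fun t : m.-tuple R => tnth t (Ordinal km))).
  exact: measurable_tnth.
by apply/funext => t; rewrite (tnth_nth 0).
Qed.

Lemma cmeas_gvec off i : cmeas (fun t : m.-tuple R => gvec n t off i).
Proof.
apply: (@cmeas_ext _ _ _ (fun t : m.-tuple R =>
  Complex (nth 0 t (off + 2 * i)%N) (nth 0 t (off + 2 * i).+1))) => [t|]; first by rewrite ffunE.
by split; exact: measurable_nth.
Qed.

Definition upd2 (off i : nat) (s : seq R) y1 y2 : seq R :=
  upd (off + 2 * i).+1 (upd (off + 2 * i) s y1) y2.

Lemma gvec_upd2 off (i : 'I_n.+1) s y1 y2 :
  gvec n (upd2 off i s y1 y2) off = updv (gvec n s off) i (Complex y1 y2).
Proof.
apply/ffunP => j; rewrite !ffunE; have [->|ji] := eqVneq j i.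
  by rewrite !nth_set_nth /= !nth_set_nth /= !eqxx ltn_eqF.
have ne : (j : nat) != i by [].
by rewrite !nth_set_nth /= !nth_set_nth /= !ifF //; apply/eqP; lia.
Qed.

Lemma gvec_upd2_other off off' (i : 'I_n.+1) s y1 y2 :
  (off' + 2 * n.+1 <= off)%N || (off + 2 * n.+1 <= off')%N ->
  gvec n (upd2 off i s y1 y2) off' = gvec n s off'.
Proof.
move=> h; apply/ffunP => j; rewrite !ffunE; have := ltn_ord i; have := ltn_ord j.
move=> hj hi; rewrite !nth_set_nth /= !nth_set_nth /= !ifF //; apply/eqP; case/orP: h; lia.
Qed.

Local Open Scope ereal_scope.

Lemma gint_resample2 off i (f : seq R -> \bar R) : ((off + 2 * i).+1 < m)%N ->
  (forall s, 0 <= f s) -> gmeas m f ->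
  gint m f = gint m (fun s => \int[gam]_y1 \int[gam]_y2 f (upd2 off i s y1 y2)).
Proof.
move=> jm f0 mf; rewrite (gint_resample jm) // (@gint_resample _ _ (off + 2 * i)) //.
- exact: ltnW.
- by move=> s; exact: integral_ge0.
- exact: gmeas_int.
Qed.

Lemma le_gint k (f g : seq R -> \bar R) : (forall s, 0 <= f s) -> (forall s, f s <= g s) ->
  gint k f <= gint k g.
Proof.
elim: k f g => [|k IH] f g f0 fg /=; first exact: fg.
apply: ge0_le_integral_nomeas => x _; first exact: gint_ge0.
exact: IH.
Qed.

Lemma gint_cst k (c : \bar R) : gint k (fun=> c) = c.
Proof.
elim: k => [//|k IH] /=; rewrite IH integral_cst // -[RHS]mule1; congr (_ * _).
exact: probability_setT.
Qed.

Lemma gint_sum k (I : Type) (r : seq I) (f : I -> seq R -> \bar R) :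
  (forall i s, 0 <= f i s) -> (forall i, gmeas k (f i)) ->
  gint k (fun s => \sum_(i <- r) f i s) = \sum_(i <- r) gint k (f i).
Proof.
move=> f0 mf; have [P hP] := @gint_tuple R k; rewrite hP.
- by rewrite ge0_integral_sum //; apply: eq_bigr => i _; rewrite hP.
- by move=> s; exact: sume_ge0.
- exact: emeasurable_sum.
Qed.

Lemma gintZl k (c : R) (f : seq R -> \bar R) : (0 <= c)%R ->
  (forall s, 0 <= f s) -> gmeas k f ->
  gint k (fun s => c%:E * f s) = c%:E * gint k f.
Proof.
move=> c0 f0 mf; have [P hP] := @gint_tuple R k; rewrite !hP //.
- by rewrite ge0_integralZl_EFin.
- by move=> s; rewrite mule_ge0.
- exact: measurable_funeM.
Qed.

Lemma gint_nth2 k : (k < m)%N -> gint m (fun s => ((nth 0 s k) ^+ 2)%:E) = moment2 R.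
Proof.
move=> km; rewrite (gint_resample km).
- rewrite -[RHS](gint_cst m); congr (gint _ _); apply/funext => s.
  by apply: eq_integral => y _; rewrite nth_set_nth /= eqxx.
- by move=> s; rewrite lee_fin sqr_ge0.
- by apply/measurable_EFinP; apply: measurable_funX; exact (@measurable_nth k).
Qed.

Lemma gint_vnorm2 off : (off + 2 * n.+1 <= m)%N ->
  gint m (fun s => (vnorm2 (gvec n s off))%:E) = \sum_(i < n.+1) (moment2 R + moment2 R).
Proof.
move=> om.
have mm k : gmeas m (fun s : seq R => ((nth 0 s k) ^+ 2)%:E).
  by apply/measurable_EFinP; apply: measurable_funX; exact (@measurable_nth k).
transitivity (gint m (fun s : seq R => \sum_(i < n.+1) \sum_(b <- [:: 0; 1]%N)
   ((nth 0 s (off + 2 * i + b)) ^+ 2)%:E)).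
  apply: eq_gint => s _; rewrite /vnorm2 -sumEFin; apply: eq_bigr => i _.
  by rewrite !big_cons big_nil adde0 addn0 addn1 /cabs2 ffunE EFinD.
rewrite gint_sum; last 2 first.
- by move=> i s; apply: sume_ge0 => b _; rewrite lee_fin sqr_ge0.
- by move=> i; apply: emeasurable_sum => b; exact: mm.
apply: eq_bigr => i _; rewrite gint_sum //; last by move=> b s; rewrite lee_fin sqr_ge0.
have li := ltn_ord i.
by rewrite !big_cons big_nil adde0 !gint_nth2 //; lia.
Qed.

End GaussianVectors.

Section SmallBallEstimate.
Variables (R : realType) (n d : nat).
Local Notation C := (complex R).
Local Notation gam := (@normal_prob R 0 1).
Local Notation leb := (@lebesgue_measure R).
Local Notation m := (4 * n.+1)%N.
Implicit Types (p : hpoly R n d).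

Definition vU (s : seq R) : cvec R n := gvec n s 0.
Definition vV (s : seq R) : cvec R n := gvec n s (2 * n.+1).

Lemma cmeas_vU i : cmeas (fun t : m.-tuple R => vU t i). Proof. exact: cmeas_gvec. Qed.
Lemma cmeas_vV i : cmeas (fun t : m.-tuple R => vV t i). Proof. exact: cmeas_gvec. Qed.

Definition vmoment : R := n.+1%:R * (2 * fine (moment2 R)).

Lemma moment2_fine : moment2 R = (fine (moment2 R))%:E.
Proof.
rewrite fineK // ge0_fin_numE ?moment2_lty //.
by apply: integral_ge0 => x _; rewrite lee_fin sqr_ge0.
Qed.

Lemma vmoment_ge0 : 0 <= vmoment.
Proof.
rewrite mulr_ge0 // mulr_ge0 // fine_ge0 //.
by apply: integral_ge0 => x _; rewrite lee_fin sqr_ge0.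
Qed.

Lemma gint_vnorm2_vmoment off : (off + 2 * n.+1 <= m)%N ->
  gint m (fun s => (vnorm2 (gvec n s off))%:E) = vmoment%:E.
Proof.
move=> om; rewrite gint_vnorm2 // moment2_fine -EFinD sumEFin sumr_const card_ord.
by rewrite /vmoment mulr_natl [2 * _]mulr_natl mulr2n.
Qed.

(** Stated for a point [L s] that moves affinely with factor [kap] when coordinate i of the block at
    [offw] is resampled, so that it covers both choices of resampled vector, as well as the point u
    alone in [ae_peval_neq0]. The blocks being disjoint, the norm of the other one is constant under
    the inner integrals and averages to [vmoment]. *)
Lemma gint_zone_inv_le p (eta dl : R) (i : 'I_n.+1) (kap : C) (c : R) (offa offw : nat)
    (L : seq R -> cvec R n) (b : seq R -> C) :
  (0 < d)%N -> 0 < dl -> 0 <= eta -> d%:R * eta / dl <= 1 / 2 -> kap != 0 -> 0 <= c ->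
  (offa + 2 * n.+1 <= m)%N -> (offw + 2 * n.+1 <= m)%N ->
  (offa + 2 * n.+1 <= offw)%N || (offw + 2 * n.+1 <= offa)%N ->
  (forall j, cmeas (fun t : m.-tuple R => L t j)) ->
  (forall s y1 y2, L (upd2 offw i s y1 y2) = updv (L s) i (kap * Complex y1 y2 + b s)) ->
  (gint m (fun s => (c * vnorm2 (gvec n s offa) * zone_inv p eta dl i (L s))%:E) <=
   (c * (d%:R * (36 * (d%:R * eta / dl) ^+ 2 / cm kap ^+ 2)) * vmoment)%:E)%E.
Proof.
move=> d0 dl0 eta0 tau1 kap0 c0 am wm aw mL hL.
set K := d%:R * _.
have K0 : 0 <= K by rewrite mulr_ge0 // divr_ge0 ?sqr_ge0 // mulr_ge0 // sqr_ge0.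
have mva : measurable_fun setT (fun t : m.-tuple R => vnorm2 (gvec n t offa)).
  by apply: measurable_vnorm2 => j; exact: cmeas_gvec.
have li := ltn_ord i.
rewrite (@gint_resample2 R m offw i); first last.
- apply/measurable_EFinP; apply: measurable_funM; last exact: measurable_zone_inv.
  by apply: measurable_funM => //; exact: measurable_cst.
- by move=> s; rewrite lee_fin !mulr_ge0 ?vnorm2_ge0 ?zone_inv_ge0.
- lia.
apply: (@le_trans _ _ (gint m (fun s => (c * K)%:E * (vnorm2 (gvec n s offa))%:E)))%E; last first.
  rewrite gintZl ?gint_vnorm2_vmoment -?EFinM //.
  - by rewrite mulr_ge0.
  - by move=> s; rewrite lee_fin vnorm2_ge0.
  - exact/measurable_EFinP.
apply: le_gint => s.
  by apply: integral_ge0 => y1 _; apply: integral_ge0 => y2 _; rewrite lee_fin !mulr_ge0 ?vnorm2_ge0 ?zone_inv_ge0.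
set A := vnorm2 (gvec n s offa); have A0 : 0 <= A by exact: vnorm2_ge0.
have mh y1 : measurable_fun setT (fun y2 => zone_inv p eta dl i (updv (L s) i (kap * Complex y1 y2 + b s))).
  apply: measurable_zone_inv => j.
  apply: (@cmeas_ext _ _ _ (fun y2 => if j == i then kap * Complex y1 y2 + b s else L s j)).
    by move=> t; rewrite updvE.
  case: (j == i); last exact: cmeas_cst.
  by apply: cmeasD; [apply: cmeasM; [exact: cmeas_cst|split; [exact: measurable_cst|exact: measurable_id]]|exact: cmeas_cst].
have mh2 : measurable_fun setT (fun y : R * R => zone_inv p eta dl i (updv (L s) i (kap * Complex y.1 y.2 + b s))).
  apply: measurable_zone_inv => j.
  apply: (@cmeas_ext _ _ _ (fun y : R * R => if j == i then kap * Complex y.1 y.2 + b s else L s j)).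
    by move=> t; rewrite updvE.
  case: (j == i); last exact: cmeas_cst.
  by apply: cmeasD; [apply: cmeasM; [exact: cmeas_cst|split; [exact: measurable_fst|exact: measurable_snd]]|exact: cmeas_cst].
have h0 y1 y2 : (0 <= (zone_inv p eta dl i (updv (L s) i (kap * Complex y1 y2 + b s)))%:E)%E.
  by rewrite lee_fin zone_inv_ge0.
have mhE y1 : measurable_fun setT (fun y2 => (zone_inv p eta dl i (updv (L s) i (kap * Complex y1 y2 + b s)))%:E).
  by apply/measurable_EFinP; exact: (mh y1).
have -> : (\int[gam]_y1 \int[gam]_y2 (c * vnorm2 (gvec n (upd2 offw i s y1 y2) offa) *
    zone_inv p eta dl i (L (upd2 offw i s y1 y2)))%:E =
  (c * A)%:E * \int[gam]_y1 \int[gam]_y2 (zone_inv p eta dl i (updv (L s) i (kap * Complex y1 y2 + b s)))%:E)%E.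
  rewrite -ge0_integralZl_EFin ?mulr_ge0 //.
  - apply: eq_integral => y1 _; rewrite -ge0_integralZl_EFin; last by rewrite mulr_ge0.
    2: exact: measurableT.
    2: by [].
    2: exact: mhE.
    apply: eq_integral => y2 _; rewrite gvec_upd2_other; last exact: aw.
    by rewrite hL EFinM.
  - by move=> y1 _; apply: integral_ge0 => y2 _; exact: h0.
  - have m1 : measurable_fun setT (EFin \o (fun y : R * R => zone_inv p eta dl i (updv (L s) i (kap * Complex y.1 y.2 + b s)))).
      exact/measurable_EFinP.
    exact: (measurable_fun_fubini_tonelli_F (m2 := gam) _ m1 (fun y => h0 y.1 y.2)).
apply: le_trans (lee_pmul _ _ (lexx _) (integral_zone_inv p i (L s) (b s) d0 dl0 eta0 tau1 kap0)) _.
- by rewrite lee_fin mulr_ge0.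
- by apply: integral_ge0 => y1 _; exact: integral_ge0.
- by rewrite -!EFinM lee_fin -/K mulrAC.
Qed.

(* For [|x| <= 1] a coordinate of [v] is integrated first, for [|x| > 1] a coordinate of [u];
   the resulting bound is integrable in [x]. *)
Lemma gint_zone_density_le p (eta dl : R) (x : C) :
  (0 < d)%N -> 0 < dl -> 0 <= eta -> d%:R * eta / dl <= 1 / 2 -> good dl p ->
  (gint m (fun s => (zone_density p eta (vU s) (vV s) x)%:E) <=
   (n.+1%:R * (d%:R * (36 * (d%:R * eta / dl) ^+ 2)) * vmoment *
    (4 / ((1 + complex.Re x ^+ 2) * (1 + complex.Im x ^+ 2))))%:E)%E.
Proof.
move=> d0 dl0 eta0 tau1 gp; set tau := d%:R * eta / dl.
have M0 := vmoment_ge0.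
have b1 : (0 + 2 * n.+1 <= m)%N by rewrite add0n leq_mul2r orbT.
have b2 : (2 * n.+1 + 2 * n.+1 <= m)%N by rewrite -mulnDl.
(* A product of two Cauchy functions that dominates both 1 for |x| <= 1 and |x|^-4 for |x| > 1, and
   whose plane integral splits into two line integrals. *)
set ph := 4 / _; set K := d%:R * (36 * tau ^+ 2).
have K0 : 0 <= K by rewrite mulr_ge0 // mulr_ge0 // sqr_ge0.
have hx : cm x ^+ 2 = complex.Re x ^+ 2 + complex.Im x ^+ 2 by rewrite -cabs2E.
have r1 := sqr_ge0 (complex.Re x); have r2 := sqr_ge0 (complex.Im x).
have den0 : 0 < (1 + complex.Re x ^+ 2) * (1 + complex.Im x ^+ 2) by apply: mulr_gt0; lra.
have mlin j : cmeas (fun t : m.-tuple R => lin x (vU t) (vV t) j).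
  by apply: cmeas_lin => [k|k|]; [exact: cmeas_vU|exact: cmeas_vV|exact: cmeas_cst].
suff [c [cge0 cph hc]] : exists c : R, [/\ 0 <= c, c <= ph &
  (gint m (fun s => (zone_density p eta (vU s) (vV s) x)%:E) <= \sum_(i < n.+1) (c * K * vmoment)%:E)%E].
  apply: le_trans hc _; rewrite sumEFin sumr_const card_ord lee_fin -[leLHS]mulr_natl.
  have -> : n.+1%:R * K * vmoment * ph = n.+1%:R * (ph * (K * vmoment)) by ring.
  by apply: ler_wpM2l => //; rewrite -mulrA; apply: ler_wpM2r => //; exact: mulr_ge0.
have gsum (f : 'I_n.+1 -> seq R -> R) (c : R) : (forall i s, 0 <= f i s) ->
   (forall i, measurable_fun setT (fun t : m.-tuple R => f i t)) ->
   (forall s, zone_density p eta (vU s) (vV s) x <= \sum_i f i s) ->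
   (forall i, gint m (fun s => (f i s)%:E) <= (c * K * vmoment)%:E)%E ->
   (gint m (fun s => (zone_density p eta (vU s) (vV s) x)%:E) <= \sum_(i < n.+1) (c * K * vmoment)%:E)%E.
  move=> f0 mf hF hf.
  apply: (@le_trans _ _ (gint m (fun s => \sum_(i < n.+1) (f i s)%:E)))%E.
    apply: le_gint => s; first by rewrite lee_fin zone_density_ge0.
    by rewrite sumEFin lee_fin hF.
  rewrite gint_sum; first exact: lee_sum.
  - by move=> i s; rewrite lee_fin f0.
  - by move=> i; apply/measurable_EFinP; exact: mf.
have [x1|x1] := leP (cm x) 1.
  have x2 : cm x ^+ 2 <= 1 by rewrite expr_le1 ?cm_ge0.
  exists 1; split => //.
    rewrite /ph ler_pdivlMr // mul1r.
    have : 1 + complex.Re x ^+ 2 <= 2 by move: x2; rewrite hx; lra.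
    have : 1 + complex.Im x ^+ 2 <= 2 by move: x2; rewrite hx; lra.
    move: r1 r2; nra.
  apply: (gsum (fun i s => 1 * vnorm2 (vU s) * zone_inv p eta dl i (lin x (vU s) (vV s)))).
  - by move=> i s; rewrite !mulr_ge0 ?vnorm2_ge0 ?zone_inv_ge0.
  - move=> i; apply: measurable_funM; last exact: measurable_zone_inv.
    by apply: measurable_funM; [exact: measurable_cst|apply: measurable_vnorm2 => j; exact: cmeas_vU].
  - by move=> s; rewrite mul1r; exact: zone_density_le1.
  - move=> i.
    have := @gint_zone_inv_le p eta dl i 1 1 0 (2 * n.+1) (fun s => lin x (vU s) (vV s))
      (fun s => x * vU s i) d0 dl0 eta0 tau1 (oner_neq0 _) ler01 b1 b2.
    rewrite cm1 expr1n divr1 add0n leqnn; apply => //.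
    move=> s y1 y2; rewrite /vU /vV gvec_upd2 gvec_upd2_other; last by rewrite add0n leqnn.
    exact: updv_lin1.
have x0 : x != 0 by rewrite -cm_gt0 (lt_trans ltr01).
have c0 : 0 < cabs2 x by rewrite cabs2E exprn_gt0 // cm_gt0.
have c1 : 1 < cabs2 x by rewrite cabs2E; apply: exprn_egt1.
(* One factor |x|^-2 comes from [zone_density_le2], the other from the affine factor [kap = x] in
   [gint_zone_inv_le]. *)
exists ((cabs2 x)^-1 * (cabs2 x)^-1); split.
- by rewrite mulr_ge0 // invr_ge0 ltW.
- rewrite -invfM /ph ler_pdivlMr // mulrC ler_pdivrMr ?mulr_gt0 //.
  have e : cabs2 x = complex.Re x ^+ 2 + complex.Im x ^+ 2 by [].
  move: c1 r1 r2; rewrite e; move: (complex.Re x ^+ 2) (complex.Im x ^+ 2) => a b; clear; nra.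
apply: (gsum (fun i s => (cabs2 x)^-1 * vnorm2 (vV s) * zone_inv p eta dl i (lin x (vU s) (vV s)))).
- by move=> i s; rewrite !mulr_ge0 ?vnorm2_ge0 ?zone_inv_ge0 // invr_ge0 ltW.
- move=> i; apply: measurable_funM; last exact: measurable_zone_inv.
  by apply: measurable_funM; [exact: measurable_cst|apply: measurable_vnorm2 => j; exact: cmeas_vV].
- move=> s; apply: le_trans (@zone_density_le2 _ _ _ p eta dl (vU s) (vV s) x gp x0) _.
  by apply: ler_sum => i _; rewrite [vnorm2 _ / _]mulrC.
- move=> i; have ci : 0 <= (cabs2 x)^-1 by rewrite invr_ge0 ltW.
  have := @gint_zone_inv_le p eta dl i x _ (2 * n.+1) 0 (fun s => lin x (vU s) (vV s))
      (fun s => vV s i) d0 dl0 eta0 tau1 x0 ci b2 b1.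
  have -> : (cabs2 x)^-1 * (d%:R * (36 * (d%:R * eta / dl) ^+ 2 / cm x ^+ 2)) =
     (cabs2 x)^-1 / cabs2 x * K.
    by rewrite /K /tau -cabs2E; ring.
  rewrite add0n leqnn orbT; apply => //.
  move=> s y1 y2; rewrite /vU /vV gvec_upd2 gvec_upd2_other; last by rewrite orbC add0n leqnn.
  exact: updv_lin2.
Qed.

Definition cauchy_mass : R := fine (\int[leb]_x ((1 + x ^+ 2)^-1)%:E)%E.

Lemma cauchy_massE : (\int[leb]_x ((1 + x ^+ 2)^-1)%:E = cauchy_mass%:E)%E.
Proof.
rewrite fineK // ge0_fin_numE ?integral_cauchy_lty //.
by apply: integral_ge0 => x _; rewrite lee_fin invr_ge0 addr_ge0 // sqr_ge0.
Qed.

Lemma measurable_cauchy : measurable_fun setT (fun x : R => ((1 + x ^+ 2)^-1)%:E).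
Proof.
apply/measurable_EFinP; apply: measurable_invr => [t|]; first by rewrite addr_ge0 // sqr_ge0.
by apply: measurable_funD; [exact: measurable_cst|exact: measurable_funX].
Qed.

Lemma integral_cauchy2 (k : R) : 0 <= k ->
  (\int[leb]_x \int[leb]_y (k * (4 / ((1 + x ^+ 2) * (1 + y ^+ 2))))%:E =
   (k * 4 * cauchy_mass ^+ 2)%:E)%E.
Proof.
move=> k0.
have c0 (x : R) : 0 <= (1 + x ^+ 2)^-1 by rewrite invr_ge0 addr_ge0 // sqr_ge0.
transitivity (\int[leb]_x ((k * 4 * cauchy_mass)%:E * ((1 + x ^+ 2)^-1)%:E))%E.
  apply: eq_integral => x _.
  transitivity (\int[leb]_y ((k * 4 * (1 + x ^+ 2)^-1)%:E * ((1 + y ^+ 2)^-1)%:E))%E.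
    by apply: eq_integral => y _; rewrite -EFinM invfM; congr EFin; ring.
  rewrite ge0_integralZl_EFin //; last 3 first.
  - by move=> y _; rewrite lee_fin.
  - exact: measurable_cauchy.
  - by rewrite mulr_ge0 // mulr_ge0.
  by rewrite cauchy_massE -!EFinM; congr EFin; ring.
have cm0 : 0 <= cauchy_mass.
  by apply: fine_ge0; apply: integral_ge0 => y _; rewrite lee_fin; exact: c0.
rewrite ge0_integralZl_EFin //; last 3 first.
- by move=> y _; rewrite lee_fin.
- exact: measurable_cauchy.
- by rewrite mulr_ge0 // mulr_ge0.
by rewrite cauchy_massE -!EFinM expr2 mulrA.
Qed.

Lemma measurable_zone_density_joint p eta : measurable_fun setT (fun z : m.-tuple R * R * R =>
  (zone_density p eta (vU z.1.1) (vV z.1.1) (Complex z.1.2 z.2))%:E).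
Proof.
have m11 : measurable_fun setT (fun z : m.-tuple R * R * R => z.1.1).
  exact: (measurableT_comp measurable_fst measurable_fst).
apply/measurable_EFinP; apply: measurable_zone_density.
- by move=> i; apply: (@cmeas_comp _ _ _ _ _ (fun t : m.-tuple R => vU t i) _ _ m11); exact: cmeas_vU.
- by move=> i; apply: (@cmeas_comp _ _ _ _ _ (fun t : m.-tuple R => vV t i) _ _ m11); exact: cmeas_vV.
- split; last exact: measurable_snd.
  exact: (measurableT_comp measurable_snd measurable_fst).
Qed.

Definition line_mass p (eta : R) (s : seq R) : \bar R :=
  (\int[leb]_x \int[leb]_y (zone_density p eta (vU s) (vV s) (Complex x y))%:E)%E.

Lemma line_mass_ge0 p eta s : (0 <= line_mass p eta s)%E.
Proof.
by apply: integral_ge0 => x _; apply: integral_ge0 => y _; rewrite lee_fin zone_density_ge0.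
Qed.

Lemma measurable_line_mass_inner p eta : measurable_fun setT (fun z : m.-tuple R * R =>
  (\int[leb]_y (zone_density p eta (vU z.1) (vV z.1) (Complex z.2 y))%:E)%E).
Proof.
apply: (measurable_fun_fubini_tonelli_F (m2 := leb) _ (measurable_zone_density_joint p eta)) => z.
by rewrite lee_fin zone_density_ge0.
Qed.

Lemma gmeas_line_mass p eta : gmeas m (line_mass p eta).
Proof.
apply: (measurable_fun_fubini_tonelli_F (m2 := leb) _ (measurable_line_mass_inner p eta)) => z.
by apply: integral_ge0 => y _; rewrite lee_fin zone_density_ge0.
Qed.

(** Tonelli moves the expectation inside both area integrals, where the bound at fixed x applies.
    The result is quadratic in eta, as a Lipschitz bound for the square root of the cost
    requires. *)
Lemma small_ball p (eta dl : R) :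
  (0 < d)%N -> 0 < dl -> 0 <= eta -> d%:R * eta / dl <= 1 / 2 -> good dl p ->
  (gint m (line_mass p eta) <=
   (n.+1%:R * (d%:R * (36 * (d%:R * eta / dl) ^+ 2)) * vmoment * 4 * cauchy_mass ^+ 2)%:E)%E.
Proof.
move=> d0 dl0 eta0 tau1 gp; set K := n.+1%:R * _ * _.
have K0 : 0 <= K.
  apply: mulr_ge0 (vmoment_ge0); apply: mulr_ge0 => //; apply: mulr_ge0 => //.
  by apply: mulr_ge0 => //; exact: sqr_ge0.
have [P hP] := @gint_tuple R m.
pose F (z : m.-tuple R * R * R) : \bar R := (zone_density p eta (vU z.1.1) (vV z.1.1) (Complex z.1.2 z.2))%:E.
have F0 z : (0 <= F z)%E by rewrite lee_fin zone_density_ge0.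
have mF : measurable_fun setT F := measurable_zone_density_joint p eta.
pose G (z : m.-tuple R * R) : \bar R := (\int[leb]_y F (z, y))%E.
have G0 z : (0 <= G z)%E by exact: integral_ge0.
have mG : measurable_fun setT G := measurable_line_mass_inner p eta.
rewrite hP; [|exact: line_mass_ge0|exact: gmeas_line_mass].
have E1 : (\int[P]_t \int[leb]_x G (t, x) = \int[leb]_x \int[P]_t G (t, x))%E.
  exact: (fubini_tonelli (m1 := P) (m2 := leb) G mG G0).
rewrite E1 -(integral_cauchy2 K0).
apply: ge0_le_integral_nomeas => x _; first exact: integral_ge0.
pose Gx (z : m.-tuple R * R) : \bar R := F (z.1, x, z.2).
have mGx : measurable_fun setT Gx.
  apply: (measurableT_comp mF); apply/measurable_fun_pairP; split => /=; last exact: measurable_snd.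
  by apply/measurable_fun_pairP; split => /=; [exact: measurable_fst|exact: measurable_cst].
have E2 : (\int[P]_t G (t, x) = \int[leb]_y \int[P]_t Gx (t, y))%E.
  exact: (fubini_tonelli (m1 := P) (m2 := leb) Gx mGx (fun z => F0 _)).
rewrite E2.
apply: ge0_le_integral_nomeas => y _; first by apply: integral_ge0 => t _; exact: F0.
have := @gint_zone_density_le p eta dl (Complex x y) d0 dl0 eta0 tau1 gp; rewrite hP //.
- by move=> s; rewrite lee_fin zone_density_ge0.
- apply/measurable_EFinP; apply: measurable_zone_density; [exact: cmeas_vU|exact: cmeas_vV|exact: cmeas_cst].
Qed.

End SmallBallEstimate.

(** * Coupling of root distributions *)

Section Restriction.
Variables (R : realType) (n d : nat).
Local Notation C := (complex R).
Implicit Types (p : hpoly R n d) (u v w : cvec R n).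

Lemma restr_horner p u v x : (restr p u v).[x] = peval p (lin x u v).
Proof.
rewrite /restr horner_sum; apply: eq_bigr => a _.
rewrite hornerZ horner_prod; congr (_ * _); apply: eq_bigr => i _.
by rewrite horner_exp hornerD hornerM !hornerC hornerX ffunE mulrC.
Qed.

Lemma size_linpow (a b : C) k : (size ((a%:P * 'X + b%:P) ^+ k) <= k.+1)%N.
Proof.
apply: leq_trans (size_poly_exp_leq _ _) _; rewrite ltnS -[leqRHS]mul1n leq_mul2r.
apply/orP; right; have : (size (a%:P * 'X + b%:P)%R <= 2)%N.
  by rewrite size_MXaddC; case: ifP => // _; rewrite ltnS size_polyC leq_b1.
by case: (size _).
Qed.

Lemma coef_linpow (a b : C) k : ((a%:P * 'X + b%:P) ^+ k : {poly C})`_k = a ^+ k.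
Proof.
elim: k => [|k IH]; first by rewrite !expr0 coef1.
rewrite exprS mulrDl coefD -mulrA !coefCM coefXM /= IH nth_default ?mulr0 ?addr0 -?exprS //.
exact: size_linpow.
Qed.

Lemma size_prod_linpow u v (I : finType) (f : I -> 'I_n.+1) (a : I -> nat) (r : seq I) :
  (size (\prod_(i <- r) ((u (f i))%:P * 'X + (v (f i))%:P) ^+ a i)%R <= (\sum_(i <- r) a i).+1)%N /\
  (\prod_(i <- r) ((u (f i))%:P * 'X + (v (f i))%:P) ^+ a i : {poly C})`_(\sum_(i <- r) a i)%N
    = \prod_(i <- r) u (f i) ^+ a i.
Proof.
elim: r => [|i r [IH1 IH2]]; first by rewrite !big_nil size_poly1 coef1.
rewrite !big_cons; set A := (_ ^+ a i); set B := \prod_(_ <- _) _ in IH1 IH2 *.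
have sA : (size A <= (a i).+1)%N by exact: size_linpow.
split.
  apply: leq_trans (size_polyMleq _ _) _.
  by move: sA IH1; lia.
rewrite coefM (bigD1 (inord (a i))) //= inordK ?ltnS ?leq_addr // addKn IH2 coef_linpow.
rewrite [X in _ + X]big1 ?addr0 // => j hj.
have [ji|ij] := ltnP (a i) j.
  by rewrite nth_default ?mul0r // (leq_trans sA).
have jne : (j : nat) != a i by apply: contraNneq hj => e; apply/eqP/val_inj; rewrite /= inordK ?ltnS ?leq_addr.
rewrite [X in _ * X]nth_default ?mulr0 //; apply: leq_trans IH1 _.
by move: ij jne (ltn_ord j); lia.
Qed.

Lemma size_restr p u v : (size (restr p u v) <= d.+1)%N.
Proof.
apply: leq_trans (size_sum _ _ _) _; apply/bigmax_leqP => a _.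
apply: leq_trans (size_scale_leq _ _) _.
have [] := size_prod_linpow u v id (fun i => val a i) (index_enum 'I_n.+1).
by have /eqP -> := valP a.
Qed.

(** The coefficient of degree d is the value at the point at infinity [u] of the line; when it is
    nonzero all d roots are finite. *)
Lemma coef_restr p u v : (restr p u v)`_d = peval p u.
Proof.
rewrite /restr coef_sum; apply: eq_bigr => a _; rewrite coefZ; congr (_ * _).
have [_] := size_prod_linpow u v id (fun i => val a i) (index_enum 'I_n.+1).
by have /eqP -> := valP a.
Qed.

Lemma size_restr_eq p u v : peval p u != 0 -> size (restr p u v) = d.+1.
Proof.
move=> pu; apply/eqP; rewrite eqn_leq size_restr ltnNge; apply: contra pu => h.
by rewrite -(coef_restr p u v) nth_default.
Qed.

Lemma peval0 p : (0 < d)%N -> peval p 0 = 0.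
Proof.
move=> d0; rewrite /peval big1 // => a _; rewrite /mono.
have [i ai] : exists i, (0 < val a i)%N.
  apply: contrapT => h; have /eqP := valP a.
  rewrite big1 => [e|i _]; first by move: d0; rewrite -e.
  by apply/eqP; rewrite -leqn0 leqNgt; apply/negP => ai; apply: h; exists i.
by rewrite (bigD1 i) //= ffunE expr0n eqn0Ngt ai mul0r mulr0.
Qed.

Lemma mono_scale (a : mon n d) (c : C) w : mono a (vscale c w) = c ^+ d * mono a w.
Proof.
have /eqP e := valP a; rewrite -[X in c ^+ X]e.
rewrite /mono -prodrXr -big_split /=; apply: eq_bigr => i _.
by rewrite ffunE exprMn.
Qed.

Lemma peval_scale p (c : C) w : peval p (vscale c w) = c ^+ d * peval p w.
Proof.
rewrite /peval mulr_sumr; apply: eq_bigr => a _; rewrite mono_scale; ring.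
Qed.

Lemma cm_coord_le_vn w i : cm (w i) <= vn w.
Proof.
rewrite -(@ler_pXn2r _ 2) ?nnegrE ?cm_ge0 ?vn_ge0 // vn_sqr -cabs2E.
exact: cabs2_le_vnorm2.
Qed.

Lemma cm_mono_le (a : mon n d) w : cm (mono a w) <= vn w ^+ d.
Proof.
have /eqP e := valP a; rewrite -[X in _ <= vn w ^+ X]e.
rewrite /mono cm_prod -prodrXr; apply: ler_prod => i _.
by rewrite cm_ge0 cmX lerXn2r ?nnegrE ?cm_ge0 ?vn_ge0 // cm_coord_le_vn.
Qed.

Definition coefdist p q : R := \sum_a cm (p a - q a).

Lemma coefdist_ge0 p q : 0 <= coefdist p q.
Proof. by apply: sumr_ge0 => a _; exact: cm_ge0. Qed.

Lemma peval_lip p q w : cm (peval p w - peval q w) <= coefdist p q * vn w ^+ d.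
Proof.
rewrite /peval -sumrB; apply: le_trans (cm_sum _ _ _) _.
rewrite /coefdist mulr_suml; apply: ler_sum => a _.
by rewrite -mulrBl cmM ler_wpM2l ?cm_ge0 // cm_mono_le.
Qed.

Lemma gapxx u : gap u u = 0.
Proof.
by rewrite /gap /gram hdotxx cabs2E cm_realC ger0_norm ?vnorm2_ge0 // expr2 subrr mul0r.
Qed.

Lemma gram_eq0_line u v : u != 0 -> gram u v = 0 -> exists z, lin z u v = 0.
Proof.
move=> u0 g0; have v0 : vnorm2 u != 0 by rewrite vnorm2_eq0.
exists (- hdot v u / realC (vnorm2 u)); apply/eqP; rewrite -vnorm2_eq0 -lN2_vnorm2 //.
rewrite /wedge g0 sqrtr0 /lN2 expr0n /= addr0.
have -> : realC (vnorm2 u) * (- hdot v u / realC (vnorm2 u)) + hdot v u = 0.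
  have r0 : realC (vnorm2 u) != 0 by rewrite -cm_eq0 cm_realC normr_eq0.
  by field.
by rewrite cabs2E cm0 expr0n mul0r.
Qed.

End Restriction.

Section MatchedRoots.
Variables (R : realType) (n d : nat).
Local Notation C := (complex R).
Local Notation leb := (@lebesgue_measure R).
Implicit Types (p q : hpoly R n d) (u v w : cvec R n).

(** By [matched_ball] the disc of radius 2 D about a root displaced by D lies in the zone of level
    [match_const R d * coefdist p q]; [disc_mass] bounds its area below by D^2 / 81, and D^2 is the
    gap by [ls_gap]. *)
Lemma match_roots p q u v (ra rb : 'I_d -> C) : (0 < d)%N ->
  peval p u != 0 -> peval q u != 0 ->
  restr p u v = lead_coef (restr p u v) *: \prod_i ('X - (ra i)%:P) ->
  restr q u v = lead_coef (restr q u v) *: \prod_i ('X - (rb i)%:P) ->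
  exists sg : {perm 'I_d}, forall i,
   ((gap (val (Defs.proj (lin (ra i) u v))) (val (Defs.proj (lin (rb (sg i)) u v))))%:E <=
    81%:E * \int[leb]_x \int[leb]_y
       (zone_density p (match_const R d * coefdist p q) u v (Complex x y))%:E)%E.
Proof.
move=> d0 pu qu gp gq.
have u0 : u != 0 by apply: contraNneq pu => ->; rewrite peval0.
have u1 : 0 < vnorm2 u by rewrite vnorm2_gt0.
have F0 (r : hpoly R n d) eta : (0 <= 81%:E * \int[leb]_x \int[leb]_y (zone_density r eta u v (Complex x y))%:E)%E.
  by rewrite mule_ge0 //; apply: integral_ge0 => x _; apply: integral_ge0 => y _; rewrite lee_fin zone_density_ge0.
have [w0|w0] := eqVneq (wedge u v) 0.
  (* When u and v are dependent, every root of either restriction is the parameter at which x u + v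
     vanishes, so all the root points are the default point and any permutation serves. *)
  exists 1%g => i; rewrite perm1.
  have [z0 hz0] : exists z, lin z u v = 0.
    by apply: gram_eq0_line => //; rewrite -wedge_sqr w0 expr0n.
  have lin0 (r : hpoly R n d) x : peval r u != 0 -> root (restr r u v) x -> lin x u v = 0.
    move=> ru; rewrite /root restr_horner.
    have -> : lin x u v = vscale (x - z0) u.
      apply/ffunP => j; have /ffunP/(_ j) := hz0; rewrite !ffunE => e.
      by rewrite mulrBl -[RHS]addr0 -e; ring.
    rewrite peval_scale mulf_eq0 (negPf ru) orbF expf_eq0 d0 /= => /eqP ->.
    by apply/ffunP => j; rewrite !ffunE mul0r.
  rewrite (lin0 p (ra i)) //; last first.
    by rewrite gp rootZ ?lead_coef_eq0 -?size_poly_eq0 ?size_restr_eq // (bigD1 i) //= rootM root_XsubC eqxx.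
  rewrite (lin0 q (rb i)) //; last first.
    by rewrite gq rootZ ?lead_coef_eq0 -?size_poly_eq0 ?size_restr_eq // (bigD1 i) //= rootM root_XsubC eqxx.
  by rewrite gapxx F0.
have w1 : 0 < wedge u v by rewrite lt_def w0 sqrtr_ge0.
have lNE z : lN (vnorm2 u) (wedge u v) (hdot v u) z = vn (lin z u v).
  by rewrite /lN lN2_vnorm2 // gt_eqF.
have hd z : cm ((restr q u v).[z] - (restr p u v).[z]) <=
    coefdist p q * lN (vnorm2 u) (wedge u v) (hdot v u) z ^+ d.
  by rewrite !restr_horner lNE -cmN opprB peval_lip.
have [sg hsg] := matched_ball u1 w1 d0 (size_restr_eq v pu) (size_restr_eq v qu) gp gq
   (coefdist_ge0 p q) hd.
exists sg => i.
have lin_neq0 z : lin z u v != 0.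
  apply: contraNneq w0 => e; rewrite -sqrf_eq0 wedge_sqr -(gram_linl z) e.
  rewrite eq_le gram_ge0 andbT; apply: le_trans (gram_le _ _) _.
  have /eqP -> : vnorm2 (0 : cvec R n) == 0 by rewrite vnorm2_eq0.
  by rewrite mul0r.
rewrite gap_proj // -ls_gap //; set D := ls _ _ _ _ _.
have D0 : 0 <= D by exact: ls_ge0.
move: D0; rewrite le_eqVlt => /orP[/eqP <-|D0]; first by rewrite expr0n /= F0.
have D1 : D <= 1 by exact: ls_le1.
have := @disc_mass R (vnorm2 u) (wedge u v) (hdot v u) u1 w1
   (fun z => zone p (match_const R d * coefdist p q) (lin z u v)) (ra i) D.
rewrite D0 D1 => /(_ erefl) h.
have {h} : ((D ^+ 2 / 81)%:E <= \int[leb]_x \int[leb]_y (line_weight (vnorm2 u) (wedge u v) (hdot v u) (fun z : C => zone p (match_const R d * coefdist p q) (lin z u v)) (Complex x y))%:E)%E.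
  apply: h => z hz; rewrite /zone -restr_horner -lNE; exact: (hsg i D0 z hz).
under eq_integral => x _.
  under eq_integral => y _ do rewrite /line_weight wedge_sqr lN2_vnorm2 ?gt_eqF // -/(zone_density _ _ _ _ _).
  over.
move=> h; have : (81%:E * (D ^+ 2 / 81)%:E <= 81%:E * \int[leb]_x \int[leb]_y (zone_density p (match_const R d * coefdist p q) u v (Complex x y))%:E)%E.
  by apply: lee_wpmul2l h; rewrite lee_fin.
by rewrite -EFinM mulrC divfK.
Qed.

End MatchedRoots.

Section FiniteMinimum.
Variables (dsp : measure_display) (T : measurableType dsp) (R : realType).

Lemma measurable_all (S : Type) (r : seq S) (b : S -> T -> bool) :
  (forall s, measurable_fun setT (b s)) ->
  measurable_fun setT (fun t => all (fun s => b s t) r).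
Proof.
move=> mb; elim: r => [|s r IH] /=; first exact: measurable_cst.
exact: measurable_and.
Qed.

Lemma measurable_finite_data (S : finType) (b : S -> T -> bool) (h : {ffun S -> bool} -> bool) :
  (forall s, measurable_fun setT (b s)) ->
  measurable_fun setT (fun t => h [ffun s => b s t]).
Proof.
move=> mb; apply: mset_bool.
have -> : [set t | h [ffun s => b s t]] = \bigcup_(f in [set f | h f])
   [set t | all (fun s => if f s then b s t else ~~ b s t) (enum S)].
  apply/seteqP; split => t /=.
    move=> ht; exists [ffun s => b s t] => //=; apply/allP => s _.
    by rewrite ffunE; case: (b s t).
  move=> [f hf ft]; rewrite (_ : [ffun s => b s t] = f) //.
  apply/ffunP => s; rewrite ffunE; have /= := allP ft s; rewrite mem_enum => /(_ isT).
  by case: (f s) => [->//|/negbTE].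
apply: fin_bigcup_measurable; first exact: finite_finset.
move=> f _; apply: mset; apply: measurable_all => s.
by case: (f s) => //; exact: measurable_neg.
Qed.

(* A minimizer chosen as a function of the finite table of all comparisons, hence
   measurably. *)
Lemma measurable_argmin (S : finType) (s0 : S) (c : S -> T -> R) :
  (forall s, measurable_fun setT (c s)) ->
  exists sel : T -> S, (forall s t, c (sel t) t <= c s t) /\
    (forall Q : S -> bool, measurable_fun setT (fun t => Q (sel t))).
Proof.
move=> mc; pose b (ss : S * S) t := c ss.1 t <= c ss.2 t.
pose g (f : {ffun S * S -> bool}) := odflt s0 [pick s | [forall s', f (s, s')]].
exists (fun t => g [ffun ss => b ss t]); split; last first.
  move=> Q; apply: (@measurable_finite_data _ b (fun f => Q (g f))) => ss.
  exact: measurable_fun_ler.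
move=> s t; rewrite /g; case: pickP => [s1 /forallP h|h] /=.
  by have := h s; rewrite ffunE.
have [s1 _ hs1] := @arg_minP _ R S s0 xpredT (c ^~ t) isT.
by have /forallP[] := h s1 => s'; rewrite ffunE; exact: hs1.
Qed.

End FiniteMinimum.

Section Mixture.
Variables (R : realType) (d1 d2 : measure_display) (T : measurableType d1) (X : measurableType d2).
Variable P : probability T R.

Variables (d : nat) (Phi : nat -> {mfun T >-> X}).
Hypothesis d0 : (0 < d)%N.

Lemma mixture_weight_ge0 : 0 <= d%:R^-1 :> R. Proof. by rewrite invr_ge0. Qed.

Definition mixture_weight : {nonneg R} := NngNum mixture_weight_ge0.

(** The law of [Phi i] when the index i < d is uniform and independent of the argument distributed
    by [P]. *)
Definition mixture : set X -> \bar R :=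
  mscale mixture_weight (msum (fun i => distribution P (Phi i)) d).

HB.instance Definition _ := Measure.on mixture.

Lemma mixture_setT : mixture setT = 1%E.
Proof.
rewrite /mixture /mscale /= /msum.
rewrite (eq_bigr (fun=> 1%:E)) => [|i _]; last exact: probability_setT.
rewrite sumEFin sumr_const card_ord -EFinM mulVf // pnatr_eq0 -lt0n //.
Qed.

HB.instance Definition _ := Measure_isProbability.Build _ _ _ mixture mixture_setT.

Definition mixture_prob : probability X R := mixture.

Lemma integral_mixture (f : X -> \bar R) : (forall x, 0 <= f x)%E -> measurable_fun setT f ->
  (\int[mixture_prob]_x f x = (d%:R^-1)%:E * \int[P]_t \sum_(i < d) f (Phi i t))%E.
Proof.
move=> f0 mf; rewrite ge0_integral_mscale // ge0_integral_measure_sum // ge0_integral_sum //.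
  congr (_ * _)%E; apply: eq_bigr => i _; exact: ge0_integral_pushforward.
by move=> i; exact: measurableT_comp.
Qed.

End Mixture.

(** * The law of the roots on a random line *)

Section RootLaw.
Variables (R : realType) (n d : nat).
Local Notation C := (complex R).
Local Notation gam := (@normal_prob R 0 1).
Local Notation m := (4 * n.+1)%N.
Implicit Types (p : hpoly R n d).

Lemma pmeas_restr p : pmeas (fun t : m.-tuple R => restr p (vU n t) (vV n t)).
Proof.
apply: pmeas_sum => a; apply: pmeasZ; first exact: cmeas_cst.
apply: pmeas_prod => i; apply: pmeasX; apply: pmeasD; last exact/pmeas_C/cmeas_vV.
by apply: pmeasM; [exact/pmeas_C/cmeas_vU|exact: pmeas_cst].
Qed.

(** Indices beyond the degree of the restriction are sent to u, which reproduces the d - deg copies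
    of the point at infinity in [line_sum]. *)
Lemma root_points p : exists (x : nat -> m.-tuple R -> C) (z : nat -> m.-tuple R -> cvec R n),
  [/\ forall i j, cmeas (fun t => z i t j),
    forall (t : m.-tuple R) (f : CP R n -> R), restr p (vU n t) (vV n t) != 0 ->
      line_sum p (vU n t) (vV n t) (fun y => (f y)%:E) =
       (\sum_(i < d) f (Defs.proj (z i t)))%:E &
    forall t : m.-tuple R, peval p (vU n t) != 0 ->
      restr p (vU n t) (vV n t) =
       lead_coef (restr p (vU n t) (vV n t)) *: \prod_(i < d) ('X - (x i t)%:P) /\
      forall i, (i < d)%N -> z i t = lin (x i t) (vU n t) (vV n t)].
Proof.
pose G (t : m.-tuple R) := restr p (vU n t) (vV n t).
have [x mx hx] := root_list_selection (pmeas_restr p) (fun t : m.-tuple R => size_restr p (vU n t) (vV n t)).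
exists x, (fun i t => if (i < (size (G t)).-1)%N then lin (x i t) (vU n t) (vV n t) else vU n t).
split.
- move=> i j; apply: (@cmeas_ext _ _ _ (fun t => if (i < (size (G t)).-1)%N
     then lin (x i t) (vU n t) (vV n t) j else vU n t j)) => [t|]; first by case: ifP.
  apply: cmeas_if; last exact: cmeas_vU; last first.
    by apply: cmeas_lin => // k; [exact: cmeas_vU|exact: cmeas_vV].
  have -> : (fun t => (i < (size (G t)).-1)%N) = (fun t => ~~ (size (G t) <= i.+1)%N).
    by apply/funext => t; rewrite -ltnNge; case: (size (G t)).
  by apply: measurable_neg; exact: (pmeas_size_leq _ (pmeas_restr p)).
- move=> t f g0; rewrite /line_sum (negPf g0) sumEFin.
  set rs := sval _; have hrs : restr p (vU n t) (vV n t) = lead_coef (restr p (vU n t) (vV n t)) *: \prod_(z <- rs) ('X - z%:P).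
    exact: (svalP (closed_field_poly_normal (restr p (vU n t) (vV n t)))).
  set k := (size (restr p (vU n t) (vV n t))).-1.
  have kd : (k <= d)%N by have := size_restr p (vU n t) (vV n t); rewrite /k; case: (size _).
  (* [line_sum] uses a list of roots in an unspecified order; two factorizations of the same
     polynomial into monic linear factors differ by a permutation. *)
  have pe : perm_eq rs [seq x i t | i : 'I_k].
    apply: prod_XsubC_eq; rewrite big_map /=.
    apply: (@scalerI _ _ (lead_coef (restr p (vU n t) (vV n t)))); first by rewrite lead_coef_eq0.
    by rewrite -hrs [LHS]hx big_enum.
  rewrite (perm_big _ pe) big_map /= big_enum /= -EFinM -EFinD; congr EFin.
  rewrite -(big_mkord xpredT (fun i => f (Defs.proj (if (i < k)%N then lin (x i t) (vU n t) (vV n t) else vU n t)))).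
  rewrite (big_cat_nat _ (n := k)) //=; congr (_ + _).
    by rewrite big_mkord; apply: eq_bigr => i _; rewrite ltn_ord.
  rewrite (eq_big_nat _ _ (F2 := fun=> f (Defs.proj (vU n t)))).
    by rewrite sumr_const_nat mulr_natl.
  by move=> i /andP[ki _]; rewrite ltnNge ki.
- move=> t pu; have sz : (size (G t)).-1 = d by rewrite /G size_restr_eq.
  split; last by move=> i id; rewrite sz id.
  by rewrite [LHS]hx /= -/(G t) sz.
Qed.

(** At level eta = 0 the bound of [gint_zone_inv_le] is 0, so the zeros of a good polynomial form a
    Gaussian null set. *)
Lemma ae_peval_neq0 (P : probability (m.-tuple R) R) p dl : (0 < d)%N -> 0 < dl -> good dl p ->
  (forall f : seq R -> \bar R, (forall s, (0 <= f s)%E) -> gmeas m f ->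
    gint m f = (\int[P]_t f t)%E) ->
  {ae P, forall t : m.-tuple R, peval p (vU n t) != 0}.
Proof.
move=> d0 dl0 gp hP.
have b1 : (0 + 2 * n.+1 <= m)%N by rewrite add0n leq_mul2r orbT.
have b2 : (2 * n.+1 + 2 * n.+1 <= m)%N by rewrite -mulnDl.
have aezero (f : seq R -> R) : (forall s, 0 <= f s) ->
    measurable_fun setT (fun t : m.-tuple R => f t) ->
    (gint m (fun s => (f s)%:E) <= 0)%E -> {ae P, forall t : m.-tuple R, f t = 0}.
  move=> f0 mf hf; have mfE : measurable_fun setT (fun t : m.-tuple R => (f t)%:E) by exact/measurable_EFinP.
  have : (\int[P]_t `|(f t)%:E| = 0)%E.
    under eq_integral => t _ do rewrite gee0_abs ?lee_fin //.
    by apply/eqP; rewrite eq_le; apply/andP; split;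
      [rewrite -(hP (fun s => (f s)%:E)) // => s; rewrite lee_fin|apply: integral_ge0 => t _; rewrite lee_fin].
  move=> /(ae_eq_integral_abs P measurableT mfE); apply: filterS => t /(_ I) /= e.
  by apply/eqP; rewrite -eqe e.
have aenth k : (k < m)%N -> {ae P, forall t : m.-tuple R, (nth 0 t k == 0)%:R = 0 :> R}.
  move=> km; apply: (aezero (fun s => (nth 0 s k == 0)%:R)) => //.
    have -> : (fun t : m.-tuple R => (nth 0 t k == 0)%:R : R) = (fun t => if nth 0 t k == 0 then 1 else 0).
      by apply/funext => t; case: eqP.
    apply: measurable_fun_ifT; try exact: measurable_cst.
    have -> : (fun t : m.-tuple R => nth 0 t k == 0) = (fun t => (nth 0 t k <= 0) && (0 <= nth 0 t k)).
      by apply/funext => t; rewrite -eq_le.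
    apply: measurable_and; apply: measurable_fun_ler; (try exact: measurable_cst); exact: measurable_nth.
  rewrite (gint_resample km) //; last first.
    apply/measurable_EFinP.
    have -> : (fun t : m.-tuple R => (nth 0 t k == 0)%:R : R) = (fun t => if nth 0 t k == 0 then 1 else 0).
      by apply/funext => t; case: eqP.
    apply: measurable_fun_ifT; try exact: measurable_cst.
    have -> : (fun t : m.-tuple R => nth 0 t k == 0) = (fun t => (nth 0 t k <= 0) && (0 <= nth 0 t k)).
      by apply/funext => t; rewrite -eq_le.
    apply: measurable_and; apply: measurable_fun_ler; (try exact: measurable_cst); exact: measurable_nth.
  rewrite (_ : (fun s => _) = fun=> 0%E) ?gint_cst //; apply/funext => s.
  transitivity (\int[gam]_y (\1_(`[0, 0 + 0]%classic : set R) y)%:E)%E.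
    apply: eq_integral => y _; rewrite nth_set_nth /= eqxx addr0 indicE.
    have -> // : (y \in `[0, 0]%classic) = (y == 0).
    by apply/idP/idP; rewrite inE /= in_itv /= -eq_le eq_sym.
  rewrite integral_indic //= setIT; apply/eqP; rewrite eq_le measure_ge0 andbT.
  by have := @normal_itv_le R 0 (0 + 0); rewrite addr0 subrr; apply.
(* Its integral vanishes, and it is positive wherever p vanishes at u with u and v nonzero; u = 0
   has to be excluded because the inverse of its norm is 0. *)
pose f (s : seq R) : R := \sum_i 1 * vnorm2 (vV n s) * zone_inv p 0 dl i (vU n s).
have term0 i s : 0 <= 1 * vnorm2 (vV n s) * zone_inv p 0 dl i (vU n s).
  by rewrite !mulr_ge0 ?vnorm2_ge0 ?zone_inv_ge0.
have mterm i : measurable_fun setT (fun t : m.-tuple R => 1 * vnorm2 (vV n t) * zone_inv p 0 dl i (vU n t)).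
  apply: measurable_funM; last by apply: measurable_zone_inv => j; exact: cmeas_vU.
  by apply: measurable_funM; [exact: measurable_cst|apply: measurable_vnorm2 => j; exact: cmeas_vV].
have f0 : {ae P, forall t : m.-tuple R, f t = 0}.
  apply: aezero; first by move=> s; apply: sumr_ge0.
    by apply: measurable_sum => i; exact: mterm.
  under eq_fun do rewrite /f -sumEFin.
  rewrite gint_sum; last 2 first.
  - by move=> i s; rewrite lee_fin.
  - by move=> i; apply/measurable_EFinP; exact: mterm.
  have s0 : (\sum_(i < n.+1) 0 = 0 :> \bar R)%E by rewrite big1.
  rewrite -[leRHS]s0; apply: lee_sum => i _.
  have tau1 : d%:R * 0 / dl <= 1 / 2 :> R by rewrite mulr0 mul0r divr_ge0.
  have := @gint_zone_inv_le R n d p 0 dl i 1 1 (2 * n.+1) 0 (fun s => vU n s) (fun=> 0)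
    d0 dl0 (lexx 0) tau1 (oner_neq0 _) ler01 b2 b1.
  rewrite mulr0 mul0r expr0n /= mulr0 mul0r mulr0 mulr0 mul0r ?add0n ?leqnn ?orbT; apply => //.
    by move=> j; exact: cmeas_vU.
  by move=> s y1 y2; rewrite mul1r addr0 /vU gvec_upd2.
have k1 : (0 < m)%N by [].
have k2 : (2 * n.+1 < m)%N by rewrite ltn_mul2r.
move: (aenth _ k1) (aenth _ k2) f0; apply: filterS3 => t U0 V0 ft.
have {}U0 : nth 0 t 0 != 0 by move: U0; case: eqP => // _ /eqP; rewrite oner_eq0.
have {}V0 : nth 0 t (2 * n.+1) != 0 by move: V0; case: eqP => // _ /eqP; rewrite oner_eq0.
have gv off : nth 0 t off != 0 -> gvec n t off != 0.
  apply: contraNneq => /ffunP/(_ ord0); rewrite !ffunE muln0 addn0 => e.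
  by move/(congr1 (@complex.Re R)): e => /= ->.
have vv : 0 < vnorm2 (vV n t) by rewrite vnorm2_gt0 gv.
have vu : 0 < vnorm2 (vU n t) by rewrite vnorm2_gt0 gv.
apply/negP => /eqP pu; have [i hi] := gp (vU n t).
have : 1 * vnorm2 (vV n t) * zone_inv p 0 dl i (vU n t) <= 0.
  rewrite -[leRHS]ft /f (bigD1 i) //= lerDl; apply: sumr_ge0 => j _; exact: term0.
rewrite /zone_inv /zone_dir /zone pu cm0 mul0r lexx hi /= mul1r leNgt.
by rewrite divr_gt0.
Qed.

End RootLaw.

Section CouplingBound.
Variables (R : realType) (n d : nat).
Local Notation m := (4 * n.+1)%N.
Implicit Types (p q : hpoly R n d).

Lemma esqrt_ge0 (x : \bar R) : (0 <= esqrt x)%E.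
Proof. by case: x => [r| |] //=; rewrite lee_fin sqrtr_ge0. Qed.

Lemma esqrt_le (x : \bar R) (c : R) : 0 <= c -> (x <= (c ^+ 2)%:E)%E -> (esqrt x <= c%:E)%E.
Proof.
move=> c0; case: x => [r| |] //=; rewrite ?lee_fin //.
by move=> h; rewrite -[leRHS](ger0_norm c0) -sqrtr_sqr; exact: ler_wsqrtr.
Qed.

Lemma esqrt_mono (x y : \bar R) : (x <= y)%E -> (esqrt x <= esqrt y)%E.
Proof.
case: x => [r| |]; case: y => [s| |] //=; rewrite ?leey ?leNye ?lee_fin ?sqrtr_ge0 //.
exact: ler_wsqrtr.
Qed.

Lemma W2_le_coupling (mu nu : set (CP R n) -> \bar R) (pi : probability (CP R n * CP R n)%type R)
    (c : R) : is_coupling mu nu pi -> 0 <= c ->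
  (\int[pi]_zz ((fs_dist (val zz.1) (val zz.2)) ^+ 2)%:E <= (c ^+ 2)%:E)%E ->
  (W2 mu nu <= c%:E)%E.
Proof.
move=> hpi c0 hc; apply: esqrt_le => //.
by apply: le_trans hc; apply: ereal_inf_lbound; exists pi.
Qed.

Lemma gap_le1 (y z : CP R n) : gap (val y) (val z) <= 1.
Proof. by rewrite gap_unit ?val_unit // lerBlDr lerDl cabs2_ge0. Qed.

Variable P : probability (m.-tuple R) R.
Hypothesis hP : forall f : seq R -> \bar R, (forall s, (0 <= f s)%E) -> gmeas m f ->
    gint m f = (\int[P]_t f t)%E.

Lemma muP_root_law p (z : nat -> m.-tuple R -> cvec R n) (A : set (CP R n)) :
  (forall i j, cmeas (fun t => z i t j)) ->
  (forall (t : m.-tuple R) (f : CP R n -> R), restr p (vU n t) (vV n t) != 0 ->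
      line_sum p (vU n t) (vV n t) (fun y => (f y)%:E) =
       (\sum_(i < d) f (Defs.proj (z i t)))%:E) ->
  {ae P, forall t : m.-tuple R, peval p (vU n t) != 0} -> measurable A ->
  muP p A = ((d%:R^-1)%:E * \int[P]_t \sum_(i < d) (\1_A (Defs.proj (z i t) : CP R n))%:E)%E.
Proof.
move=> mz hz ae mA; rewrite /muP; congr (_ * _)%E.
have mS : measurable_fun setT (fun t : m.-tuple R => \sum_(i < d) (\1_A (Defs.proj (z i t) : CP R n) : R)).
  apply: measurable_sum => i.
  apply: (measurableT_comp (f := \1_A : CP R n -> R)); first exact: measurable_indic.
  by apply: measurable_proj => j; exact: mz.
have mL : measurable_fun setT (fun t : m.-tuple R => line_sum p (vU n t) (vV n t) (fun y => (\1_A y)%:E)).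
  have -> : (fun t : m.-tuple R => line_sum p (vU n t) (vV n t) (fun y => (\1_A y)%:E)) =
    (fun t => if size (restr p (vU n t) (vV n t)) == 0%N then 0%E
       else (\sum_(i < d) (\1_A (Defs.proj (z i t) : CP R n) : R))%:E).
    apply/funext => t; rewrite size_poly_eq0; have [e|e] := eqVneq (restr p (vU n t) (vV n t)) 0.
      by rewrite /line_sum e eqxx.
    by rewrite (hz t (\1_A)).
  apply: measurable_fun_ifT; first exact: (pmeas_size_eq _ (pmeas_restr p)).
    exact: measurable_cst.
  exact/measurable_EFinP.
rewrite hP //; last first.
  move=> s; rewrite /line_sum; case: ifP => // _.
  rewrite adde_ge0 ?mule_ge0 ?sume_ge0 // => *; by rewrite lee_fin indic01.
apply: ge0_ae_eq_integral => //.
- by under eq_fun do rewrite sumEFin; exact/measurable_EFinP.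
- move=> t _; rewrite /line_sum; case: ifP => // _.
  rewrite adde_ge0 ?mule_ge0 ?sume_ge0 // => *; by rewrite lee_fin indic01.
- by move=> t _; apply: sume_ge0 => *; rewrite lee_fin indic01.
apply: filterS ae => t pu _; rewrite sumEFin -hz //.
by rewrite -size_poly_eq0 size_restr_eq.
Qed.

(** The permutation given by [match_roots] is merely known to exist, line by line. The coupling
    therefore uses a measurable minimizer of the total gap, which costs at most as much as any
    permutation; reindexing by it preserves the second marginal. *)
Lemma coupling_exists p q (z z' : nat -> m.-tuple R -> cvec R n) : (0 < d)%N ->
  (forall i j, cmeas (fun t => z i t j)) -> (forall i j, cmeas (fun t => z' i t j)) ->
  (forall A, measurable A -> muP p A =
    ((d%:R^-1)%:E * \int[P]_t \sum_(i < d) (\1_A (Defs.proj (z i t) : CP R n))%:E)%E) ->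
  (forall A, measurable A -> muP q A =
    ((d%:R^-1)%:E * \int[P]_t \sum_(i < d) (\1_A (Defs.proj (z' i t) : CP R n))%:E)%E) ->
  exists (pi : probability (CP R n * CP R n)%type R) (cost : m.-tuple R -> R),
  [/\ is_coupling (muP p) (muP q) pi, measurable_fun setT cost,
    forall t, 0 <= cost t <= d%:R,
    forall t (sg : {perm 'I_d}), cost t <=
      \sum_(i < d) gap (val (Defs.proj (z i t))) (val (Defs.proj (z' (sg i) t))) &
    (\int[pi]_zz ((fs_dist (val zz.1) (val zz.2)) ^+ 2)%:E <=
      (20 / d%:R)%:E * \int[P]_t (cost t)%:E)%E].
Proof.
move=> d0 mz mz' hp hq.
have mpr i : measurable_fun setT (fun t => Defs.proj (z i t) : CP R n) by exact: measurable_proj.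
have mpr' i : measurable_fun setT (fun t => Defs.proj (z' i t) : CP R n) by exact: measurable_proj.
pose c (sg : {perm 'I_d}) (t : m.-tuple R) : R :=
  \sum_(i < d) gap (val (Defs.proj (z i t))) (val (Defs.proj (z' (sg i) t))).
have mc sg : measurable_fun setT (c sg).
  apply: measurable_sum => i.
  apply: (measurableT_comp (@measurable_gap R n) (g := fun t => (Defs.proj (z i t) : CP R n, Defs.proj (z' (sg i) t) : CP R n))).
  by apply/measurable_fun_pairP; split; [exact: mpr|exact: mpr'].
have [sel [hsel msel]] := measurable_argmin (1%g : {perm 'I_d}) mc.
pose y (i : nat) (t : m.-tuple R) : cvec R n :=
  oapp (fun k : 'I_d => z' (sel t k) t) 0 (insub i).
have yE (i : 'I_d) t : y i t = z' (sel t i) t by rewrite /y valK.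
have my i j : cmeas (fun t => y i t j).
  rewrite /y; case: (insub i) => [k|] /=; last exact: cmeas_cst.
  apply: (@cmeas_ext _ _ _ (fun t => \sum_(l < d) if sel t k == l then z' l t j else 0)) => [t|].
    rewrite (bigD1 (sel t k)) //= eqxx big1 ?addr0 // => l; rewrite eq_sym => /negbTE -> //.
  apply: cmeas_sum => l; apply: cmeas_if; [exact: (msel (fun s => s k == l))|exact: mz'|exact: cmeas_cst].
have mPhi i : measurable_fun setT (fun t => (Defs.proj (z i t) : CP R n, Defs.proj (y i t) : CP R n)).
  by apply/measurable_fun_pairP; split; [exact: mpr|exact: measurable_proj].
pose Phi i : {mfun (m.-tuple R) >-> (CP R n * CP R n)%type} := mfun_Sub (mem_set (mPhi i)).
have PhiE i t : Phi i t = (Defs.proj (z i t) : CP R n, Defs.proj (y i t) : CP R n) by [].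
pose pi : probability (CP R n * CP R n)%type R := mixture_prob P Phi d0.
have pi_int (f : CP R n * CP R n -> \bar R) : (forall x, 0 <= f x)%E -> measurable_fun setT f ->
    (\int[pi]_x f x = (d%:R^-1)%:E * \int[P]_t \sum_(i < d) f (Phi i t))%E.
  exact: integral_mixture.
have piE (B : set (CP R n * CP R n)) : measurable B -> pi B =
    ((d%:R^-1)%:E * \int[P]_t \sum_(i < d) (\1_B (Phi i t))%:E)%E.
  move=> mB; rewrite -(pi_int (fun x => (\1_B x)%:E)).
  - by rewrite integral_indic //= setIT.
  - by move=> x; rewrite lee_fin indic01.
  - by apply/measurable_EFinP; apply: measurable_indic.
have mgapf : measurable_fun setT (fun zz : (CP R n * CP R n)%type => (gap (val zz.1) (val zz.2))%:E).
  by apply/measurable_EFinP; exact: (@measurable_gap R n).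
exists pi, (fun t => c (sel t) t); split => //.
- split => [A mA|B mB].
    have -> := piE _ (measurableX mA measurableT).
    rewrite hp //; congr (_ * _)%E; apply: eq_integral => t _; apply: eq_bigr => i _.
    by rewrite !indicE in_setX in_setT andbT.
  have -> := piE _ (measurableX measurableT mB).
  rewrite hq //; congr (_ * _)%E; apply: eq_integral => t _.
  rewrite [RHS](reindex_inj (@perm_inj _ (sel t))) /=; apply: eq_bigr => i _.
  by rewrite !indicE in_setX in_setT /= -(yE i t).
- have -> : (fun t => c (sel t) t) = (fun t => \sum_(sg : {perm 'I_d}) if sel t == sg then c sg t else 0).
    apply/funext => t; rewrite (bigD1 (sel t)) //= eqxx big1 ?addr0 // => l.
    by rewrite eq_sym => /negbTE ->.
  apply: measurable_sum => sg; apply: measurable_fun_ifT; last exact: measurable_cst.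
    exact: (msel (fun s => s == sg)).
  exact: mc.
- move=> t; apply/andP; split; first by apply: sumr_ge0 => i _; exact: gap_ge0.
  have -> : d%:R = \sum_(i < d) (1 : R) by rewrite sumr_const card_ord.
  by apply: ler_sum => i _; exact: gap_le1.
- by move=> t sg; exact: hsel.
- apply: (@le_trans _ _ (\int[pi]_zz (20%:E * (gap (val zz.1) (val zz.2))%:E)))%E.
    apply: ge0_le_integral_nomeas => zz _; rewrite lee_fin ?sqr_ge0 //.
    by rewrite fs_dist_sqr_le ?val_unit.
  rewrite ge0_integralZl_EFin //; last by move=> zz _; rewrite lee_fin gap_ge0.
  rewrite pi_int //; last by move=> zz; rewrite lee_fin gap_ge0.
  rewrite muleA -EFinM; apply: lee_wpmul2l; first by rewrite lee_fin divr_ge0.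
  apply: ge0_le_integral_nomeas => t _; first by apply: sume_ge0 => i _; rewrite lee_fin gap_ge0.
  by rewrite sumEFin lee_fin; apply: ler_sum => i _; rewrite /= yE.
Qed.

End CouplingBound.

Section LipschitzRootLaw.
Variables (R : realType) (n d : nat).
Local Notation leb := (@lebesgue_measure R).
Local Notation m := (4 * n.+1)%N.
Implicit Types (p q : hpoly R n d).

Lemma W2_muP_lip (dl : R) : (0 < d)%N -> 0 < dl -> exists2 L : R, 0 <= L &
  forall p q, good dl p -> good dl q -> (W2 (muP p) (muP q) <= (L * coefdist p q)%:E)%E.
Proof.
move=> d0 dl0.
pose A : R := n.+1%:R * (d%:R * 36) * vmoment R n * 4 * cauchy_mass R ^+ 2.
have A0 : 0 <= A.
  apply: mulr_ge0 (sqr_ge0 _); apply: mulr_ge0 => //; apply: mulr_ge0 (vmoment_ge0 R n).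
  by apply: mulr_ge0 => //; apply: mulr_ge0.
(* For tau <= 1/2 the cost is at most 20 * 81 * A * tau^2 = 1620 A tau^2. For tau > 1/2 the trivial
   bound 20 on the cost is at most 80 tau^2. Their sum covers both regimes. *)
pose K : R := 1620 * A + 80.
have K0 : 0 <= K by rewrite /K; move: A0; lra.
have mc0 := match_const_ge0 R d.
exists (Num.sqrt K * (d%:R * match_const R d / dl)).
  by apply: mulr_ge0 (sqrtr_ge0 _) _; rewrite divr_ge0 ?(ltW dl0) // mulr_ge0.
move=> p q gp gq.
have [P hP] := @gint_tuple R m.
have [x [z [mz hz hx]]] := root_points p; have [x' [z' [mz' hz' hx']]] := root_points q.
have aep := ae_peval_neq0 d0 dl0 gp hP; have aeq := ae_peval_neq0 d0 dl0 gq hP.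
have [pi [cost [hpi mcost cost0 hcost hint]]] := coupling_exists d0 mz mz'
  (fun B mB => muP_root_law hP mz hz aep mB) (fun B mB => muP_root_law hP mz' hz' aeq mB).
set dlt := coefdist p q; have dlt0 : 0 <= dlt by exact: coefdist_ge0.
set eta := match_const R d * dlt; have eta0 : 0 <= eta by rewrite mulr_ge0.
set tau := d%:R * eta / dl.
have tau0 : 0 <= tau by rewrite divr_ge0 ?(ltW dl0) // mulr_ge0.
have -> : Num.sqrt K * (d%:R * match_const R d / dl) * dlt = Num.sqrt K * tau.
  by rewrite /tau /eta; ring.
apply: (W2_le_coupling hpi); first by rewrite mulr_ge0 ?sqrtr_ge0.
apply: le_trans hint _; rewrite exprMn [Num.sqrt K ^+ 2]sqr_sqrtr //.
have dR : 0 < d%:R :> R by rewrite ltr0n.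
have mcostE : measurable_fun setT (fun t => (cost t)%:E) by exact/measurable_EFinP.
have [tau1|tau1] := leP tau (1 / 2).
  have hc : (\int[P]_t (cost t)%:E <= \int[P]_t ((d%:R * 81)%:E * line_mass p eta t))%E.
    apply: ae_ge0_le_integral => //.
    - by move=> t _; rewrite lee_fin; have /andP[] := cost0 t.
    - by move=> t _; rewrite mule_ge0 ?line_mass_ge0 // lee_fin mulr_ge0.
    - by apply: measurable_funeM; exact: gmeas_line_mass.
    move: aep aeq; apply: filterS2 => t pu qu _.
    have [gpt zt] := hx t pu; have [gqt zt'] := hx' t qu.
    have [sg hsg] := @match_roots _ _ _ p q (vU n t) (vV n t) (fun i => x i t) (fun i => x' i t)
      d0 pu qu gpt gqt.
    apply: (@le_trans _ _ (\sum_(i < d) (81%:E * line_mass p eta t)))%E.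
      apply: (@le_trans _ _ (\sum_(i < d) gap (val (Defs.proj (z i t))) (val (Defs.proj (z' (sg i) t))))%:E).
        by rewrite lee_fin; exact: hcost.
      rewrite -sumEFin; apply: lee_sum => i _.
      by rewrite zt ?zt' //; exact: hsg.
    rewrite EFinM -muleA; move: (81%:E * _)%E => c.
    have -> : d%:R%:E = (\sum_(i < d) 1)%E :> \bar R by rewrite sumEFin sumr_const card_ord.
    by rewrite ge0_sume_distrl //; under [leRHS]eq_bigr do rewrite mul1e.
  apply: (@le_trans _ _ ((20 / d%:R)%:E * ((d%:R * 81)%:E * (A * tau ^+ 2)%:E)))%E.
    apply: lee_wpmul2l; first by rewrite lee_fin divr_ge0 // ltW.
    apply: le_trans hc _.
    rewrite ge0_integralZl_EFin ?mulr_ge0 //; last 2 first.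
    - by move=> t _; exact: line_mass_ge0.
    - exact: gmeas_line_mass.
    apply: lee_wpmul2l; first by rewrite lee_fin mulr_ge0.
    rewrite -(hP (line_mass p eta)) //; [|exact: line_mass_ge0|exact: gmeas_line_mass].
    apply: le_trans (small_ball d0 dl0 eta0 tau1 gp) _.
    by rewrite lee_fin -/tau le_eqVlt; apply/orP; left; apply/eqP; rewrite /A; ring.
  rewrite -!EFinM lee_fin.
  have -> : 20 / d%:R * (d%:R * 81 * (A * tau ^+ 2)) = 1620 * A * tau ^+ 2.
    by field; rewrite gt_eqF.
  by rewrite ler_wpM2r ?sqr_ge0 // /K lerDl.
apply: (@le_trans _ _ ((20 / d%:R)%:E * d%:R%:E)%E).
  apply: lee_wpmul2l; first by rewrite lee_fin divr_ge0 // ltW.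
  apply: (@le_trans _ _ (\int[P]_t (cst d%:R%:E) t))%E.
    apply: ge0_le_integral_nomeas => t _; have /andP[c0 c1] := cost0 t; by rewrite lee_fin.
  by rewrite integral_cst //= probability_setT mule1.
rewrite -EFinM lee_fin divfK ?gt_eqF //.
have t2 : 1 / 4 <= tau ^+ 2 by move: tau1; clear; nra.
have : 20 <= 80 * tau ^+ 2 by move: t2; lra.
have : 0 <= A * tau ^+ 2 by rewrite mulr_ge0 // sqr_ge0.
have -> : K * tau ^+ 2 = 1620 * (A * tau ^+ 2) + 80 * tau ^+ 2 by rewrite /K; ring.
by move: (A * tau ^+ 2) (tau ^+ 2) => a b; clear; lra.
Qed.

End LipschitzRootLaw.

(** * Energy of curves *)

Section CurveEnergy.
Variables (R : realType) (n d : nat).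
Local Notation C := (complex R).
Local Notation leb := (@lebesgue_measure R).

Lemma integral_cst_itv (s t k : R) : s <= t ->
  (\int[leb]_(x in `[s, t]) k%:E = (k * (t - s))%:E)%E.
Proof.
move=> st; rewrite integral_cst //= lebesgue_measure_itv /= lte_fin EFinM.
case: ltP => // ts; have -> : t = s by apply/eqP; rewrite eq_le ts st.
by rewrite subrr !mule0.
Qed.

(* The lower bound matters: a metric speed of -oo would have square +oo. *)
Lemma mspeed_lip (M : R -> set (CP R n) -> \bar R) (k t : R) : 0 <= t <= 1 -> 0 <= k ->
  (forall h, 0 <= t + h <= 1 -> (W2 (M (t + h)%R) (M t) <= (k * `|h|)%:E)%E) ->
  (0 <= mspeed M t <= k%:E)%E.
Proof.
move=> /andP[t0 t1] k0 hM; apply/andP; split.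
  apply: le_ereal_inf_tmp => _ [de /= de0 <-].
  have [h [h0 h1]] : exists h : R, 0 < `|h| < de /\ 0 <= t + h <= 1.
    pose e := Num.min (de / 2) (1 / 2).
    have e0 : 0 < e by rewrite lt_min; apply/andP; split; lra.
    have ede : e < de by rewrite gt_min; apply/orP; left; lra.
    have e2 : e <= 1 / 2 by rewrite ge_min lexx orbT.
    have [t2|t2] := leP t (1 / 2).
      by exists e; rewrite gtr0_norm // e0 ede; split => //; apply/andP; split; lra.
    by exists (- e); rewrite normrN gtr0_norm // e0 ede; split => //; apply/andP; split; lra.
  apply: (@le_trans _ _ (W2 (M (t + h)%R) (M t) * (`|h|^-1)%:E)%E).
    by rewrite mule_ge0 ?esqrt_ge0 // lee_fin invr_ge0.
  by apply: ereal_sup_ubound; exists h.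
apply: (@le_trans _ _ (ereal_sup [set (W2 (M (t + h)%R) (M t) * (`|h|^-1)%:E)%E
   | h in [set h : R | 0 < `|h| < 1 /\ 0 <= t + h <= 1]])).
  by apply: ereal_inf_lbound; exists 1 => //=.
apply: ge_ereal_sup => _ [h [/andP[h0 _] h1] <-].
have -> : k%:E = ((k * `|h|)%:E * (`|h|^-1)%:E)%E by rewrite -EFinM mulfK // gt_eqF.
by apply: lee_wpmul2r; [rewrite lee_fin invr_ge0|exact: hM].
Qed.

Lemma W2in_le_lip (p q : hpoly R n d) (g : R -> hpoly R n d) (k : R) (c0 c1 : C) : 0 <= k ->
  c0 != 0 -> c1 != 0 -> g 0 = [ffun a => c0 * p a] -> g 1 = [ffun a => c1 * q a] ->
  (forall t, 0 <= t <= 1 -> g t != 0) ->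
  (forall s t, 0 <= s <= 1 -> 0 <= t <= 1 -> (W2 (muP (g s)) (muP (g t)) <= (k * `|s - t|)%:E)%E) ->
  (W2in p q <= k%:E)%E.
Proof.
move=> k0 c00 c10 g0 g1 gne hg; apply: esqrt_le => //.
apply: (@le_trans _ _ (energy (fun t => muP (g t)))).
  apply: ereal_inf_lbound; exists g => //; split=> //; split; [by exists c0|split; [by exists c1|]].
  exists (fun=> k); split; first exact: measurable_cst.
  split; first by [].
  split; first by rewrite integral_cst_itv ?ltry.
  move=> s t s0 st t1; rewrite integral_cst_itv //.
  apply: le_trans (hg s t _ _) _; first by rewrite s0 (le_trans st).
    by rewrite t1 (le_trans s0).
  by rewrite distrC ger0_norm // subr_ge0.
have -> : (k ^+ 2)%:E = (\int[leb]_(t in `[0%R, 1%R]) (k ^+ 2)%:E)%E.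
  by rewrite integral_cst_itv // subr0 mulr1.
have sp t : 0 <= t <= 1 -> (0 <= mspeed (fun t => muP (g t)) t <= k%:E)%E.
  move=> t01; apply: mspeed_lip => // h h01.
  by apply: le_trans (hg _ _ h01 t01) _; rewrite addrAC subrr add0r.
apply: ge0_le_integral_nomeas => t /=; rewrite in_itv /= => /sp /andP[s0 s1].
  exact: mule_ge0.
by rewrite expr2 EFinM; exact: lee_pmul.
Qed.

End CurveEnergy.

(** * Singular members of a pencil *)

Section DefinableSets.
Variable F : closedFieldType.
Implicit Types (e : F -> seq F) (f : GRing.formula F) (t : GRing.term F).

Lemma rterm_poly (N : nat) (e0 : seq F) t : GRing.rterm t ->
  exists P : {poly F}, forall z, GRing.eval (set_nth 0 e0 N z) t = P.[z].
Proof.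
elim: t => //=.
- move=> i _; exists (if i == N then 'X else (nth 0 e0 i)%:P) => z.
  by rewrite nth_set_nth /=; case: eqP => _; rewrite ?hornerX ?hornerC.
- by move=> x _; exists x%:P => z; rewrite hornerC.
- by move=> k _; exists (k%:R)%:P => z; rewrite hornerC.
- by move=> t1 h1 t2 h2 /andP[/h1[P1 e1] /h2[P2 e2]]; exists (P1 + P2) => z; rewrite hornerD e1 e2.
- by move=> t1 h1 /h1[P1 e1]; exists (- P1) => z; rewrite hornerN e1.
- by move=> t1 h1 k /h1[P1 e1]; exists (P1 *+ k) => z; rewrite hornerMn e1.
- by move=> t1 h1 t2 h2 /andP[/h1[P1 e1] /h2[P2 e2]]; exists (P1 * P2) => z; rewrite hornerM e1 e2.
- by move=> t1 h1 k /h1[P1 e1]; exists (P1 ^+ k) => z; rewrite horner_exp e1.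
Qed.

Definition finite_or_cofinite (S : F -> bool) : Prop :=
  exists s : seq F, (forall z, S z -> z \in s) \/ (forall z, ~~ S z -> z \in s).

(** With the other variables fixed, an atomic formula says that a univariate polynomial vanishes;
    zero sets are finite or everything, and boolean operations preserve the dichotomy. *)
Lemma qf_finite_or_cofinite (N : nat) (e0 : seq F) f : GRing.qf_form f -> GRing.rformula f ->
  finite_or_cofinite (fun z => GRing.qf_eval (set_nth 0 e0 N z) f).
Proof.
have orC S1 S2 : finite_or_cofinite S1 -> finite_or_cofinite S2 ->
    finite_or_cofinite (fun z => S1 z || S2 z).
  move=> [s1 h1] [s2 h2]; case: h1 => h1; last first.
    by exists s1; right => z; rewrite negb_or => /andP[/h1].
  case: h2 => h2; last by exists s2; right => z; rewrite negb_or => /andP[_ /h2].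
  by exists (s1 ++ s2); left => z; rewrite mem_cat => /orP[/h1 ->|/h2 ->]; rewrite ?orbT.
have negC S1 : finite_or_cofinite S1 -> finite_or_cofinite (fun z => ~~ S1 z).
  by move=> [s [h|h]]; exists s; [right => z; rewrite negbK; exact: h|left].
have ext S1 S2 : (forall z, S1 z = S2 z) -> finite_or_cofinite S1 -> finite_or_cofinite S2.
  by move=> e [s h]; exists s; case: h => h; [left|right] => z; rewrite -e; exact: h.
elim: f => //=.
- by move=> b _ _; case: b; exists [::]; [right|left].
- move=> t1 t2 _ /andP[/(rterm_poly N e0)[P1 e1] /(rterm_poly N e0)[P2 e2]].
  have [e|ne] := eqVneq P1 P2.
    by exists [::]; right => z; rewrite e1 e2 e eqxx.
  have [rs hrs] := closed_field_poly_normal (P1 - P2).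
  exists rs; left => z; rewrite e1 e2 -subr_eq0 -hornerN -hornerD => h.
  have : root (P1 - P2) z by rewrite /root.
  by rewrite hrs rootZ ?lead_coef_eq0 ?subr_eq0 // root_prod_XsubC.
- move=> f1 h1 f2 h2 /andP[q1 q2] /andP[r1 r2].
  apply: (ext (fun z => ~~ (~~ GRing.qf_eval (set_nth 0 e0 N z) f1 || ~~ GRing.qf_eval (set_nth 0 e0 N z) f2))).
    by move=> z; rewrite negb_or !negbK.
  by apply: (negC); apply: orC; apply: negC; [exact: h1|exact: h2].
- by move=> f1 h1 f2 h2 /andP[q1 q2] /andP[r1 r2]; apply: orC; [exact: h1|exact: h2].
- move=> f1 h1 f2 h2 /andP[q1 q2] /andP[r1 r2].
  apply: (ext (fun z => ~~ GRing.qf_eval (set_nth 0 e0 N z) f1 || GRing.qf_eval (set_nth 0 e0 N z) f2)).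
    by move=> z; rewrite implybE.
  by apply: orC; [apply: negC; exact: h1|exact: h2].
- by move=> f1 h1 q1 r1; apply: negC; exact: h1.
Qed.

(** The strong minimality of algebraically closed fields, obtained from quantifier elimination. *)
Lemma definable_finite_or_cofinite (N : nat) (e0 : seq F) f : GRing.rformula f ->
  exists2 S : F -> bool, finite_or_cofinite S &
    forall z, S z <-> GRing.holds (set_nth 0 e0 N z) f.
Proof.
move=> rf.
have wf : GRing.wf_QE_proj (@ClosedFieldQE.ex_elim F) by exact: ClosedFieldQE.wf_ex_elim.
have ok : GRing.valid_QE_proj (@ClosedFieldQE.ex_elim F).
  exact: (ClosedFieldQE.holds_ex_elim (@solve_monicpoly F)).
have /andP[qf rq] := GRing.quantifier_elim_wf wf rf.
exists (fun z => GRing.qf_eval (set_nth 0 e0 N z) (GRing.quantifier_elim (@ClosedFieldQE.ex_elim F) f)).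
  exact: qf_finite_or_cofinite.
by move=> z; split => [/(GRing.quantifier_elim_rformP wf ok _ rf)|/(GRing.quantifier_elim_rformP wf ok _ rf)].
Qed.

End DefinableSets.

Section Pencil.
Variables (R : realType) (n d : nat).
Local Notation C := (complex R).
Implicit Types (p q : hpoly R n d) (w : cvec R n).

Definition nonsing p : Prop := forall w, w != 0 -> exists i, pderiv_eval p i w != 0.

Definition pencil p q (z : C) : hpoly R n d := [ffun a => p a + z * (q a - p a)].

(** Variables 0 to n stand for the coordinates of the point, variable n + 1 for the parameter of the
    pencil, which [singular_formula] leaves free. *)
Definition pencil_deriv_term p q (i : 'I_n.+1) : GRing.term C :=
  \big[GRing.Add/0%T]_a ((GRing.Const (p a) + 'X_(n.+1) * GRing.Const (q a - p a)%R) *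
     (GRing.NatConst C (val a i) * \big[GRing.Mul/1%T]_(j < n.+1) ('X_j ^+ (val a j - eq_op j i)%N)))%T.

Lemma rterm_big (op : GRing.term C -> GRing.term C -> GRing.term C) (x0 : GRing.term C)
    (I : Type) (r : seq I) (t : I -> GRing.term C) :
  GRing.rterm x0 -> (forall x y, GRing.rterm (op x y) = GRing.rterm x && GRing.rterm y) ->
  (forall i, GRing.rterm (t i)) -> GRing.rterm (\big[op/x0]_(i <- r) t i).
Proof.
move=> h0 hop ht; elim: r => [|i r ih]; first by rewrite big_nil.
by rewrite big_cons hop ht ih.
Qed.

Lemma eval_pencil_deriv p q i (e : seq C) :
  GRing.eval e (pencil_deriv_term p q i) =
    pderiv_eval (pencil p q (nth 0 e n.+1)) i [ffun j : 'I_n.+1 => nth 0 e j].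
Proof.
rewrite /pencil_deriv_term (big_morph (GRing.eval e) (id1 := 0) (op1 := +%R)) //=.
apply: eq_bigr => a _; rewrite ffunE; congr (_ * (_ * _)).
rewrite (big_morph (GRing.eval e) (id1 := 1) (op1 := *%R)) //=.
by apply: eq_bigr => j _; rewrite ffunE.
Qed.

Definition singular_formula p q : GRing.formula C :=
  foldr GRing.Exists
   ((\big[GRing.Or/GRing.Bool false]_(j : 'I_n.+1) (~ ('X_j == 0))) /\
    (\big[GRing.And/GRing.Bool true]_(i : 'I_n.+1) (pencil_deriv_term p q i == 0)))%T
   (iota 0 n.+1).

Lemma holds_big_or (I : eqType) (r : seq I) (f : I -> GRing.formula C) e :
  GRing.holds e (\big[GRing.Or/GRing.Bool false]_(j <- r) f j) <->
  exists2 j, j \in r & GRing.holds e (f j).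
Proof.
elim: r => [|j r ih]; first by rewrite big_nil; split => [|[]].
rewrite big_cons /=; split => [[h|/ih[k kr hk]]|[k]].
- by exists j; rewrite ?mem_head.
- by exists k; rewrite // inE kr orbT.
- by rewrite inE => /orP[/eqP ->|kr hk]; [left|right; apply/ih; exists k].
Qed.

Lemma holds_big_and (I : eqType) (r : seq I) (f : I -> GRing.formula C) e :
  GRing.holds e (\big[GRing.And/GRing.Bool true]_(j <- r) f j) <->
  forall j, j \in r -> GRing.holds e (f j).
Proof.
elim: r => [|j r ih]; first by rewrite big_nil.
rewrite big_cons /=; split => [[h /ih hr] k|h].
  by rewrite inE => /orP[/eqP ->|/hr].
by split; [apply: h; rewrite mem_head|apply/ih => k kr; apply: h; rewrite inE kr orbT].
Qed.

Lemma singular_formulaP p q z :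
  GRing.holds (set_nth 0 [::] n.+1 z) (singular_formula p q) <-> ~ nonsing (pencil p q z).
Proof.
rewrite /singular_formula; split.
  move=> /GRing.foldExistsP[e he /= [/holds_big_or[j _ /= hj] /holds_big_and hs]] ns.
  have ez : nth 0 e n.+1 = z.
    by rewrite -he ?nth_set_nth /= ?eqxx // !inE mem_iota; lia.
  have [|i] := ns [ffun j : 'I_n.+1 => nth 0 e j].
    by apply/eqP => /ffunP/(_ j); rewrite !ffunE.
  have := hs i (mem_index_enum i); rewrite /= eval_pencil_deriv ez => ->.
  by rewrite eqxx.
move=> ns; apply/GRing.foldExistsP.
have [w [w0 hw]] : exists w, w != 0 /\ forall i, pderiv_eval (pencil p q z) i w = 0.
  apply: contrapT => h; apply: ns => w w0; apply: contrapT => h2; apply: h; exists w; split => // i.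
  by apply/eqP/negPn/negP => h3; apply: h2; exists i.
pose e := rcons [seq w i | i <- enum 'I_n.+1] z.
have se : size [seq w i | i <- enum 'I_n.+1] = n.+1 by rewrite size_map size_enum_ord.
have ei (i : 'I_n.+1) : nth 0 e i = w i.
  by rewrite /e nth_rcons se ltn_ord (nth_map i) ?size_enum_ord // nth_ord_enum.
have ez : nth 0 e n.+1 = z by rewrite /e nth_rcons se ltnn eqxx.
exists e.
  move=> k; rewrite !inE mem_iota => nk.
  rewrite nth_set_nth /= nth_nil; case: eqP => [->//|/eqP ne].
  by rewrite nth_default // size_rcons se; move: nk ne; lia.
have ew : [ffun j : 'I_n.+1 => nth 0 e j] = w by apply/ffunP => j; rewrite ffunE ei.
split.
  apply/holds_big_or.
  have [j hj] : exists j, w j != 0.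
    apply: contrapT => h; move/eqP: w0; apply; apply/ffunP => j; rewrite [RHS]ffunE.
    by apply/eqP/negPn/negP => hj; apply: h; exists j.
  by exists j; rewrite ?mem_index_enum //= ei; apply/eqP.
by apply/holds_big_and => i _ /=; rewrite eval_pencil_deriv ez ew hw.
Qed.

Lemma pencil_singular_finite_or_cofinite p q : exists s : seq C,
  (forall z, ~ nonsing (pencil p q z) -> z \in s) \/ (forall z, nonsing (pencil p q z) -> z \in s).
Proof.
have rf : GRing.rformula (singular_formula p q).
  have fex (f : GRing.formula C) (I : seq nat) :
      GRing.rformula f -> GRing.rformula (foldr GRing.Exists f I).
    by move=> hf; elim: I => [|k I ih] //=.
  apply: fex => /=; apply/andP; split.
    by elim: (index_enum _) => [|j r ih]; rewrite ?big_nil ?big_cons //= ih.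
  elim: (index_enum _) => [|i r ih]; rewrite ?big_nil ?big_cons //= ih !andbT.
  by apply: rterm_big => // a /=; apply: rterm_big.
have [S [s hs] hS] := definable_finite_or_cofinite n.+1 [::] rf.
exists s; case: hs => hs; [left|right] => z hz; apply: hs.
  by apply/hS/singular_formulaP.
by apply/negP => /hS/singular_formulaP; apply.
Qed.

End Pencil.

(** * Compactness and paths *)

Section SequentialCompactness.
Variable R : realType.
Local Notation C := (complex R).

Lemma near_harmonic (e : R) : 0 < e -> \forall k \near \oo, k.+1%:R^-1 <= e.
Proof.
move=> e0; have /cvgrPdist_lt/(_ e e0) := @cvg_harmonic R; apply: filterS => k /=.
by rewrite sub0r normrN ger0_norm ?invr_ge0 // => /ltW.
Qed.

Lemma homo_ltn_geq (phi : nat -> nat) : {homo phi : a b / (a < b)%N} -> forall k, (k <= phi k)%N.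
Proof.
by move=> h; elim=> // k ih; apply: leq_ltn_trans ih _; exact: h.
Qed.

Lemma cvg_subsequence (phi : nat -> nat) : {homo phi : a b / (a < b)%N} -> phi @ \oo --> \oo.
Proof.
move=> h; apply/cvgnyPge => A; near=> k.
apply: leq_trans (homo_ltn_geq h k); near: k; exact: nbhs_infty_ge.
Unshelve. all: by end_near. Qed.

Lemma bounded_subsequence (I : eqType) (r : seq I) (x : nat -> I -> R) (B : R) :
  (forall k i, `|x k i| <= B) ->
  exists2 phi : nat -> nat, {homo phi : a b / (a < b)%N} &
    forall i, i \in r -> cvgn (fun k => x (phi k) i).
Proof.
move=> hB; elim: r => [|i r [phi hphi hr]]; first by exists id.
have [|psi psii hpsi] := @bolzano_weierstrass R (fun k => x (phi k) i).
  exists B; split; first exact: num_real.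
  by move=> M BM k _; apply: le_trans (hB _ _) (ltW BM).
have psih : {homo psi : a b / (a < b)%N}.
  by move=> a b; rewrite !ltnNge; apply: contra; rewrite -!leEnat psii.
exists (phi \o psi); first by move=> a b ab; apply: hphi; exact: psih.
move=> j; rewrite inE => /orP[/eqP -> //|jr].
have /cvg_ex[l hl] := hr j jr; apply/cvg_ex; exists l.
exact: (cvg_comp _ _ (cvg_subsequence psih) hl).
Qed.

Lemma complex_subsequence (I : finType) (x : nat -> I -> C) (B : R) :
  (forall k i, cm (x k i) <= B) ->
  exists (phi : nat -> nat) (l : I -> C), {homo phi : a b / (a < b)%N} /\
    forall i, ccvg \oo (fun k => x (phi k) i) (l i).
Proof.
move=> hB.
pose y k (ib : I * bool) : R := if ib.2 then complex.Re (x k ib.1) else complex.Im (x k ib.1).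
have [|phi hphi hr] := @bounded_subsequence _ (enum {: I * bool}) y B.
  by move=> k [i []] /=; apply: le_trans (hB k i); [exact: Re_le_cm|exact: Im_le_cm].
have hy ib : cvgn (fun k => y (phi k) ib) by apply: hr; rewrite mem_enum.
exists phi, (fun i => Complex (limn (fun k => y (phi k) (i, true))) (limn (fun k => y (phi k) (i, false)))).
by split => // i; split => /=; [exact: (hy (i, true))|exact: (hy (i, false))].
Qed.

(** Weights 1 give the norm of vectors, weights [bwt] the Bombieri-Weyl norm. *)
Lemma cvg_weighted_cm2 (T : Type) (F : set_system T) {FF : Filter F} (I : finType)
    (kap : I -> R) (x : T -> I -> C) (l : I -> C) :
  (forall i, ccvg F (fun t => x t i) (l i)) ->
  (\sum_i kap i * cm (x t i) ^+ 2) @[t --> F] --> \sum_i kap i * cm (l i) ^+ 2.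
Proof.
move=> h; elim: (index_enum I) => [|i r ih].
  by rewrite big_nil; under eq_fun do rewrite big_nil; exact: cvg_cst.
rewrite big_cons; under eq_fun do rewrite big_cons.
apply: cvgD ih; apply: cvgMr; under eq_fun do rewrite expr2.
by rewrite expr2; apply: cvgM; exact: ccvg_cm.
Qed.

End SequentialCompactness.

Section Goodness.
Variables (R : realType) (n d : nat).
Local Notation C := (complex R).
Implicit Types (p q : hpoly R n d) (w : cvec R n).

Definition dmono (a : mon n d) (i : 'I_n.+1) w : C :=
  (val a i : nat)%:R * \prod_j w j ^+ (val a j - (j == i)).

(** For an exponent 0 at i the truncated subtraction would leave the sum equal to d; such terms of a
    derivative are killed by their coefficient. *)
Lemma sum_dexp (a : mon n d) i : (0 < val a i)%N ->
  (\sum_j (val a j - (j == i)) = d.-1)%N.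
Proof.
move=> ai; have /eqP e := valP a; rewrite -[X in X.-1]e.
rewrite (bigD1 i) //= [in RHS](bigD1 i) //= eqxx subn1.
rewrite (eq_bigr (fun j => val a j : nat)) => [|j /negbTE ->]; last by rewrite subn0.
by case: (val a i : nat) ai => //= k _; rewrite addSn.
Qed.

Lemma dmono_scale (a : mon n d) i (c : C) w : dmono a i (vscale c w) = c ^+ d.-1 * dmono a i w.
Proof.
rewrite /dmono; have [a0|ai] := posnP (val a i); first by rewrite a0 !mul0r mulr0.
rewrite mulrCA; congr (_ * _); rewrite -(sum_dexp ai) -prodrXr -big_split /=.
by apply: eq_bigr => j _; rewrite ffunE exprMn.
Qed.

Lemma cm_dmono_le (a : mon n d) i w : cm (dmono a i w) <= d%:R * vn w ^+ d.-1.
Proof.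
rewrite /dmono; have [a0|ai] := posnP (val a i).
  by rewrite a0 mul0r cm0 mulr_ge0 // exprn_ge0 // vn_ge0.
rewrite cmM cm_nat; apply: ler_pM => //; first exact: cm_ge0.
  by rewrite ler_nat -ltnS; exact: ltn_ord.
rewrite cm_prod -[X in _ <= vn w ^+ X](sum_dexp ai) -prodrXr; apply: ler_prod => j _.
by rewrite cm_ge0 cmX lerXn2r ?nnegrE ?cm_ge0 ?vn_ge0 // cm_coord_le_vn.
Qed.

Lemma pderiv_scale p i (c : C) w : pderiv_eval p i (vscale c w) = c ^+ d.-1 * pderiv_eval p i w.
Proof.
rewrite /pderiv_eval mulr_sumr; apply: eq_bigr => a _.
rewrite -/(dmono a i (vscale c w)) dmono_scale -/(dmono a i w); ring.
Qed.

Lemma pderiv_lip p q i w :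
  cm (pderiv_eval p i w - pderiv_eval q i w) <= d%:R * coefdist p q * vn w ^+ d.-1.
Proof.
rewrite /pderiv_eval -sumrB; apply: le_trans (cm_sum _ _ _) _.
rewrite /coefdist mulrAC mulr_sumr; apply: ler_sum => a _.
rewrite -mulrBl cmM mulrC ler_wpM2r ?cm_ge0 //; exact: cm_dmono_le.
Qed.

Lemma euler_identity p w : \sum_i w i * pderiv_eval p i w = d%:R * peval p w.
Proof.
rewrite /peval mulr_sumr.
under eq_bigr do rewrite /pderiv_eval mulr_sumr.
rewrite exchange_big /=; apply: eq_bigr => a _.
have e i : w i * (p a * dmono a i w) = (val a i : nat)%:R * (p a * mono a w).
  rewrite /dmono /mono; have [a0|ai] := posnP (val a i); first by rewrite a0 !mul0r !mulr0.
  have eX : w i ^+ val a i = w i * w i ^+ (val a i - 1) by rewrite -exprS subn1 prednK.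
  rewrite [in RHS](bigD1 i) //= (bigD1 i) //= eqxx eX.
  rewrite (eq_bigr (fun j => w j ^+ val a j)) => [|j /negbTE ->]; last by rewrite subn0.
  ring.
rewrite (eq_bigr _ (fun i _ => e i)) -mulr_suml -natr_sum.
by have /eqP -> := valP a.
Qed.

Lemma good_perturb dl p q : good dl p -> d%:R * coefdist p q <= dl / 2 -> good (dl / 2) q.
Proof.
move=> gp h w; have [i hi] := gp w; exists i.
have l := pderiv_lip p q i w; have v0 : 0 <= vn w ^+ d.-1 by rewrite exprn_ge0 // vn_ge0.
have t : cm (pderiv_eval p i w) <= cm (pderiv_eval q i w) + cm (pderiv_eval p i w - pderiv_eval q i w).
  by rewrite addrC -{1}(subrK (pderiv_eval q i w) (pderiv_eval p i w)) cmD.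
have h2 : d%:R * coefdist p q * vn w ^+ d.-1 <= dl / 2 * vn w ^+ d.-1 by rewrite ler_wpM2r.
apply: le_trans (_ : dl * vn w ^+ d.-1 - dl / 2 * vn w ^+ d.-1 <= _).
  by rewrite -mulrBl le_eqVlt; apply/orP; left; apply/eqP; field.
by rewrite lerBlDr; apply: le_trans hi _; apply: le_trans t _; rewrite lerD2l; apply: le_trans l h2.
Qed.

Lemma good_le dl dl' p : dl' <= dl -> good dl p -> good dl' p.
Proof.
move=> le g w; have [i hi] := g w; exists i; apply: le_trans hi.
by rewrite ler_wpM2r // exprn_ge0 // vn_ge0.
Qed.

Lemma good_nonsing dl p : 0 < dl -> good dl p -> nonsing p.
Proof.
move=> dl0 g w w0; have [i hi] := g w; exists i; rewrite -cm_gt0.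
apply: lt_le_trans hi; rewrite mulr_gt0 // exprn_gt0 // lt_def vn_ge0 andbT.
by rewrite -sqrf_eq0 vn_sqr vnorm2_eq0.
Qed.

Lemma nonsing_neq0 p : nonsing p -> p != 0.
Proof.
move=> ns; apply/eqP => p0; have nz : e0 R n != 0.
  by apply/eqP => /ffunP/(_ ord0); rewrite !ffunE eqxx => /eqP; rewrite oner_eq0.
have [j] := ns _ nz; rewrite p0 /pderiv_eval big1 ?eqxx // => a _.
by rewrite ffunE mul0r.
Qed.

Lemma vn_e0 : vn (e0 R n) = 1.
Proof. by rewrite /vn; have /andP[/eqP -> _] := e0_rep R n; rewrite sqrtr1. Qed.

Lemma good_unit dl p : (forall w, vn w = 1 -> exists i, dl <= cm (pderiv_eval p i w)) ->
  good dl p.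
Proof.
move=> h w.
have [u [c [u1 c0 ->]]] : exists (u : cvec R n) (c : R), [/\ vn u = 1, 0 <= c & w = vscale (realC c) u].
  (* The zero vector is 0 times a unit vector. This case has content for d = 1, where [vn w ^+ d.-1]
     equals 1 even at w = 0. *)
  have [w0|w0] := eqVneq w 0.
    exists (e0 R n), 0; split; rewrite ?vn_e0 //.
    by rewrite w0; apply/ffunP => j; rewrite !ffunE mul0r.
  have v0 : 0 < vn w by rewrite lt_def vn_ge0 andbT -sqrf_eq0 vn_sqr vnorm2_eq0.
  have cv : realC (vn w) != 0 by rewrite -cm_eq0 cm_realC normr_eq0 gt_eqF.
  exists (vscale (realC (vn w))^-1 w), (vn w); split; last 2 first.
  - exact: ltW.
  - by apply/ffunP => j; rewrite !ffunE mulVKf.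
  rewrite [LHS]/vn vnorm2_scale cabs2E cmV cm_realC gtr0_norm //.
  by rewrite -vn_sqr -exprMn mulVf ?gt_eqF // expr1n sqrtr1.
have [i hi] := h u u1; exists i; rewrite pderiv_scale cmM cmX cm_realC ger0_norm //.
have -> : vn (vscale (realC c) u) = c.
  by rewrite /vn vnorm2_scale -vn_sqr u1 expr1n mulr1 cabs2E cm_realC sqrtr_sqr normr_id ger0_norm.
by rewrite mulrC ler_wpM2l // exprn_ge0.
Qed.

(** Compactness of the unit sphere: otherwise unit vectors at which all the derivatives are smaller
    and smaller would accumulate at a common zero. *)
Lemma nonsing_good p : nonsing p -> exists2 dl : R, 0 < dl & good dl p.
Proof.
move=> ns; apply: contrapT => hn.
have /choice[w hw] : forall k : nat, exists w : cvec R n, vn w = 1 /\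
    forall i, cm (pderiv_eval p i w) < k.+1%:R^-1.
  move=> k; apply: contrapT => h; apply: hn; exists k.+1%:R^-1; first by rewrite invr_gt0.
  apply: good_unit => w w1; apply: contrapT => h2; apply: h; exists w; split => // i.
  by rewrite ltNge; apply/negP => h3; apply: h2; exists i.
have [|phi [l [hphi hl]]] := @complex_subsequence R _ (fun k => w k : 'I_n.+1 -> C) 1.
  by move=> k i; have [<- _] := hw k; exact: cm_coord_le_vn.
pose u : cvec R n := [ffun i => l i].
have hu i : ccvg \oo (fun k => w (phi k) i) (u i) by rewrite ffunE.
have u1 : vnorm2 u = 1.
  have h1 : (\sum_i 1 * cm (w (phi k) i) ^+ 2) @[k --> \oo] --> \sum_i 1 * cm (u i) ^+ 2.
    exact: (cvg_weighted_cm2 (kap := fun=> 1) hu).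
  have -> : vnorm2 u = \sum_i 1 * cm (u i) ^+ 2.
    by apply: eq_bigr => i _; rewrite mul1r cabs2E.
  rewrite -(cvg_lim (@Rhausdorff R) h1); apply: cvg_lim; first exact: Rhausdorff.
  rewrite (_ : (fun k => _) = cst 1); first exact: cvg_cst.
  apply/funext => k /=; have [h _] := hw (phi k).
  rewrite (eq_bigr (fun i => cabs2 (w (phi k) i))) => [|i _]; last by rewrite mul1r cabs2E.
  by rewrite -/(vnorm2 (w (phi k))) -vn_sqr h expr1n.
have u0 : u != 0 by rewrite -vnorm2_gt0 u1.
have [i0] := ns u u0; rewrite -cm_eq0 => /eqP; apply.
have hd : ccvg \oo (fun k => pderiv_eval p i0 (w (phi k))) (pderiv_eval p i0 u).
  apply: ccvg_sum => a _; apply: ccvgM; first exact: ccvg_cst.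
  apply: ccvgM; first exact: ccvg_cst.
  by apply: ccvg_prod => j _; apply: ccvgX.
rewrite -(cvg_lim (@Rhausdorff R) (ccvg_cm hd)); apply: cvg_lim; first exact: Rhausdorff.
apply: (@squeeze_cvgr _ _ _ _ (fun=> 0) (fun k => k.+1%:R^-1)).
- near=> k; rewrite cm_ge0 /=; have [_ h] := hw (phi k); apply: le_trans (ltW (h i0)) _.
  by rewrite lef_pV2 ?posrE // ler_nat ltnS; exact: homo_ltn_geq.
- exact: cvg_cst.
- exact: cvg_harmonic.
Unshelve. all: by end_near. Qed.

Definition seq_compact (S : set (hpoly R n d)) : Prop := forall u, (forall k : nat, S (u k)) ->
  exists (phi : nat -> nat) p, {homo phi : a b / (a < b)%N} /\ S p /\
    (coefdist (u (phi k)) p @[k --> \oo] --> 0).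

Lemma coefdist_lt (u : nat -> hpoly R n d) p (e : R) : 0 < e ->
  coefdist (u k) p @[k --> \oo] --> 0 -> \forall k \near \oo, coefdist (u k) p < e.
Proof.
move=> e0 /cvgrPdist_lt/(_ e e0); apply: filterS => k.
by rewrite sub0r normrN ger0_norm // coefdist_ge0.
Qed.

Lemma coefdistC p q : coefdist p q = coefdist q p.
Proof. by apply: eq_bigr => a _; rewrite -cmN opprB. Qed.

Lemma good_near dl p : 0 < dl -> good dl p ->
  exists2 r : R, 0 < r & forall q, coefdist p q <= r -> good (dl / 2) q.
Proof.
move=> dl0 g; exists (dl / 2 / d.+1%:R); first by rewrite !divr_gt0.
move=> q h; apply: (good_perturb g).
apply: (@le_trans _ _ (d.+1%:R * (dl / 2 / d.+1%:R))).
  by apply: ler_pM => //; [exact: coefdist_ge0|rewrite ler_nat].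
by rewrite mulrC divfK // pnatr_eq0.
Qed.

(** A sequence with constants tending to 0 would have a limit p in S; p is good for some constant,
    and by [good_near] half of that constant serves all nearby polynomials. *)
Lemma good_uniform (S : set (hpoly R n d)) : seq_compact S -> (forall p, S p -> nonsing p) ->
  exists2 dl : R, 0 < dl & forall p, S p -> good dl p.
Proof.
move=> cS nS; apply: contrapT => hn.
have /choice[u hu] : forall k : nat, exists p, S p /\ ~ good k.+1%:R^-1 p.
  move=> k; apply: contrapT => h; apply: hn; exists k.+1%:R^-1; first by rewrite invr_gt0.
  by move=> p Sp; apply: contrapT => h2; apply: h; exists p.
have [phi [p [hphi [Sp cvp]]]] := cS u (fun k => (hu k).1).
have [dl dl0 g] := nonsing_good (nS _ Sp).
have [r r0 hr] := good_near dl0 g.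
have dl2 : 0 < dl / 2 by rewrite divr_gt0.
suff : \forall k \near \oo, False by move/filter_ex => [].
near=> k; have [_] := hu (phi k); apply.
apply: (@good_le (dl / 2)); last first.
  apply: hr; rewrite coefdistC; apply: ltW; near: k; exact: coefdist_lt.
apply: (@le_trans _ _ k.+1%:R^-1).
  by rewrite lef_pV2 ?posrE // ler_nat ltnS; exact: homo_ltn_geq.
near: k; exact: near_harmonic.
Unshelve. all: by end_near. Qed.

End Goodness.

Section Paths.
Variables (R : realType) (n d : nat).
Local Notation C := (complex R).
Implicit Types (p q : hpoly R n d).

Lemma avoid_seq (s : seq R) (b : R) : 0 < b -> exists x : R, [/\ 0 < x, x <= b & x \notin s].
Proof.
move=> b0; pose l := [seq b / k.+1%:R | k <- iota 0 (size s).+1].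
have ul : uniq l.
  rewrite map_inj_uniq ?iota_uniq // => i j /(mulfI (lt0r_neq0 b0)).
  by move=> /invr_inj /eqP; rewrite eqr_nat => /eqP [].
apply: contrapT => hn; have : (size l <= size s)%N.
  apply: uniq_leq_size => // _ /mapP[k _ ->]; apply: contrapT => /negP h; apply: hn.
  exists (b / k.+1%:R); split => //; first by rewrite divr_gt0.
  by rewrite ler_pdivrMr // ler_peMr ?(ltW b0) // ler1n.
by rewrite size_map size_iota ltnn.
Qed.

Lemma coefdist_pencil p q (z z' : C) :
  coefdist (pencil p q z) (pencil p q z') = cm (z - z') * coefdist p q.
Proof.
rewrite /coefdist mulr_sumr; apply: eq_bigr => a _; rewrite !ffunE.
have -> : p a + z * (q a - p a) - (p a + z' * (q a - p a)) = (z - z') * (q a - p a) by ring.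
by rewrite cmM -[cm (q a - p a)]cmN opprB.
Qed.

Lemma pencil0 p q : pencil p q 0 = p.
Proof. by apply/ffunP => a; rewrite ffunE mul0r addr0. Qed.

Lemma pencil1 p q : pencil p q 1 = q.
Proof. by apply/ffunP => a; rewrite ffunE mul1r addrC subrK. Qed.

Definition good_radius (dl : R) : R := dl / 2 / d.+1%:R.

Lemma good_radius_gt0 dl : 0 < dl -> 0 < good_radius dl.
Proof. by move=> dl0; rewrite !divr_gt0. Qed.

Lemma good_within dl p q : good dl p -> coefdist p q <= good_radius dl -> good (dl / 2) q.
Proof.
move=> g h; apply: (good_perturb g).
apply: (@le_trans _ _ (d.+1%:R * good_radius dl)).
  by apply: ler_pM => //; [exact: coefdist_ge0|rewrite ler_nat].
by rewrite /good_radius mulrC divfK // pnatr_eq0.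
Qed.

(* The cofinite case is excluded because nonsingularity is an open condition at 0. *)
Lemma pencil_singular_finite p q : nonsing p ->
  exists s : seq C, forall z, ~ nonsing (pencil p q z) -> z \in s.
Proof.
move=> np; have [s [h|h]] := pencil_singular_finite_or_cofinite p q; first by exists s.
have [dl dl0 g] := nonsing_good np.
have D0 : 0 < coefdist p q + 1 by have := coefdist_ge0 p q; lra.
have [x [x0 xb]] := avoid_seq [seq complex.Re z | z : C <- s] (divr_gt0 (good_radius_gt0 dl0) D0).
move=> /negP []; apply/mapP; exists (realC x); last by rewrite Re_realC.
apply: h; apply: (@good_nonsing _ _ _ (dl / 2)); first by rewrite divr_gt0.
apply: (good_within g); rewrite -{1}(pencil0 p q) coefdist_pencil sub0r cmN cm_realC gtr0_norm //.
move: xb; rewrite ler_pdivlMr // => xb; apply: le_trans xb.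
by rewrite ler_wpM2l ?(ltW x0) // lerDl.
Qed.

Lemma bentpath_lip (kap s t : R) : 0 <= kap <= 1 -> 0 <= s <= 1 -> 0 <= t <= 1 ->
  cm (bentpath kap s - bentpath kap t) <= 2 * `|s - t|.
Proof.
move=> /andP[k0 k1] /andP[s0 s1] /andP[t0 t1]; apply: le_trans (cm_le _) _ => /=.
have -> : kap * (s * (1 - s)) - kap * (t * (1 - t)) = kap * (1 - s - t) * (s - t) by ring.
rewrite normrM mulr2n mulrDl mul1r lerD2l ler_piMl //.
rewrite normrM (ger0_norm k0) mulr_ile1 // ler_norml; apply/andP; split; lra.
Qed.

Lemma nonsing_path p q : nonsing p -> nonsing q ->
  exists (g : R -> hpoly R n d) (M dl : R),
  [/\ 0 <= M, 0 < dl, g 0 = p, g 1 = q &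
   (forall s t, 0 <= s <= 1 -> 0 <= t <= 1 -> coefdist (g s) (g t) <= M * `|s - t|) /\
   forall t, 0 <= t <= 1 -> good dl (g t)].
Proof.
move=> np nq; have [s hs] := pencil_singular_finite q np.
(* The bent path meets z away from its ends only if t = Re z and kap is the listed quotient, so each
   singular parameter excludes at most one value of [kap]. The ends are p and q themselves. *)
have [kap [k0 k1 hk]] := avoid_seq
  [seq complex.Im z / (complex.Re z * (1 - complex.Re z)) | z : C <- s] (@ltr01 R).
have k01 : 0 <= kap <= 1 by rewrite ltW.
pose g t := pencil p q (bentpath kap t).
have g0 : g 0 = p.
  by rewrite /g (_ : bentpath kap 0 = 0) ?pencil0 // /bentpath mul0r mulr0.
have g1 : g 1 = q.
  by rewrite /g (_ : bentpath kap 1 = 1) ?pencil1 // /bentpath subrr !mulr0.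
have ns t : nonsing (g t).
  have [t01|t01] := eqVneq (t * (1 - t)) 0.
    move/eqP: t01; rewrite mulf_eq0 subr_eq0 => /orP[/eqP ->|/eqP <-].
      by rewrite g0.
    by rewrite g1.
  apply: contrapT => /hs zs; move/negP: hk; apply; apply/mapP.
  by exists (bentpath kap t); rewrite //= mulfK.
have lip s' t : 0 <= s' <= 1 -> 0 <= t <= 1 ->
    coefdist (g s') (g t) <= 2 * coefdist p q * `|s' - t|.
  move=> s1 t1; rewrite /g coefdist_pencil mulrAC ler_wpM2r ?coefdist_ge0 //.
  exact: bentpath_lip.
have [dl dl0 hdl] : exists2 dl : R, 0 < dl & forall r, [set g t | t in `[0, 1]] r -> good dl r.
  apply: good_uniform; last by move=> _ [t _ <-].
  move=> u hu; have /choice[t ht] : forall k, exists t, 0 <= t <= 1 /\ g t = u k.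
    by move=> k; have [t tI <-] := hu k; exists t; split => //; move: tI; rewrite /= in_itv.
  have [|phi hphi hcv] := @bounded_subsequence R unit [:: tt] (fun k _ => t k) 1.
    by move=> k _; have [/andP[a b] _] := ht k; rewrite ger0_norm.
  have /cvg_ex[l hl] := hcv tt (mem_head _ _).
  have l01 : 0 <= l <= 1.
    apply/andP; split.
      by apply: (cvgr_to_ge hl); apply: nearW => k; have [/andP[]] := ht (phi k).
    by apply: (cvgr_to_le hl); apply: nearW => k; have [/andP[]] := ht (phi k).
  exists phi, (g l); split => //; split; first by exists l; rewrite //= in_itv.
  apply: (@squeeze_cvgr _ _ _ _ (fun=> 0) (fun k => 2 * coefdist p q * `|t (phi k) - l|)).
  - near=> k; rewrite coefdist_ge0 /=; have [a <-] := ht (phi k); exact: lip.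
  - exact: cvg_cst.
  - rewrite -(mulr0 (2 * coefdist p q)); apply: cvgMr.
    rewrite -(normr0 R) -(subrr l); apply: cvg_norm; apply: cvgB => //; exact: cvg_cst.
exists g, (2 * coefdist p q), dl; split => //; first by rewrite mulr_ge0 // coefdist_ge0.
by split => // t t1; apply: hdl; exists t; rewrite //= in_itv.
Unshelve. all: by end_near. Qed.

End Paths.

(** * The Bombieri-Weyl norm and compactness of the unit representatives *)

Section BombieriWeyl.
Variables (R : realType) (n d : nat).
Local Notation C := (complex R).
Implicit Types (p q : hpoly R n d).

(** The squared Bombieri-Weyl norm of the monomial z^a. *)
Definition bwt (a : mon n d) : R := (\prod_i (val a i : nat)`!)%:R / (d`!)%:R.

Lemma bwt_gt0 a : 0 < bwt a.
Proof.
rewrite divr_gt0 // ltr0n ?fact_gt0 //.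
by apply: prodn_gt0 => i; exact: fact_gt0.
Qed.

Lemma bwE p q : bw p q = \sum_a p a * cconj (q a) * realC (bwt a).
Proof.
by apply: eq_bigr => a _; rewrite /bwt realCE fmorph_div !rmorph_nat.
Qed.

Definition N2 p : R := complex.Re (bw p p).

Lemma N2E p : N2 p = \sum_a bwt a * cm (p a) ^+ 2.
Proof.
rewrite /N2 bwE cRe_sum; apply: eq_bigr => a _.
by rewrite mulc_conj -realCM Re_realC cabs2E mulrC.
Qed.

Lemma bw_self p : bw p p = realC (N2 p).
Proof.
rewrite N2E bwE realC_sum; apply: eq_bigr => a _.
by rewrite mulc_conj -realCM cabs2E mulrC.
Qed.

Lemma N2_ge0 p : 0 <= N2 p.
Proof. by rewrite N2E; apply: sumr_ge0 => a _; rewrite mulr_ge0 ?sqr_ge0 // ltW ?bwt_gt0. Qed.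

Lemma coef_le_N2 p a : bwt a * cm (p a) ^+ 2 <= N2 p.
Proof.
rewrite N2E (bigD1 a) //= lerDl; apply: sumr_ge0 => b _.
by rewrite mulr_ge0 ?sqr_ge0 // ltW ?bwt_gt0.
Qed.

Lemma N2_gt0 p : p != 0 -> 0 < N2 p.
Proof.
move=> p0; have [a pa] : exists a, p a != 0.
  apply: contrapT => h; move/eqP: p0; apply; apply/ffunP => a; rewrite [RHS]ffunE.
  by apply/eqP/negPn/negP => pa; apply: h; exists a.
by apply: lt_le_trans (coef_le_N2 p a); rewrite mulr_gt0 ?bwt_gt0 // exprn_gt0 // cm_gt0.
Qed.

Definition hscale (c : C) p : hpoly R n d := [ffun a => c * p a].

Lemma bwC p q : bw q p = cconj (bw p q).
Proof.
rewrite !bwE cconj_sum; apply: eq_bigr => a _; rewrite !cconjM cconjK.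
by rewrite [cconj (p a) * _]mulrC; congr (_ * _); rewrite /realC /cconj /= oppr0.
Qed.

Lemma bw_scalel c p q : bw (hscale c p) q = c * bw p q.
Proof. by rewrite !bwE mulr_sumr; apply: eq_bigr => a _; rewrite ffunE; ring. Qed.

Lemma bw_scaler c p q : bw p (hscale c q) = cconj c * bw p q.
Proof. by rewrite bwC bw_scalel cconjM -bwC. Qed.

Lemma N2_scale c p : N2 (hscale c p) = cm c ^+ 2 * N2 p.
Proof.
rewrite !N2E mulr_sumr; apply: eq_bigr => a _; rewrite ffunE cmM exprMn; ring.
Qed.

Lemma dFSE p q : dFS p q = acos (cm (bw p q) / Num.sqrt (N2 p * N2 q)).
Proof. by rewrite /dFS /fs_of cabs2E sqrtr_sqr ger0_norm ?cm_ge0. Qed.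

Lemma dFSC p q : dFS p q = dFS q p.
Proof. by rewrite !dFSE bwC cm_conj mulrC [N2 q * _]mulrC mulrC. Qed.

Lemma dFS_scale c p q : c != 0 -> dFS (hscale c p) q = dFS p q.
Proof.
move=> c0; rewrite !dFSE bw_scalel N2_scale cmM -[cm c ^+ 2 * _ * _]mulrA sqrtrM ?sqr_ge0 //.
have c1 : 0 < cm c by rewrite cm_gt0.
rewrite sqrtr_sqr gtr0_norm // invfM.
by congr acos; rewrite mulrACA mulfV ?mul1r // gt_eqF.
Qed.

Lemma dFS_unit p q : N2 p = 1 -> N2 q = 1 -> dFS p q = acos (cm (bw p q)).
Proof. by move=> p1 q1; rewrite dFSE p1 q1 mul1r sqrtr1 divr1. Qed.

Lemma hscale_neq0 c p : c != 0 -> p != 0 -> hscale c p != 0.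
Proof.
move=> c0; apply: contraNneq => /ffunP h; apply/eqP/ffunP => a.
by have /eqP := h a; rewrite !ffunE mulf_eq0 (negPf c0) /= => /eqP.
Qed.

Lemma Peps_scale eps c p : c != 0 -> Peps eps p -> Peps eps (hscale c p).
Proof.
move=> c0 [p0 hp]; split; first exact: hscale_neq0.
apply: le_trans hp _; rewrite /dist_Delta.
rewrite (_ : [set (dFS (hscale c p) q)%:E | q in @Delta R n d] = [set (dFS p q)%:E | q in @Delta R n d]) //.
by apply/seteqP; split => _ [q hq <-]; exists q => //; rewrite dFS_scale.
Qed.

Definition unit_rep p : hpoly R n d := hscale (realC (Num.sqrt (N2 p))^-1) p.

Lemma unit_factor_neq0 p : p != 0 -> realC (Num.sqrt (N2 p))^-1 != 0.
Proof.
by move=> p0; rewrite -cm_eq0 cm_realC normr_eq0 invr_eq0 gt_eqF // sqrtr_gt0 N2_gt0.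
Qed.

Lemma N2_unit_rep p : p != 0 -> N2 (unit_rep p) = 1.
Proof.
move=> p0; have h := N2_gt0 p0.
rewrite N2_scale cm_realC ger0_norm ?invr_ge0 ?sqrtr_ge0 // exprVn [Num.sqrt _ ^+ 2]sqr_sqrtr ?N2_ge0 //.
by rewrite mulVf // gt_eqF.
Qed.

Lemma N2_sub_unit p q : N2 p = 1 -> N2 q = 1 ->
  N2 (p - q) = 2 - 2 * complex.Re (bw p q).
Proof.
move=> p1 q1; have -> : 2 - 2 * complex.Re (bw p q) = N2 p + N2 q - 2 * complex.Re (bw p q).
  by rewrite p1 q1.
rewrite !N2E bwE cRe_sum mulr_sumr -big_split /= -sumrB; apply: eq_bigr => a _.
rewrite !ffunE -!cabs2E cabs2_sub.
by case: (p a) (q a) => x1 y1 [x2 y2]; rewrite /cabs2 /cconj /realC /=; ring.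
Qed.

Definition bw_const : R := \sum_a (Num.sqrt (bwt a))^-1.

Lemma bw_const_ge0 : 0 <= bw_const.
Proof. by apply: sumr_ge0 => a _; rewrite invr_ge0 sqrtr_ge0. Qed.

Lemma coefdist_le_N2 p q : coefdist p q <= bw_const * Num.sqrt (N2 (p - q)).
Proof.
rewrite /coefdist mulr_suml; apply: ler_sum => a _.
have w0 := bwt_gt0 a; have s0 : 0 < Num.sqrt (bwt a) by rewrite sqrtr_gt0.
rewrite mulrC ler_pdivlMr //.
have := coef_le_N2 (p - q) a; rewrite !ffunE => /ler_wsqrtr.
by rewrite sqrtrM ?(ltW w0) // sqrtr_sqr ger0_norm ?cm_ge0 // mulrC.
Qed.

Lemma phase_align (b : C) : exists c : C, cm c = 1 /\ cconj c * b = realC (cm b).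
Proof.
have [b0|b0] := eqVneq b 0.
  by exists 1; rewrite cm1 b0 mulr0 cm0; split => //.
have cb : cm b != 0 by rewrite cm_eq0.
exists (b * realC (cm b)^-1); split.
  by rewrite cmM cm_realC ger0_norm ?invr_ge0 ?cm_ge0 // mulfV.
have cr (x : R) : cconj (realC x) = realC x by rewrite /cconj /realC /= oppr0.
by rewrite cconjM cr mulrAC [cconj b * b]mulrC mulc_conj cabs2E -realCM expr2 mulfK.
Qed.

(* Multiplying [q] by a phase makes its product with [p] a nonnegative real. *)
Lemma aligned_N2 p q : N2 p = 1 -> N2 q = 1 -> exists c : C,
  cm c = 1 /\ N2 (p - hscale c q) = 2 - 2 * cm (bw p q).
Proof.
move=> p1 q1; have [c [c1 hc]] := phase_align (bw p q).
have q1' : N2 (hscale c q) = 1 by rewrite N2_scale c1 expr1n mul1r.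
by exists c; split => //; rewrite N2_sub_unit // bw_scaler hc Re_realC.
Qed.

(** Cauchy-Schwarz: after alignment of the phases, 2 - 2 |<p, q>| is a squared norm. *)
Lemma cm_bw_unit p q : N2 p = 1 -> N2 q = 1 -> 0 <= cm (bw p q) <= 1.
Proof.
move=> p1 q1; have [c [_ hN]] := aligned_N2 p1 q1.
by rewrite cm_ge0 /=; have := N2_ge0 (p - hscale c q); rewrite hN; lra.
Qed.

(** For aligned unit vectors at angle t the squared chord is 2 - 2 cos t, at most (2 t)^2; the
    coefficient distance is controlled by the chord. *)
Lemma aligned_dist p q : N2 p = 1 -> N2 q = 1 -> exists c : C,
  [/\ cm c = 1, 0 <= dFS p q & coefdist p (hscale c q) <= bw_const * 2 * dFS p q].
Proof.
move=> p1 q1; have [c [c1 hN]] := aligned_N2 p1 q1.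
have b1 := cm_bw_unit p1 q1; set b := bw p q in hN b1.
have bI : -1 <= cm b <= 1 by case/andP: b1 => b1 b2; rewrite b2 andbT; lra.
have th0 : 0 <= acos (cm b) by exact: acos_ge0.
exists c; rewrite dFS_unit // -/b; split => //.
apply: le_trans (coefdist_le_N2 _ _) _; rewrite -mulrA ler_wpM2l ?bw_const_ge0 //.
rewrite hN; have := one_minus_cos_le th0; rewrite acosK // => h.
have h2 : 2 - 2 * cm b <= (2 * acos (cm b)) ^+ 2.
  by have := sqr_ge0 (acos (cm b)); rewrite exprMn; lra.
apply: le_trans (ler_wsqrtr h2) _; rewrite sqrtr_sqr ger0_norm //; exact: mulr_ge0.
Qed.

Lemma dFS_self p : p != 0 -> dFS p p = 0.
Proof.
move=> p0; have h := N2_gt0 p0.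
rewrite dFSE bw_self cm_realC ger0_norm ?(ltW h) // -expr2 sqrtr_sqr ger0_norm ?(ltW h) //.
by rewrite mulfV ?gt_eqF // acos1.
Qed.

(** A singular p would belong to [Delta], at distance 0 from itself. [Delta] also demands that p
    vanish at the singular point, which Euler's identity provides. *)
Lemma Peps_nonsing eps p : (0 < d)%N -> 0 < eps -> Peps eps p -> nonsing p.
Proof.
move=> d0 e0 [p0 hp] w w0; apply: contrapT => hn.
have hd i : pderiv_eval p i w = 0 by apply/eqP/negPn/negP => h; apply: hn; exists i.
have pw : peval p w = 0.
  have := euler_identity p w; rewrite big1 => [/eqP|i _]; last by rewrite hd mulr0.
  by rewrite eq_sym mulf_eq0 pnatr_eq0 eqn0Ngt d0 /= => /eqP.
have : (eps%:E <= (dFS p p)%:E)%E.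
  apply: le_trans hp _; apply: ereal_inf_lbound; exists p => //; split => //.
  by exists w.
by rewrite dFS_self // lee_fin leNgt e0.
Qed.

Definition Peps_unit (eps : R) : set (hpoly R n d) := [set p | Peps eps p /\ N2 p = 1].

(** Unit norm bounds the coefficients, whence a convergent subsequence. The distance condition is
    closed because it can be checked for one q of [Delta] at a time, where it reads |<p, q>| / |q|
    <= cos eps, an inequality continuous in p. *)
Lemma Peps_unit_compact eps : seq_compact (Peps_unit eps).
Proof.
move=> u hu.
pose B : R := \sum_a (1 + (bwt a)^-1).
have [|phi [l [hphi hl]]] := @complex_subsequence R _ (fun k => u k : mon n d -> C) B.
  move=> k a; have [_ u1] := hu k.
  have w0 := bwt_gt0 a; have := coef_le_N2 (u k) a; rewrite u1 mulrC -ler_pdivlMr // div1r => h.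
  apply: (@le_trans _ _ (1 + (bwt a)^-1)).
    have := cm_ge0 (u k a); have : 0 < (bwt a)^-1 by rewrite invr_gt0.
    by move: h; move: (cm _) (bwt a)^-1 => x y; nra.
  rewrite /B (bigD1 a) //= lerDl; apply: sumr_ge0 => b _.
  by rewrite addr_ge0 // invr_ge0 ltW // bwt_gt0.
pose p : hpoly R n d := [ffun a => l a].
have hp a : ccvg \oo (fun k => u (phi k) a) (p a) by rewrite ffunE.
have p1 : N2 p = 1.
  have h1 : (\sum_a bwt a * cm (u (phi k) a) ^+ 2) @[k --> \oo] --> \sum_a bwt a * cm (p a) ^+ 2.
    exact: (cvg_weighted_cm2 (kap := bwt) hp).
  rewrite N2E -(cvg_lim (@Rhausdorff R) h1); apply: cvg_lim; first exact: Rhausdorff.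
  rewrite (_ : (fun k => _) = cst 1); first exact: cvg_cst.
  by apply/funext => k; rewrite -N2E; have [] := hu (phi k).
have p0 : p != 0.
  apply/eqP => p0; move: p1; rewrite p0 N2E big1 => [/eqP|a _].
    by rewrite eq_sym oner_eq0.
  by rewrite ffunE cm0 expr0n mulr0.
have hcoef : coefdist (u (phi k)) p @[k --> \oo] --> 0.
  suff gen (r : seq (mon n d)) : (\sum_(a <- r) cm (u (phi k) a - p a)) @[k --> \oo] --> 0 by exact: gen.
  elim: r => [|a r ih]; first by under eq_fun do rewrite big_nil; exact: cvg_cst.
  under eq_fun do rewrite big_cons.
  suff : (cm (u (phi k) a - p a) + \sum_(b <- r) cm (u (phi k) b - p b)) @[k --> \oo] -->
      cm (p a - p a) + 0 by rewrite subrr cm0 addr0.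
  apply: cvgD ih; apply: ccvg_cm; apply: ccvgD => //; apply: ccvgN; exact: ccvg_cst.
exists phi, p; split => //; split => //; split => //; split => //.
apply: le_ereal_inf_tmp => _ [q qD <-]; rewrite lee_fin.
have q0 : q != 0 by case: qD.
have nq := N2_gt0 q0; have sq : 0 < Num.sqrt (N2 q) by rewrite sqrtr_gt0.
have hcs r : N2 r = 1 -> 0 <= cm (bw r q) / Num.sqrt (N2 q) <= 1.
  move=> r1; have := cm_bw_unit r1 (N2_unit_rep q0).
  have i0 : 0 <= (Num.sqrt (N2 q))^-1 by rewrite invr_ge0 ltW.
  by rewrite /unit_rep bw_scaler cmM cm_conj cm_realC (ger0_norm i0) mulrC.
have dE r : N2 r = 1 -> dFS r q = acos (cm (bw r q) / Num.sqrt (N2 q)).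
  by move=> r1; rewrite dFSE r1 mul1r.
have cI (x : R) : 0 <= x <= 1 -> -1 <= x <= 1 by move=> /andP[a b]; rewrite b andbT; lra.
have heps k : eps <= dFS (u (phi k)) q.
  have [[_ h] _] := hu (phi k); rewrite -lee_fin; apply: le_trans h _.
  by apply: ereal_inf_lbound; exists q.
have [e0|e0] := leP eps 0.
  by apply: (le_trans e0); rewrite dE // acos_ge0 // cI // hcs.
have u1 k : N2 (u (phi k)) = 1 by have [] := hu (phi k).
(* The cosine is monotone only on [0, pi]; the presence of some q in [Delta] forces eps into this
   interval. *)
have epi : eps <= pi.
  by apply: le_trans (heps 0%N) _; rewrite dE // acos_lepi // cI // hcs.
have hk k : cm (bw (u (phi k)) q) / Num.sqrt (N2 q) <= cos eps.
  have := heps k; rewrite dE // => h; have c1 := cI _ (hcs _ (u1 k)).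
  rewrite -[leLHS]acosK ?in_itv //= leNgt ltr_cos -?leNgt // in_itv /=.
    by rewrite acos_ge0 // acos_lepi.
  by rewrite (ltW e0).
have cvb : ccvg \oo (fun k => bw (u (phi k)) q) (bw p q).
  rewrite bwE; under eq_fun do rewrite bwE.
  by apply: ccvg_sum => a _; apply: ccvgM; [apply: ccvgM => //|]; exact: ccvg_cst.
have hlim : cm (bw p q) / Num.sqrt (N2 q) <= cos eps.
  have h : (cm (bw (u (phi k)) q) / Num.sqrt (N2 q)) @[k --> \oo] --> cm (bw p q) / Num.sqrt (N2 q).
    by apply: cvgM; [exact: ccvg_cm|exact: cvg_cst].
  by apply: (cvgr_to_le h); apply: nearW.
rewrite dE // leNgt -ltr_cos ?in_itv /= ?(ltW e0) ?epi //; last first.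
  by rewrite acos_ge0 ?acos_lepi // cI // hcs.
by rewrite acosK ?in_itv //= -?leNgt // cI // hcs.
Qed.

End BombieriWeyl.

(** * Local and global bounds on the inner distance *)

Section InnerDistance.
Variables (R : realType) (n d : nat).
Local Notation C := (complex R).
Implicit Types (p q : hpoly R n d).

(** The endpoints of an admissible curve are prescribed only up to scalars, so a curve for the
    scaled pair also joins the original one. *)
Lemma W2in_scale (c c' : C) p q : c != 0 -> c' != 0 ->
  (W2in p q <= W2in (hscale c p) (hscale c' q))%E.
Proof.
move=> c0 c'0; apply: esqrt_mono; apply: ereal_inf_le_tmp => _ [g [g0 [[k [k0 hk]] [[k' [k'0 hk']] ac]]] <-].
exists g => //; split => //; split.
  exists (k * c); rewrite mulf_neq0 //; split => //; rewrite hk.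
  by apply/ffunP => a; rewrite !ffunE mulrA.
split => //; exists (k' * c'); rewrite mulf_neq0 //; split => //; rewrite hk'.
by apply/ffunP => a; rewrite !ffunE mulrA.
Qed.

Lemma W2in_curve dl (L M : R) (g : R -> hpoly R n d) : 0 < dl -> 0 <= L -> 0 <= M ->
  (forall p q, good dl p -> good dl q -> (W2 (muP p) (muP q) <= (L * coefdist p q)%:E)%E) ->
  (forall t, 0 <= t <= 1 -> good dl (g t)) ->
  (forall s t, 0 <= s <= 1 -> 0 <= t <= 1 -> coefdist (g s) (g t) <= M * `|s - t|) ->
  (W2in (g 0%R) (g 1%R) <= (L * M)%:E)%E.
Proof.
move=> dl0 L0 M0 hL gg hg.
have one_scale p : p = [ffun a => 1 * p a] by apply/ffunP => a; rewrite ffunE mul1r.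
apply: (@W2in_le_lip _ _ _ _ _ g _ 1 1); rewrite ?oner_neq0 ?mulr_ge0 //.
  by move=> t t01; apply: nonsing_neq0; apply: good_nonsing (gg t t01).
move=> s t s01 t01; apply: le_trans (hL _ _ (gg s s01) (gg t t01)) _.
by rewrite lee_fin -mulrA ler_wpM2l // hg.
Qed.

Lemma W2in_segment dl (L : R) p q : 0 < dl -> 0 <= L ->
  (forall p q, good (dl / 2) p -> good (dl / 2) q ->
     (W2 (muP p) (muP q) <= (L * coefdist p q)%:E)%E) ->
  good dl p -> coefdist p q <= good_radius d dl ->
  (W2in p q <= (L * coefdist p q)%:E)%E.
Proof.
move=> dl0 L0 hL gp h.
have := @W2in_curve (dl / 2) L (coefdist p q) (fun t => pencil p q (realC t)).
rewrite pencil0 pencil1; apply => //; rewrite ?divr_gt0 ?coefdist_ge0 //.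
- move=> t /andP[t0 t1]; apply: (good_within gp); apply: le_trans h.
  rewrite -{1}(pencil0 p q) coefdist_pencil sub0r cmN cm_realC ger0_norm //.
  by rewrite ler_piMl // coefdist_ge0.
- move=> s t _ _; rewrite coefdist_pencil mulrC.
  have -> : realC s - realC t = realC (s - t) by rewrite !realCE rmorphB.
  by rewrite cm_realC.
Qed.

(* Otherwise a sequence of counterexamples converges to a pair joined by a good path, and
   small perturbations of that path join the pairs of the sequence with bounded energy. *)
Lemma W2in_bounded (S : set (hpoly R n d)) : (0 < d)%N -> seq_compact S ->
  (forall p, S p -> nonsing p) ->
  exists2 K : R, 0 <= K & forall p q, S p -> S q -> (W2in p q <= K%:E)%E.
Proof.
move=> d0 cS nS; apply: contrapT => hn.
have /choice[u hu] : forall k : nat, exists pq : hpoly R n d * hpoly R n d,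
    [/\ S pq.1, S pq.2 & ~ (W2in pq.1 pq.2 <= (k%:R)%:E)%E].
  move=> k; apply: contrapT => h; apply: hn; exists k%:R => // p q Sp Sq.
  by apply: contrapT => h2; apply: h; exists (p, q).
have [phi [p [hphi [Sp cvp]]]] := cS (fun k => (u k).1) (fun k => let: And3 a _ _ := hu k in a).
have [psi [q [hpsi [Sq cvq]]]] := cS (fun k => (u (phi k)).2) (fun k => let: And3 _ b _ := hu (phi k) in b).
have [g [M [dl [M0 dl0 g0 g1 [gM gg]]]]] := nonsing_path (nS p Sp) (nS q Sq).
have dl2 : 0 < dl / 2 by rewrite divr_gt0.
have [L L0 hL] := W2_muP_lip n d0 dl2.
(* The two end perturbations are smaller than e: their sum stays within [good_radius], which keeps
   the perturbed path good, and below 1, which adds at most 1 to the Lipschitz constant M. *)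
pose e := Num.min (good_radius d dl / 2) (1 / 2).
have e0 : 0 < e by rewrite lt_min; have := good_radius_gt0 d dl0; move=> h; apply/andP; split; lra.
have e1 : e + e <= good_radius d dl.
  have : e <= good_radius d dl / 2 by rewrite ge_min lexx.
  by lra.
have e2 : e + e <= 1.
  have : e <= 1 / 2 by rewrite ge_min lexx orbT.
  by lra.
have cvp' : coefdist (u (phi (psi k))).1 p @[k --> \oo] --> 0.
  exact: (cvg_comp _ _ (cvg_subsequence hpsi) cvp).
suff : \forall k \near \oo, False by move/filter_ex => [].
near=> k.
have ha : coefdist (u (phi (psi k))).1 p < e by near: k; exact: coefdist_lt.
have hb : coefdist (u (phi (psi k))).2 q < e by near: k; exact: coefdist_lt.
have hk : L * (M + 1) <= (phi (psi k))%:R.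
  apply: (@le_trans _ _ k%:R); last first.
    by rewrite ler_nat (leq_trans (homo_ltn_geq hpsi k)) // homo_ltn_geq.
  near: k; exact: nbhs_infty_ger.
have [_ _] := hu (phi (psi k)); apply.
set a := (u (phi (psi k))).1 in ha *; set b := (u (phi (psi k))).2 in hb *.
apply: (@le_trans _ _ (L * (M + 1))%:E); last by rewrite lee_fin.
(* The path g corrected by the linear interpolation of its two end defects, hence a path from a to
   b. *)
pose h t : hpoly R n d := [ffun i => g t i + realC (1 - t) * (a i - p i) + realC t * (b i - q i)].
have h0 : h 0 = a.
  apply/ffunP => i; rewrite ffunE g0 subr0 /realC.
  by rewrite -[Complex 1 0]/(1 : C) -[Complex 0 0]/(0 : C) mul1r mul0r addr0 addrC subrK.
have h1 : h 1 = b.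
  apply/ffunP => i; rewrite ffunE g1 subrr /realC.
  by rewrite -[Complex 1 0]/(1 : C) -[Complex 0 0]/(0 : C) mul1r mul0r addr0 addrC subrK.
have rB s t : realC (s - t) = realC s - realC t :> C by rewrite !realCE rmorphB.
rewrite -h0 -h1; apply: (W2in_curve dl2 L0 _ hL) => //; first by lra.
- move=> t /andP[t0 t1]; apply: (good_within (gg t _)); first by rewrite t0.
  apply: le_trans e1; apply: (@le_trans _ _ (coefdist a p + coefdist b q)); last first.
    by rewrite lerD // ltW.
  rewrite /coefdist -big_split /=; apply: ler_sum => i _; rewrite ffunE.
  have -> : g t i - (g t i + realC (1 - t) * (a i - p i) + realC t * (b i - q i)) =
    - (realC (1 - t) * (a i - p i) + realC t * (b i - q i)) by ring.
  rewrite cmN; apply: le_trans (cmD _ _) _; rewrite !cmM !cm_realC !ger0_norm ?subr_ge0 //.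
  by rewrite lerD // ler_piMl ?cm_ge0 // lerBlDr lerDl.
- move=> s t s01 t01; apply: (@le_trans _ _ (coefdist (g s) (g t) + `|s - t| * (coefdist a p + coefdist b q))).
    rewrite /coefdist mulrDr !mulr_sumr -!big_split /=; apply: ler_sum => i _; rewrite !ffunE.
    have -> : g s i + realC (1 - s) * (a i - p i) + realC s * (b i - q i) -
       (g t i + realC (1 - t) * (a i - p i) + realC t * (b i - q i)) =
       (g s i - g t i) + (realC (t - s) * (a i - p i) + realC (s - t) * (b i - q i)).
      by rewrite !rB; ring.
    apply: le_trans (cmD _ _) _; rewrite lerD2l; apply: le_trans (cmD _ _) _.
    by rewrite !cmM !cm_realC (distrC t).
  rewrite mulrDl mul1r; apply: lerD; first exact: gM.
  rewrite ler_piMr //; apply: le_trans e2; by rewrite lerD // ltW.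
Unshelve. all: by end_near. Qed.

End InnerDistance.

(** * Lipschitz estimate and compactness *)

Theorem mainTheorem15 (R : realType) (n d : nat) (eps : R) :
  (1 <= n)%N -> (1 <= d)%N -> 0 < eps ->
  (exists L : R, 0 <= L /\
     forall p q : hpoly R n d, Peps eps p -> Peps eps q ->
       (W2in p q <= (L * dFS p q)%:E)%E)
  /\
  (forall u : nat -> hpoly R n d, (forall k, Peps eps (u k)) ->
     exists (phi : nat -> nat) (q : hpoly R n d),
       {homo phi : a b / (a < b)%N} /\ Peps eps q /\
       (W2in (u (phi k)) q @[k --> \oo] --> 0%E)).
Proof.
move=> n0 d0 eps0.
pose S : set (hpoly R n d) := Peps_unit eps.
have cS : seq_compact S := @Peps_unit_compact R n d eps.
have nS (p : hpoly R n d) : S p -> nonsing p by move=> [hp _]; exact: Peps_nonsing hp.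
have [dl dl0 gS] := good_uniform cS nS.
have dl2 : 0 < dl / 2 by rewrite divr_gt0.
have [L L0 hL] := W2_muP_lip n d0 dl2.
have [K K0 hK] := W2in_bounded d0 cS nS.
have unitS p : Peps eps p -> S (unit_rep p).
  move=> hp; have [p0 _] := hp; split; last exact: N2_unit_rep.
  exact: Peps_scale (unit_factor_neq0 p0) hp.
have near (p q : hpoly R n d) : S p -> coefdist p q <= good_radius d dl -> (W2in p q <= (L * coefdist p q)%:E)%E.
  by move=> Sp; apply: W2in_segment (gS p Sp).
have r0 := good_radius_gt0 d dl0; set r := good_radius d dl in near r0.
split.
  pose B : R := bw_const R n d * 2.
  have B0 : 0 <= B by rewrite mulr_ge0 // bw_const_ge0.
  (* L serves pairs whose aligned representatives are within r. For the others r < B dFS, so the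
     uniform bound K is at most (K / r) B dFS. *)
  exists ((L + K / r) * B); split.
    by rewrite mulr_ge0 // addr_ge0 // divr_ge0 // ltW.
  move=> p q hp hq; have [p0 _] := hp; have [q0 _] := hq.
  have cp := unit_factor_neq0 p0; have cq := unit_factor_neq0 q0.
  have -> : dFS p q = dFS (unit_rep p) (unit_rep q).
    by rewrite dFS_scale // [RHS]dFSC dFS_scale // dFSC.
  apply: le_trans (W2in_scale p q cp cq) _; rewrite -/(unit_rep p) -/(unit_rep q).
  move: (unit_rep p) (unit_rep q) (unitS p hp) (unitS q hq) => {p q hp hq p0 q0 cp cq} p q Sp Sq.
  have [c [c1 th0 hc]] := aligned_dist Sp.2 Sq.2.
  rewrite -/B in hc.
  have c0 : c != 0 by rewrite -cm_eq0 c1 oner_eq0.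
  have Kr : 0 <= K / r by rewrite divr_ge0 // ltW.
  have [h|h] := leP (coefdist p (hscale c q)) r.
    apply: le_trans (W2in_scale p q (oner_neq0 _) c0) _.
    have -> : hscale 1 p = p by apply/ffunP => a; rewrite ffunE mul1r.
    apply: le_trans (near _ _ Sp h) _; rewrite lee_fin -mulrA.
    apply: le_trans (ler_wpM2l L0 hc) _.
    by apply: ler_wpM2r; [exact: mulr_ge0|rewrite lerDl].
  apply: le_trans (hK p q Sp Sq) _; rewrite lee_fin -mulrA.
  apply: (@le_trans _ _ (K / r * (B * dFS p q))); last first.
    by apply: ler_wpM2r; [exact: mulr_ge0|rewrite lerDr].
  apply: (@le_trans _ _ (K / r * r)); first by rewrite divfK // gt_eqF.
  by rewrite ler_wpM2l // (le_trans (ltW h)).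
move=> u hu.
(* Compactness is applied to unit representatives. By [W2in_scale] the bound for them carries over
   to the given polynomials, and near the limit the local estimate bounds [W2in] by the coefficient
   distance. *)
have [phi [q [hphi [Sq cvq]]]] := cS (fun k => unit_rep (u k)) (fun k => unitS _ (hu k)).
exists phi, q; split => //; split; first exact: Sq.1.
apply: (@squeeze_cvge _ _ _ _ (fun=> 0%E) _ (fun k => (L * coefdist (unit_rep (u (phi k))) q)%:E)).
- near=> k; rewrite esqrt_ge0 /=.
  have [uk0 _] := hu (phi k).
  apply: le_trans (W2in_scale _ q (unit_factor_neq0 uk0) (oner_neq0 _)) _.
  have -> : hscale 1 q = q by apply/ffunP => a; rewrite ffunE mul1r.
  apply: near; first exact: unitS.
  by apply: ltW; near: k; exact: coefdist_lt.
- exact: cvg_cst.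
- apply: cvg_EFin; first exact: nearW.
  by rewrite -(mulr0 L); apply: cvgMr.
Unshelve. all: by end_near. Qed.
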